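(* Let $n\ge 1$. For each $a>0$ there exist $a'>0$ and a constant $C$ such that for all $u\in C_{\rm c}(\mathbb{R}^n)$, $$\| S_a u \|_{L^1(\mathbb{R}^n;\gamma)} \le C\,\|T^{*}_{a'} u\|_{L^1(\mathbb{R}^n;\gamma)},$$ where $S_a$ is the conical square function with parameter $a$ and $T^*_{a'}$ is the non-tangential maximal function with parameter $a'$ associated with the Ornstein-Uhlenbeck semigroup. The constant $C$ does not depend on $u$.
   Context: $\gamma$ is the standard gaussian measure on $\mathbb{R}^n$, $d\gamma(x)=(2\pi)^{-n/2}\exp(-\tfrac12|x|^2)\,dx$. $L$ is the Ornstein-Uhlenbeck operator, $Lf(x)=-\Delta f(x)+x\cdot\nabla f(x)$, and $(e^{-tL})_{t\ge 0}$ is the Ornstein-Uhlenbeck semigroup, given for $t>0$ by $e^{-tL}u(x)=\int_{\mathbb{R}^n}u\big(e^{-t}x+\sqrt{1-e^{-2t}}\,y\big)\,d\gamma(y)$. $C_{\rm c}(\mathbb{R}^n)$ is the space of continuous compactly supported functions. $B(y,t)$ is the euclidean ball with centre $y$ and radius $t$. Put $m(x)=\min\{1,\frac1{|x|}\}$ (with $m(0)=1$). For $a>0$ and $x\in\mathbb{R}^n$ the admissible cone with parameter $a$ based at $x$ is $$\Gamma_x^{a}(\gamma)=\{(y,t)\in\mathbb{R}^n\times(0,\infty)\colon |y-x|<t<a\,m(x)\}.$$ For $u\in C_{\rm c}(\mathbb{R}^n)$ define the conical square function $$S_a u(x)=\Big(\int_{\Gamma_x^{a}(\gamma)}\frac{1}{\gamma(B(y,t))}\,|t\nabla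 e^{-t^2L}u(y)|^2\,d\gamma(y)\,\frac{dt}{t}\Big)^{1/2}$$ (the gradient is taken in the space variable), and the non-tangential maximal function $$T_a^*u(x)=\sup_{(y,t)\in\Gamma_x^{a}(\gamma)}\Big(\frac{1}{\gamma(B(y,t))}\int_{B(y,t)}|e^{-t^2L}u(z)|^2\,d\gamma(z)\Big)^{1/2}.$$ *)

(* Defs.v *)
From HB Require Import structures.
From mathcomp Require Import all_boot all_order all_algebra.
From mathcomp Require Import all_classical all_reals all_analysis.
From mathcomp Require Import measurable_realfun.

Set Implicit Arguments.
Unset Strict Implicit.
Unset Printing Implicit Defensive.

Import Order.TTheory GRing.Theory Num.Theory.
Import numFieldNormedType.Exports.

Local Open Scope classical_set_scope.
Local Open Scope ring_scope.

Definition measure_rV_display : measure_display -> measure_display.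
Proof. exact. Qed.

(* The product sigma-algebra on row vectors, generated by the coordinate maps,
   as the library does for tuples; on 'rV[R]_n with R : realType it is the
   Borel sigma-algebra. *)
Section measurable_rV.
Context {d} {T : measurableType d} (n : nat).

Let coors : 'I_n -> 'rV[T]_n -> T := fun i x => x ord0 i.

Let rV_set0 : g_sigma_preimage coors set0.
Proof. exact: sigma_algebra0. Qed.

Let rV_setC A : g_sigma_preimage coors A -> g_sigma_preimage coors (~` A).
Proof. exact: sigma_algebraC. Qed.

Let rV_bigcup (F : _^nat) : (forall i, g_sigma_preimage coors (F i)) ->
  g_sigma_preimage coors (\bigcup_i (F i)).
Proof. exact: sigma_algebra_bigcup. Qed.

HB.instance Definition _ := @isMeasurable.Build (measure_rV_display d)
  'rV[T]_n (g_sigma_preimage coors) rV_set0 rV_setC rV_bigcup.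

End measurable_rV.

Section measurable_fun_rV.
Context {d} {T : measurableType d}.

Lemma measurable_coord_rV n (i : 'I_n) :
  measurable_fun [set: 'rV[T]_n] (fun x => x ord0 i).
Proof.
move=> _ Y mY; rewrite setTI; apply: sub_sigma_algebra => /=.
rewrite -bigcup_seq/=; exists i => /=; first by rewrite mem_index_enum.
by exists Y => //; rewrite setTI.
Qed.

Lemma measurable_fun_rV {d'} {S : measurableType d'} n (f : S -> 'rV[T]_n) :
  (forall i, measurable_fun [set: S] (fun s => f s ord0 i)) ->
  measurable_fun [set: S] f.
Proof.
move=> mf.
suff : g_sigma_preimage (fun i s => f s ord0 i) `<=` @measurable _ S.
  rewrite (g_sigma_preimage_comp (fun i (x : 'rV[T]_n) => x ord0 i)) => sub.
  by move=> _ Y mY; apply: sub; exists Y.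
apply: smallest_sub; first exact: sigma_algebra_measurable.
case: n => [|n] in f mf *; first by rewrite big_ord0.
rewrite -bigcup_mkord_ord; apply: bigcup_sub => i Ii.
by move=> A [B mB <-]; exact: mf.
Qed.

Definition rV_cons n (p : 'rV[T]_n * T) : 'rV[T]_n.+1 :=
  \row_i (if unlift ord0 i is Some j then p.1 ord0 j else p.2).

Lemma measurable_rV_cons n : measurable_fun [set: 'rV[T]_n * T] (@rV_cons n).
Proof.
apply: measurable_fun_rV => i; rewrite /rV_cons.
under eq_fun do rewrite mxE.
case: (unlift ord0 i) => [j|]; last exact: measurable_snd.
exact: (measurableT_comp (measurable_coord_rV j) measurable_fst).
Qed.

End measurable_fun_rV.

Section lebesgue_measure_rV.
Context {R : realType}.

(* Lebesgue measure on R^n as an iterated product of the one-dimensional one.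
   [pushforward mu f] is a measure only when f is measurable, which cannot be
   inferred: hence the explicit use of the instance. *)
Fixpoint lebesgue_measure_rV n : {measure set 'rV[R]_n -> \bar R} :=
  match n with
  | 0 => \d_ (0 : 'rV[R]_0)
  | n'.+1 => measure_function_pushforward__canonical__measure_function_Measure
      (lebesgue_measure_rV n' \x @lebesgue_measure R)%E
      (@measurable_rV_cons _ R n')
  end.

End lebesgue_measure_rV.

Section euclidean.
Context {R : realType} {n : nat}.
Implicit Types (x y : 'rV[R]_n) (t : R).

(* The norm `|x| of 'rV[R]_n in the library is the sup norm. *)
Definition enorm x : R := Num.sqrt (\sum_i x ord0 i ^+ 2).

Definition eball y t : set 'rV[R]_n := [set z | enorm (z - y) < t].

Definition gradient (f : 'rV[R]_n -> R) x : 'rV[R]_n :=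
  \row_i 'D_(delta_mx ord0 i) f x.

Definition continuous_compact_support (u : 'rV[R]_n -> R) :=
  continuous u /\ compact (closure [set x | u x != 0]).

Lemma measurable_enorm : measurable_fun [set: 'rV[R]_n] enorm.
Proof.
apply: (@measurableT_comp _ _ _ _ _ _ (@Num.sqrt R)) => //.
  by apply: continuous_measurable_fun; exact: sqrt_continuous.
by apply: measurable_sum => i; apply: measurable_funX; exact: measurable_coord_rV.
Qed.

End euclidean.

Section gaussian_measure.
Context {R : realType} {n : nat}.

Definition gaussian_density (x : 'rV[R]_n) : R :=
  (2 * pi) `^ (- (n%:R / 2)) * expR (- (enorm x ^+ 2 / 2)).

Definition gaussian_measure (A : set 'rV[R]_n) : \bar R :=
  (\int[lebesgue_measure_rV n]_(x in A) (gaussian_density x)%:E)%E.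

Let gaussian_density_ge0 x : (0 <= (gaussian_density x)%:E)%E.
Proof. by rewrite lee_fin mulr_ge0 ?powR_ge0 ?expR_ge0. Qed.

Let measurable_gaussian_density :
  measurable_fun [set: 'rV[R]_n] (EFin \o gaussian_density).
Proof.
apply/measurable_EFinP; apply: measurable_funM => //.
apply: (@measurableT_comp _ _ _ _ _ _ (@expR R)) => //.
apply: measurableT_comp => //; apply: measurable_funM => //.
by apply: measurable_funX; exact: measurable_enorm.
Qed.

Let gaussian_measure0 : gaussian_measure set0 = 0%E.
Proof. exact: integral_set0. Qed.

Let gaussian_measure_ge0 A : (0 <= gaussian_measure A)%E.
Proof. by apply: integral_ge0 => x _; exact: gaussian_density_ge0. Qed.

Let gaussian_measure_sigma_additive : semi_sigma_additive gaussian_measure.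
Proof. exact: semi_sigma_additive_nng_induced. Qed.

HB.instance Definition _ := isMeasure.Build _ _ _ gaussian_measure
  gaussian_measure0 gaussian_measure_ge0 gaussian_measure_sigma_additive.

End gaussian_measure.

Section ornstein_uhlenbeck.
Context {R : realType} {n : nat}.
Implicit Types (x y : 'rV[R]_n) (a t : R) (u : 'rV[R]_n -> R).

Local Notation gamma := (@gaussian_measure R n).
Local Notation lambda := (@lebesgue_measure R).

(* e^{-tL} u for t > 0, by Mehler's formula *)
Definition ou_semigroup t u x : R :=
  \int[gamma]_y u (expR (- t) *: x + Num.sqrt (1 - expR (- (2 * t))) *: y).

(* The case split is needed because 0^-1 = 0 in the library. *)
Definition admissible_radius x : R :=
  if x == 0 then 1 else Num.min 1 (enorm x)^-1.

Definition admissible_cone a x : set ('rV[R]_n * R) :=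
  [set p | [/\ 0 < p.2, enorm (p.1 - x) < p.2 & p.2 < a * admissible_radius x]].

Definition conical_square_function a u x : \bar R :=
  sqrte (\int[gamma \x lambda]_(p in admissible_cone a x)
    ((gamma (eball p.1 p.2))^-1
     * (enorm (p.2 *: gradient (ou_semigroup (p.2 ^+ 2) u) p.1) ^+ 2
        / p.2)%:E))%E.

Definition nontangential_maximal_function a u x : \bar R :=
  ereal_sup [set sqrte ((gamma (eball p.1 p.2))^-1
      * \int[gamma]_(z in eball p.1 p.2)
          (`|ou_semigroup (p.2 ^+ 2) u z| ^+ 2)%:E)%E
    | p in admissible_cone a x].

End ornstein_uhlenbeck.

(* Main.v *)
(** Write v_s = e^{-sL} u, let p = T^* u + eps (with T^* taken for a large
    parameter a'), H(y, t) = inf_{B(y, t)} p and G = 1 / H. By AM-GM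
    S <= (S^2 / p + p) / 2, and by Fubini the integral of S^2 / p is at most a
    constant times the integral of t |grad v_{t^2}(y)|^2 G(y, t) over
    0 < t < kappa, t |y| < kappa, where kappa = a + a^2; so it suffices to bound
    the latter by C \int p.
    On t_{k+1} <= t <= t_k = kappa (4/5)^k one majorizes G by eta_k^2, where
    eta_k is a regularization of sqrt(G(., t_k)) cut off to |y| <= 4 kappa / t_k,
    and uses the local energy inequality for d/ds \int eta_k^2 v_s^2. Its error
    term is \int v_s^2 |grad eta_k|^2, and |grad eta_k|^2 is controlled by
    t^-2 (G(y, 1.2 t) - G(y, 0.9 t)) plus a term which is summable in k. By the
    definition of T^*, averages of v_{t^2}^2 over balls of radius about t are at
    most H^2, and (1/b - 1/a) b^2 <= a - b turns increments of G into increments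
    of H, whose sum over k telescopes.
    No regularity of the semigroup is needed: if Y is the Mehler image of X at
    time h, then (X, Y) is exchangeable under gamma x gamma, Cameron-Martin and
    Cauchy-Schwarz give |d_i P_h w(x)|^2 <= E[(w(Y) - w(x))^2 | X = x] / h, and the
    energy inequality is the limit h -> 0 of an inequality for this quantity. *)

Require Import Defs.
From HB Require Import structures.
From mathcomp Require Import all_boot all_order all_algebra.
From mathcomp Require Import all_classical all_reals all_analysis.
From mathcomp Require Import measurable_realfun.
From mathcomp Require Import ring lra.
Import Order.TTheory GRing.Theory Num.Theory.
Import numFieldNormedType.Exports.
Set Implicit Arguments.
Unset Strict Implicit.
Unset Printing Implicit Defensive.
Local Open Scope classical_set_scope.
Local Open Scope ring_scope.

(** The margin [eps] keeps [p] away from 0, so that 1 / p and all weights are bounded; it is made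
    small only at the very end. The weights live where t |y| is bounded: there the Gaussian density
    varies by a bounded factor on balls of radius t, and gamma of such a ball is comparable to t^n
    times the density at a nearby point. The cutoff has slope c_k = t_k / (2 kappa), so it
    contributes to t_k^2 |grad eta_k|^2 a term of order t_k^4 G: this is the part that is summable
    without cancellation. A square root of G is regularized because the energy inequality involves
    eta^2 and |grad eta|^2, and (B - A)^2 <= B^2 - A^2 for 0 <= A <= B turns the squared increments
    of sqrt G into increments of G; squares of increments would not telescope. All margins are
    fractions of t. The weights use radii from 9/10 t to 12/10 t, the lower one is relaxed to 8/10
    t, that is, to the next scale, and averaging over balls of radius t / 10 widens the pair 8/10,
    12/10 to 7/10, 13/10. With ratio 4/5 such a span is covered by three consecutive scales, so the
    telescoping sum leaves three terms at each end. *)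

Section euclidean_norm.
Context {R : realType} {n : nat}.
Implicit Types (x y z : 'rV[R]_n) (t : R).

Lemma enorm_ge0 x : 0 <= enorm x.
Proof. exact: sqrtr_ge0. Qed.

Lemma enorm_sqr x : enorm x ^+ 2 = \sum_i x ord0 i ^+ 2.
Proof. by rewrite sqr_sqrtr// sumr_ge0// => i _; rewrite sqr_ge0. Qed.

Lemma enorm0 : enorm (0 : 'rV[R]_n) = 0.
Proof.
by rewrite /enorm big1 ?sqrtr0// => i _; rewrite mxE expr0n.
Qed.

Lemma enormZ t x : enorm (t *: x) = `|t| * enorm x.
Proof.
rewrite /enorm -sqrtr_sqr -sqrtrM ?sqr_ge0//; congr Num.sqrt.
by rewrite big_distrr/=; apply: eq_bigr => i _; rewrite mxE exprMn.
Qed.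

Lemma enormN x : enorm (- x) = enorm x.
Proof. by rewrite -scaleN1r enormZ normrN normr1 mul1r. Qed.

Lemma enorm_distC x y : enorm (x - y) = enorm (y - x).
Proof. by rewrite -enormN opprB. Qed.

Lemma coord_le_enorm x i : `|x ord0 i| <= enorm x.
Proof.
rewrite -sqrtr_sqr; apply: ler_wsqrtr; rewrite (bigD1 i)//= lerDl.
by apply: sumr_ge0 => j _; exact: sqr_ge0.
Qed.

Lemma enorm_eq0 x : enorm x = 0 -> x = 0.
Proof.
move=> x0; apply/rowP => i; rewrite mxE; apply/normr0_eq0/eqP.
by rewrite eq_le normr_ge0 andbT -x0 coord_le_enorm.
Qed.

Lemma enorm_dot x y : \sum_i x ord0 i * y ord0 i <= enorm x * enorm y.
Proof.
have [x0|x0] := eqVneq (enorm x) 0.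
  rewrite x0 mul0r (enorm_eq0 x0) big1// => i _.
  by rewrite mxE mul0r.
have [y0|y0] := eqVneq (enorm y) 0.
  rewrite y0 mulr0 (enorm_eq0 y0) big1// => i _.
  by rewrite mxE mulr0.
have -> : enorm x * enorm y = \sum_i 
   (2^-1 * (enorm y / enorm x * x ord0 i ^+ 2)
   + 2^-1 * (enorm x / enorm y * y ord0 i ^+ 2)).
  rewrite big_split/= -!mulr_sumr -!enorm_sqr; field.
  by rewrite x0 y0.
apply: ler_sum => i _.
set a := x _ _; set b := y _ _; set p := enorm x; set q := enorm y.
have -> : 2^-1 * (q / p * a ^+ 2) + 2^-1 * (p / q * b ^+ 2) =
  (2 * p * q)^-1 * (q * a - p * b) ^+ 2 + a * b.
  by field; rewrite /p /q x0 y0.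
by rewrite lerDr mulr_ge0 ?sqr_ge0// invr_ge0 !mulr_ge0// enorm_ge0.
Qed.

Lemma enormD x y : enorm (x + y) <= enorm x + enorm y.
Proof.
rewrite -(ler_pXn2r (_ : 0 < 2)%N) ?nnegrE ?addr_ge0 ?enorm_ge0//.
rewrite sqrrD !enorm_sqr.
have -> : \sum_i (x + y) ord0 i ^+ 2 =
    \sum_i x ord0 i ^+ 2 + (\sum_i x ord0 i * y ord0 i) *+ 2
    + \sum_i y ord0 i ^+ 2.
  rewrite -sumrMnl -!big_split/=; apply: eq_bigr => i _; rewrite mxE; ring.
by rewrite lerD2r lerD2l lerMn2r enorm_dot orbT.
Qed.

Lemma enorm_triangle y x z : enorm (x - z) <= enorm (x - y) + enorm (y - z).
Proof.
have -> : x - z = (x - y) + (y - z) by rewrite addrA subrK.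
exact: enormD.
Qed.

Lemma enorm_le_sum x : enorm x <= \sum_i `|x ord0 i|.
Proof.
rewrite -(ler_pXn2r (_ : 0 < 2)%N) ?nnegrE ?enorm_ge0 ?sumr_ge0//.
rewrite enorm_sqr.
have H : forall s : seq 'I_n, \sum_(i <- s) x ord0 i ^+ 2 <= (\sum_(i <- s) `|x ord0 i|) ^+ 2
    /\ 0 <= \sum_(i <- s) `|x ord0 i|.
  elim=> [|i s [IH IH0]]; first by rewrite !big_nil expr0n.
  rewrite !big_cons; split; last by rewrite addr_ge0.
  rewrite sqrrD real_normK ?num_real// -addrA lerD2l.
  by rewrite (le_trans IH)// lerDr mulrn_wge0// mulr_ge0.
by have [] := H (index_enum 'I_n).
Qed.

Lemma enorm_le_cube x t : (forall i, `|x ord0 i| <= t) -> enorm x <= n%:R * t.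
Proof.
move=> xt; apply: le_trans (enorm_le_sum x) _.
apply: le_trans (ler_sum _ (fun i _ => xt i)) _.
by rewrite sumr_const card_ord mulr_natl.
Qed.

Lemma enorm_sqrD x y : enorm (x + y) ^+ 2 =
  enorm x ^+ 2 + (\sum_i x ord0 i * y ord0 i) *+ 2 + enorm y ^+ 2.
Proof.
rewrite !enorm_sqr -sumrMnl -!big_split/=.
apply: eq_bigr => i _; rewrite mxE; ring.
Qed.

End euclidean_norm.

(** * Measurability of sets and functions that are open or continuous for the Euclidean norm *)

Section measurability.
Context {R : realType}.

Lemma measurable_cube n (c : 'rV[R]_n) (r : R) :
  measurable [set x : 'rV[R]_n | forall i, `|x ord0 i - c ord0 i| < r].
Proof.
have -> : [set x : 'rV[R]_n | forall i, `|x ord0 i - c ord0 i| < r] =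
  \big[setI/setT]_(i <- index_enum 'I_n)
     ((fun x : 'rV[R]_n => x ord0 i) @^-1` [set s | `|s - c ord0 i| < r]).
  apply/seteqP; split => x /=.
    move=> h; elim: (index_enum 'I_n) => [|i s IH]; first by rewrite big_nil.
    by rewrite big_cons; split => //; exact: h.
  move=> + i; have := mem_index_enum i.
  elim: (index_enum 'I_n) => [//|j s IH].
  rewrite inE big_cons => /orP[/eqP->[]//|/IH h [_ /h]//].
apply: big_ind => //; first exact: measurableI.
move=> i _; rewrite -[X in measurable X]setTI; apply: measurable_coord_rV => //.
have -> : [set s | `|s - c ord0 i| < r] = ball (c ord0 i) r.
  by apply/seteqP; split => s /=; rewrite /ball/= distrC.
exact: measurable_ball.
Qed.

(** The sigma-algebra is generated by the coordinates, so an open set is exhausted by countably many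
    cubes: those with rational centre and half-side 1 / (k + 1) that it contains. *)
Lemma measurable_eopen n (A : set 'rV[R]_n) :
  (forall x, A x -> exists2 r : R, 0 < r & eball x r `<=` A) -> measurable A.
Proof.
move=> Aopen.
pose q (c : 'rV[rat]_n) : 'rV[R]_n := \row_i ratr (c ord0 i).
pose C (p : 'rV[rat]_n * nat) :=
  [set x : 'rV[R]_n | forall i, `|x ord0 i - q p.1 ord0 i| < p.2.+1%:R^-1].
have -> : A = \bigcup_(p in [set p | C p `<=` A]) C p.
  apply/seteqP; split => [x Ax|x [p pA] /pA //].
  have [r r0 rA] := Aopen _ Ax.
  (* Two points of one cube of half-side 1 / (k + 1) are at Euclidean distance at most 2 n / (k +
     1). *)
  have [k kr] : exists k : nat, n.+1%:R * 2 * k.+1%:R^-1 < r.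
    pose k := Num.truncn (n.+1%:R * 2 / r).
    exists k; rewrite ltr_pdivrMr ?ltr0n// [ltRHS]mulrC -ltr_pdivrMr//.
    exact: truncnS_gt.
  have /choice[c cP] : forall i, exists c : rat, `|x ord0 i - ratr c| < k.+1%:R^-1.
    move=> i.
    have /rat_in_itvoo[c] : x ord0 i - k.+1%:R^-1 < x ord0 i + k.+1%:R^-1.
      by rewrite ltrBlDr -addrA ltrDl addr_gt0// invr_gt0.
    rewrite in_itv/= => /andP[c1 c2]; exists c; rewrite distrC ltr_distl.
    by rewrite c1 c2.
  exists (\row_i c i, k) => [y /= Cy|i]; last by rewrite /q !mxE; exact: cP.
  apply: rA; rewrite /eball/=; apply: le_lt_trans kr.
  apply: (@le_trans _ _ (n%:R * (2 * k.+1%:R^-1))).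
    apply: enorm_le_cube => i; rewrite !mxE.
    have := Cy i; rewrite /= !mxE => yc; have xc := cP i.
    have -> : y ord0 i - x ord0 i = (y ord0 i - ratr (c i)) - (x ord0 i - ratr (c i)) by ring.
    apply: le_trans (ler_normB _ _) _.
    by rewrite mulr_natl mulr2n; apply: lerD; exact: ltW.
  by rewrite mulrA ler_wpM2r// ler_wpM2r// ler_nat.
rewrite bigcup_mkcond; apply: countable_bigcupT_measurable.
  exact: countableP.
by move=> p; case: ifP => // _; exact: measurable_cube.
Qed.

Lemma eball_center n (x : 'rV[R]_n) r : 0 < r -> eball x r x.
Proof. by rewrite /eball/= subrr enorm0. Qed.

Lemma eball_open n (x y : 'rV[R]_n) r : eball x r y ->
  exists2 e : R, 0 < e & eball y e `<=` eball x r.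
Proof.
rewrite /eball/= => yr; exists (r - enorm (y - x)); first by rewrite subr_gt0.
move=> z /=; rewrite ltrBrDr; apply: le_lt_trans; exact: enorm_triangle.
Qed.

Lemma measurable_eball n (x : 'rV[R]_n) r : measurable (eball x r).
Proof. by apply: measurable_eopen => y /eball_open. Qed.

Lemma continuous_rV_eball n (u : 'rV[R]_n -> R) x e : continuous u -> 0 < e ->
  exists2 r : R, 0 < r & forall y, eball x r y -> `|u x - u y| < e.
Proof.
move=> cu e0; have /cvgrPdist_lt/(_ e e0)/nbhs_ballP[r/= r0 rP] := cu x.
exists r => // y yr; apply: rP; split => //= i j.
rewrite /ball/= (ord1 i) distrC; apply: le_lt_trans yr.
by have := coord_le_enorm (y - x) j; rewrite !mxE.
Qed.

(** The hypothesis is continuity in the form in which Lipschitz estimates for [enorm] deliver it;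
    superlevel sets are then open. *)
Lemma eball_continuous_measurable n (u : 'rV[R]_n -> R) :
  (forall x e, 0 < e -> exists2 r : R, 0 < r & forall y, eball x r y -> `|u x - u y| < e) ->
  measurable_fun setT u.
Proof.
move=> cu; apply: (measurability _ (RGenOInfty.measurableE R)) => //.
move=> _ [_ [c ->]] <-; rewrite setTI; apply: measurable_eopen => x /=.
rewrite in_itv/= andbT => cx.
have [r r0 rP] := cu x (u x - c) ltac:(by rewrite subr_gt0).
exists r => // y /rP; rewrite /= in_itv/= andbT ltr_distlC => /andP[+ _].
by rewrite opprB addrCA subrr addr0.
Qed.

Lemma continuous_measurable_rV n (u : 'rV[R]_n -> R) : continuous u ->
  measurable_fun setT u.
Proof.
by move=> cu; apply: eball_continuous_measurable => x e; exact: continuous_rV_eball.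
Qed.

End measurability.

(** * Translation invariance of Lebesgue measure *)

Section lebesgue_rV.
Context {R : realType}.
Local Notation lambda := (@lebesgue_measure R).

(** Half-open intervals keep their length under translation, and their lengths determine the
    measure. *)
Lemma lebesgue_measure_shift (c : R) (A : set R) : measurable A ->
  pushforward lambda (fun x => x + c : measurableTypeR R) A = lambda A.
Proof.
move=> mA.
have mf : measurable_fun [set: R] (fun x : R => x + c : measurableTypeR R).
  by apply: measurable_funD => //; exact: measurable_cst.
pose mu := measure_function_pushforward__canonical__measure_function_Measure lambda mf.
apply/esym; apply: (@lebesgue_measure_unique R mu) => //= _ [[a b]] _ <-.
rewrite /mu/= /pushforward.
have -> : (fun x : R => x + c) @^-1` `]a, b] = `]a - c, b - c]%classic.
  by apply/seteqP; split => x /=; rewrite !in_itv/= ltrBlDr lerBrDr.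
rewrite !lebesgue_measure_itv/= !lte_fin ltrD2r -!EFinB.
by case: ifP => // _; congr (_%:E); ring.
Qed.

Lemma ge0_integral_shift (c : R) (f : R -> \bar R) :
  measurable_fun setT f -> (forall x, (0 <= f x)%E) ->
  (\int[lambda]_x f (x + c)%R = \int[lambda]_x f x)%E.
Proof.
move=> mf f0.
have ms : measurable_fun [set: measurableTypeR R] (fun x : measurableTypeR R => x + c : measurableTypeR R).
  by apply: measurable_funD => //; exact: measurable_cst.
have := @ge0_integral_pushforward _ _ (measurableTypeR R) (measurableTypeR R) R _ ms
  lambda setT f measurableT mf (fun x _ => f0 x).
rewrite preimage_setT /= => <-; apply: eq_measure_integral => A mA _.
exact: lebesgue_measure_shift.
Qed.

(** A named set function to which the measure and sigma-finiteness structures can be attached, so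
    that Tonelli applies to products with it. *)
Definition lebesgue_rV n : set 'rV[R]_n -> \bar R := lebesgue_measure_rV n.

HB.instance Definition _ n := Measure.on (@lebesgue_rV n).

(** Induction along [rV_cons], under which the preimage of a cube is a cube times an interval. For n
    = 0 the measure is a Dirac mass and both sides are 1. *)
Lemma lebesgue_rV_cube n (c : 'rV[R]_n) (r : R) : 0 < r ->
  lebesgue_rV [set x : 'rV[R]_n | forall i, `|x ord0 i - c ord0 i| < r]
  = ((2 * r) ^+ n)%:E.
Proof.
move=> r0; rewrite /lebesgue_rV.
elim: n c => [|n IH] c.
  rewrite expr0 /= diracE mem_set//= => -[].
  by [].
rewrite /= /pushforward.
have -> : (@rV_cons _ R n @^-1` [set x : 'rV[R]_n.+1 | forall i, `|x ord0 i - c ord0 i| < r]) =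
  [set x : 'rV[R]_n | forall i, `|x ord0 i - (\row_j c ord0 (lift ord0 j)) ord0 i| < r]
   `*` [set s | `|s - c ord0 ord0| < r].
  apply/seteqP; split => -[x s] /=.
    move=> h; split => [i|].
      by have := h (lift ord0 i); rewrite !mxE liftK.
    by have := h ord0; rewrite mxE unlift_none.
  move=> [hx hs] i; rewrite mxE; case: unliftP => [j ->|->] //=.
  by have := hx j; rewrite mxE.
have bE : [set s : R | `|s - c ord0 ord0| < r] = `]c ord0 ord0 - r, c ord0 ord0 + r[%classic.
  by apply/seteqP; split => s /=; rewrite in_itv/= ltr_distl.
rewrite product_measure1E; [|exact: measurable_cube|rewrite bE; exact: measurable_itv].
have lE : lambda [set s | `|s - c ord0 ord0| < r] = (2 * r)%:E.
  rewrite bE lebesgue_measure_itv/= lte_fin ifT; last by rewrite ltrD2l gtrN.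
  by rewrite -EFinB; congr (_%:E); ring.
transitivity (((2 * r) ^+ n)%:E * (2 * r)%:E)%E; first by congr (_ * _)%E; [exact: IH|exact: lE].
by rewrite -EFinM exprSr.
Qed.

Lemma lebesgue_rV_sigma_finite n : sigma_finite setT (@lebesgue_rV n).
Proof.
exists (fun k => [set x : 'rV[R]_n | forall i, `|x ord0 i - (0 : 'rV[R]_n) ord0 i| < k.+1%:R]).
  apply/seteqP; split => // x _ /=.
  pose k := Num.truncn (enorm x).
  exists k => // i /=; rewrite mxE subr0.
  apply: le_lt_trans (coord_le_enorm x i) _; exact: truncnS_gt.
move=> k; split; first exact: measurable_cube.
by rewrite lebesgue_rV_cube// ltry.
Qed.

HB.instance Definition _ n := Measure_isSigmaFinite.Build _ _ _ (@lebesgue_rV n)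
  (@lebesgue_rV_sigma_finite n).

Lemma ge0_integral_rV_cons n (f : 'rV[R]_n.+1 -> \bar R) :
  measurable_fun setT f -> (forall x, (0 <= f x)%E) ->
  (\int[@lebesgue_rV n.+1]_x f x =
   \int[@lebesgue_rV n]_x \int[lambda]_r f (rV_cons (x, r)))%E.
Proof.
move=> mf f0.
have mfc : measurable_fun setT (f \o @rV_cons _ R n).
  by apply: measurableT_comp => //; exact: measurable_rV_cons.
rewrite -(@fubini_tonelli1 _ _ _ _ _ (@lebesgue_rV n) lambda (f \o @rV_cons _ R n))//;
  last by move=> x /=; exact: f0.
have := @ge0_integral_pushforward _ _ ('rV[R]_n * measurableTypeR R)%type _ R _ (@measurable_rV_cons _ R n)
   (@lebesgue_rV n \x lambda)%E setT f measurableT mf (fun x _ => f0 x).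
by rewrite preimage_setT => <-.
Qed.

Lemma measurable_addrV n (h : 'rV[R]_n) : measurable_fun setT (fun x : 'rV[R]_n => x + h).
Proof.
apply: measurable_fun_rV => i; under eq_fun do rewrite mxE.
apply: measurable_funD; [exact: measurable_coord_rV|exact: measurable_cst].
Qed.

Lemma ge0_integral_shift_rV n (h : 'rV[R]_n) (f : 'rV[R]_n -> \bar R) :
  measurable_fun setT f -> (forall x, (0 <= f x)%E) ->
  (\int[@lebesgue_rV n]_x f (x + h)%R = \int[@lebesgue_rV n]_x f x)%E.
Proof.
elim: n h f => [|n IH] h f mf f0.
  by apply: eq_integral => x _; congr (f _); apply/rowP => -[].
have mfh : measurable_fun setT (fun x : 'rV[R]_n.+1 => f (x + h)).
  exact: (measurableT_comp mf (@measurable_addrV _ h)).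
rewrite (ge0_integral_rV_cons mfh (fun x => f0 _)) (ge0_integral_rV_cons mf f0).
pose h' := \row_j h ord0 (lift ord0 j).
have mF : measurable_fun setT (fun x : 'rV[R]_n => \int[lambda]_r f (rV_cons (x, r)))%E.
  apply: (@measurable_fun_fubini_tonelli_F _ _ _ _ _ lambda (f \o @rV_cons _ R n)) => //;
    last by move=> x /=; exact: f0.
  by apply: measurableT_comp => //; exact: measurable_rV_cons.
have F0 x : (0 <= \int[lambda]_r f (rV_cons (x, r)))%E by apply: integral_ge0 => r _; exact: f0.
rewrite -(IH h' _ mF F0).
apply: eq_integral => x _.
transitivity (\int[lambda]_r f (rV_cons (x + h', r + h ord0 ord0)%R))%E.
  apply: eq_integral => r _; congr (f _); apply/rowP => i; rewrite !mxE.
  by case: unliftP => [j ->|->] //=; rewrite !mxE.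
apply: (@ge0_integral_shift _ (fun r => f (rV_cons (x + h', r)))) => [|r].
  apply: (measurableT_comp mf).
  exact: (measurableT_comp (@measurable_rV_cons _ R n) (pair1_measurable _)).
exact: f0.
Qed.

End lebesgue_rV.

(** * Integration against a measure with a density *)

Section integral_density.
Local Open Scope ereal_scope.
Context d (T : measurableType d) (R : realType).
Variables (mu nu : {measure set T -> \bar R}) (g : T -> R).
Hypothesis mg : measurable_fun setT g.
Hypothesis g0 : forall x, (0 <= g x)%R.
Hypothesis nuE : forall A, measurable A -> nu A = \int[mu]_(x in A) (g x)%:E.

Import HBNNSimple.

Lemma integral_density_nnsfun (h : {nnsfun T >-> R}) :
  \int[nu]_x (h x)%:E = \int[mu]_x ((h x)%:E * (g x)%:E).
Proof.
have mEg : measurable_fun setT (EFin \o g) by exact/measurable_EFinP.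
under eq_integral do rewrite fimfunE -fsumEFin//.
rewrite ge0_integral_fsum//; last 2 first.
- by move=> r; exact/measurable_EFinP/measurable_funM.
- by move=> r x _; rewrite nnfun_muleindic_ge0.
transitivity (\int[mu]_x \sum_(r \in range h)
    ((r * \1_(h @^-1` [set r]) x)%:E * (g x)%:E)); last first.
  apply: eq_integral => x _; rewrite [in RHS]fimfunE -fsumEFin// ge0_mule_fsuml//.
  by move=> r; by rewrite EFinM nnfun_muleindic_ge0.
rewrite ge0_integral_fsum//; last 2 first.
- move=> r; apply: emeasurable_funM => //.
  exact/measurable_EFinP/measurable_funM.
- move=> r x _; apply: mule_ge0; last by rewrite lee_fin.
  by rewrite EFinM nnfun_muleindic_ge0.
apply: eq_fsbigr => r _.
rewrite integralZl_indic_nnsfun// integral_indic// setIT nuE//.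
have [r0|r0] := leP 0%R r; last first.
  rewrite (preimage_nnfun0 _ r0) integral_set0 mule0.
  by rewrite integral0_eq// => x _; rewrite indicE in_set0 mulr0 mul0e.
rewrite -ge0_integralZl//; last 2 first.
- exact: measurable_funTS.
- by move=> x _; rewrite lee_fin.
rewrite integral_mkcond; apply: eq_integral => x _ /=.
rewrite patchE indicE; case: ifP => _; first by rewrite mulr1.
by rewrite mulr0 mul0e.
Qed.

(** Linearity extends the hypothesis from sets to simple functions; monotone convergence along
    simple approximations of [f], applied to both measures, does the rest. *)
Lemma ge0_integral_density (f : T -> \bar R) :
  measurable_fun setT f -> (forall x, 0 <= f x) ->
  \int[nu]_x f x = \int[mu]_x (f x * (g x)%:E).
Proof.
have mEg : measurable_fun setT (EFin \o g) by exact/measurable_EFinP.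
move=> mf f0; pose f_ := nnsfun_approx measurableT mf.
have cf x : limn (EFin \o f_ ^~ x) = f x.
  by apply/cvg_lim => //; exact: cvg_nnsfun_approx.
transitivity (limn (fun n => \int[nu]_x (f_ n x)%:E)).
  rewrite -monotone_convergence//.
  - by apply: eq_integral => y _; rewrite cf.
  - by move=> n; exact/measurable_EFinP/measurable_funP.
  - by move=> n y _; rewrite lee_fin.
  - by move=> y _ m n mn; rewrite lee_fin; exact/lefP/nd_nnsfun_approx.
under eq_fun do rewrite integral_density_nnsfun.
rewrite -monotone_convergence//.
- apply: eq_integral => y _; apply/cvg_lim => //.
  apply: cvgeZr => //; exact: cvg_nnsfun_approx.
- move=> n; apply: emeasurable_funM => //.
  exact/measurable_EFinP/measurable_funP.
- by move=> n y _; rewrite mule_ge0// lee_fin.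
- move=> y _ m n mn; rewrite lee_wpmul2r// ?lee_fin//; exact/lefP/nd_nnsfun_approx.
Qed.

End integral_density.

(** * The Gaussian measure and its behaviour under translation *)

Section gaussian.
Context {R : realType}.
Local Notation lambda := (@lebesgue_measure R).

Lemma gaussian_density_ge0 n (x : 'rV[R]_n) : 0 <= gaussian_density x.
Proof. by rewrite mulr_ge0 ?powR_ge0 ?expR_ge0. Qed.

Lemma gaussian_density_gt0 n (x : 'rV[R]_n) : 0 < gaussian_density x.
Proof. by rewrite mulr_gt0 ?powR_gt0 ?expR_gt0// mulr_gt0 ?pi_gt0. Qed.

Lemma measurable_gaussian_density n :
  measurable_fun setT (@gaussian_density R n).
Proof.
apply: measurable_funM => //.
apply: (@measurableT_comp _ _ _ _ _ _ (@expR R)) => //.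
apply: measurableT_comp => //; apply: measurable_funM => //.
by apply: measurable_funX; exact: measurable_enorm.
Qed.

Lemma ge0_integral_gaussian n (f : 'rV[R]_n -> \bar R) :
  measurable_fun setT f -> (forall x, (0 <= f x)%E) ->
  (\int[gaussian_measure]_x f x =
   \int[@lebesgue_rV R n]_x (f x * (gaussian_density x)%:E))%E.
Proof.
apply: ge0_integral_density => //; first exact: measurable_gaussian_density.
exact: gaussian_density_ge0.
Qed.

(** Splitting off one coordinate reduces the total mass of the Gaussian measure, by induction, to
    that of the one-dimensional normal law. *)
Lemma gaussian_density_rV_cons n (x : 'rV[R]_n) (r : R) :
  gaussian_density (rV_cons (x, r)) = gaussian_density x * normal_pdf 0 1 r.
Proof.
rewrite normal_pdfE ?oner_neq0// /normal_peak /normal_fun /gaussian_density.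
have -> : enorm (rV_cons (x, r)) ^+ 2 = enorm x ^+ 2 + r ^+ 2.
  rewrite !enorm_sqr big_ord_recl mxE unlift_none addrC; congr (_ + _).
  by apply: eq_bigr => i _; rewrite mxE liftK.
rewrite subr0 expr1n mul1r.
have pi2 : (0 : R) < 2 * pi by rewrite mulr_gt0 ?pi_gt0.
have -> : (Num.sqrt (pi *+ 2))^-1%R = (2 * pi) `^ (- 2^-1) :> R.
  by rewrite powRN powR12_sqrt ?ltW// mulr_natl.
have -> : - ((n.+1)%:R / 2) = - (n%:R / 2) + - 2^-1 :> R.
  by rewrite -addn1 natrD mulrDl mul1r opprD.
rewrite powRD; last by rewrite (gt_eqF pi2) implybT.
have -> : - ((enorm x ^+ 2 + r ^+ 2) / 2) = - (enorm x ^+ 2 / 2) + (- r ^+ 2 / (1 *+ 2)) :> R.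
  by field.
by rewrite expRD; ring.
Qed.

Lemma gaussian_measureT n : @gaussian_measure R n setT = 1%E.
Proof.
rewrite /gaussian_measure.
elim: n => [|n IH].
  rewrite /= integral_dirac//; last first.
    by apply/measurable_EFinP; exact: measurable_gaussian_density.
  rewrite diracT mul1e /gaussian_density mul0r oppr0 powRr0 mul1r.
  by rewrite enorm0 expr0n mul0r oppr0 expR0.
rewrite ge0_integral_rV_cons//; last 2 first.
- by apply/measurable_EFinP; exact: measurable_gaussian_density.
- by move=> x; rewrite lee_fin gaussian_density_ge0.
rewrite -[RHS]IH; apply: eq_integral => x _.
under eq_integral do rewrite gaussian_density_rV_cons EFinM.
rewrite ge0_integralZl//; last 3 first.
- by apply/measurable_EFinP; exact: measurable_normal_pdf.
- by move=> r _; rewrite lee_fin normal_pdf_ge0.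
- by rewrite lee_fin gaussian_density_ge0.
by rewrite integral_normal_pdf mule1.
Qed.

HB.instance Definition _ n := Measure_isProbability.Build _ _ _
  (@gaussian_measure R n) (@gaussian_measureT n).

Lemma gaussian_density_shift n (x h : 'rV[R]_n) :
  gaussian_density (x - h) = gaussian_density x
    * expR (\sum_i x ord0 i * h ord0 i - enorm h ^+ 2 / 2).
Proof.
rewrite /gaussian_density -mulrA; congr (_ * _); rewrite -expRD; congr expR.
rewrite enorm_sqrD enormN.
have -> : \sum_i x ord0 i * (- h) ord0 i = - \sum_i x ord0 i * h ord0 i.
  by rewrite -sumrN; apply: eq_bigr => i _; rewrite mxE mulrN.
by rewrite -mulr_natr; field.
Qed.

(** The exponential is the ratio of the densities at x - h and at x; the identity is translation by
    [h] in the Lebesgue integral on the right. *)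
Lemma cameron_martin n (h : 'rV[R]_n) (f : 'rV[R]_n -> \bar R) :
  measurable_fun setT f -> (forall x, (0 <= f x)%E) ->
  (\int[gaussian_measure]_x f (x + h)%R = \int[gaussian_measure]_x
     (f x * (expR (\sum_i x ord0 i * h ord0 i - enorm h ^+ 2 / 2))%:E))%E.
Proof.
move=> mf f0.
have mfh : measurable_fun setT (fun x : 'rV[R]_n => f (x + h)).
  exact: (measurableT_comp mf (@measurable_addrV _ _ h)).
have me : measurable_fun setT (fun x : 'rV[R]_n =>
    expR (\sum_i x ord0 i * h ord0 i - enorm h ^+ 2 / 2)).
  apply: (@measurableT_comp _ _ _ _ _ _ (@expR R)) => //.
  apply: measurable_funB => //; apply: measurable_sum => i.
  by apply: measurable_funM => //; exact: measurable_coord_rV.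
rewrite !ge0_integral_gaussian//; last 2 first.
- by apply: emeasurable_funM => //; exact/measurable_EFinP.
- by move=> x; rewrite mule_ge0// lee_fin expR_ge0.
rewrite -[RHS](@ge0_integral_shift_rV _ _ h); last 2 first.
- apply: emeasurable_funM; last first.
    by apply/measurable_EFinP; exact: measurable_gaussian_density.
  by apply: emeasurable_funM => //; exact/measurable_EFinP.
- by move=> x; rewrite !mule_ge0// lee_fin ?expR_ge0// gaussian_density_ge0.
apply: eq_integral => x _; rewrite -muleA; congr (_ * _)%E.
by rewrite -EFinM mulrC -gaussian_density_shift addrK.
Qed.

End gaussian.

(** * Bounded measurable functions and probability measures *)

Section bounded_measurable.
Context {R : realType}.

(** This condition implies integrability for every probability measure and, unlike integrability, is
    stable under products and under composition with measurable maps; it makes the algebra of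
    real-valued integrals unconditional. *)
Definition bounded_measurable d (T : measurableType d) (f : T -> R) :=
  measurable_fun setT f /\ exists M, forall x, `|f x| <= M.

Section closure.
Context d (T : measurableType d).
Implicit Types f g : T -> R.

Lemma bounded_measurable_cst c : bounded_measurable (fun _ : T => c).
Proof. by split; [exact: measurable_cst|exists `|c|]. Qed.

Lemma bounded_measurableD f g : bounded_measurable f -> bounded_measurable g ->
  bounded_measurable (fun x => f x + g x).
Proof.
move=> [mf [M fM]] [mg [N gN]]; split; first exact: measurable_funD.
by exists (M + N) => x; rewrite (le_trans (ler_normD _ _))// lerD.
Qed.

Lemma bounded_measurableN f : bounded_measurable f ->
  bounded_measurable (fun x => - f x).
Proof.
move=> [mf [M fM]]; split; first exact: measurableT_comp.
by exists M => x; rewrite normrN.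
Qed.

Lemma bounded_measurableB f g : bounded_measurable f -> bounded_measurable g ->
  bounded_measurable (fun x => f x - g x).
Proof. by move=> bf bg; apply: bounded_measurableD => //; exact: bounded_measurableN. Qed.

Lemma bounded_measurableM f g : bounded_measurable f -> bounded_measurable g ->
  bounded_measurable (fun x => f x * g x).
Proof.
move=> [mf [M fM]] [mg [N gN]]; split; first exact: measurable_funM.
by exists (M * N) => x; rewrite normrM ler_pM.
Qed.

Lemma bounded_measurable_sqr f : bounded_measurable f ->
  bounded_measurable (fun x => f x ^+ 2).
Proof. by move=> bf; under eq_fun do rewrite expr2; exact: bounded_measurableM. Qed.

Lemma bounded_measurable_comp d' (T' : measurableType d') f (h : T' -> T) :
  measurable_fun setT h -> bounded_measurable f -> bounded_measurable (fun x => f (h x)).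
Proof.
move=> mh [mf [M fM]]; split; first exact: (measurableT_comp mf mh).
by exists M.
Qed.

Lemma bounded_measurable_itv f a b : measurable_fun setT f ->
  (forall x, a <= f x <= b) -> bounded_measurable f.
Proof.
move=> mf fab; split => //; exists (`|a| + `|b|) => x.
have /andP[fa fb] := fab x; rewrite ler_norml; apply/andP; split.
  apply: le_trans fa; rewrite lerNl; apply: (@le_trans _ _ `|a|); last by rewrite lerDl.
  by rewrite -normrN ler_norm.
by rewrite (le_trans fb)// (le_trans (ler_norm _))// lerDr.
Qed.

End closure.

Section integral.
Context d (T : measurableType d) (P : probability T R).
Implicit Types f g : T -> R.

Lemma bounded_integrable f : bounded_measurable f -> P.-integrable setT (EFin \o f).
Proof.
move=> [mf [M fM]]; apply: measurable_bounded_integrable => //.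
  exact: le_lt_trans (probability_le1 P measurableT) (ltry 1).
exists M; split; first exact: num_real.
by move=> N MN x _ /=; rewrite (le_trans (fM x))// ltW.
Qed.

Lemma bounded_EFin_Rintegral f : bounded_measurable f ->
  (\int[P]_x f x)%:E = (\int[P]_x (f x)%:E)%E.
Proof.
move=> bf; rewrite /Rintegral fineK//.
apply: integrable_fin_num => //; exact: bounded_integrable.
Qed.

Lemma bounded_RintegralD f g : bounded_measurable f -> bounded_measurable g ->
  \int[P]_x (f x + g x) = \int[P]_x f x + \int[P]_x g x.
Proof. by move=> bf bg; rewrite RintegralD//; exact: bounded_integrable. Qed.

Lemma bounded_RintegralB f g : bounded_measurable f -> bounded_measurable g ->
  \int[P]_x (f x - g x) = \int[P]_x f x - \int[P]_x g x.
Proof. by move=> bf bg; rewrite RintegralB//; exact: bounded_integrable. Qed.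

Lemma bounded_RintegralZl c f : bounded_measurable f ->
  \int[P]_x (c * f x) = c * \int[P]_x f x.
Proof. by move=> bf; rewrite RintegralZl//; exact: bounded_integrable. Qed.

Lemma bounded_le_Rintegral f g : bounded_measurable f -> bounded_measurable g ->
  (forall x, f x <= g x) -> \int[P]_x f x <= \int[P]_x g x.
Proof. by move=> bf bg fg; apply: le_Rintegral => //; exact: bounded_integrable. Qed.

Lemma probability_Rintegral_cst c : \int[P]_x c = c.
Proof. by rewrite Rintegral_cst//= probability_setT mulr1. Qed.

Lemma bounded_Rintegral_norm f M : measurable_fun setT f ->
  (forall x, `|f x| <= M) -> `|\int[P]_x f x| <= M.
Proof.
move=> mf fM; have bf : bounded_measurable f by split => //; exists M.
apply: (le_trans (le_normr_Rintegral _ _)) => //; first exact: bounded_integrable.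
rewrite -[leRHS]probability_Rintegral_cst; apply: bounded_le_Rintegral => //.
  by split; [exact: measurableT_comp|exists M => x; rewrite normr_id].
exact: bounded_measurable_cst.
Qed.

End integral.

Section fubini.
Context d (T : measurableType d) d' (T' : measurableType d') (Q : probability T' R).

Lemma bounded_measurable_Rfubini (F : T * T' -> R) : bounded_measurable F ->
  bounded_measurable (fun x => \int[Q]_z F (x, z)).
Proof.
move=> [mF [M FM]]; split; last first.
  exists M => x; apply: bounded_Rintegral_norm => //.
  exact: (measurableT_comp mF (pair1_measurable x)).
(* Adding the bound [M] makes the integrand nonnegative, so that measurability of the partial
   integral follows from Tonelli. *)
have -> : (fun x => \int[Q]_z F (x, z)) =
    (fun x => fine (\int[Q]_z ((F (x, z) + M)%:E))%E - M).
  apply/funext => x; rewrite -/(Rintegral _ _ _).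
  rewrite bounded_RintegralD ?probability_Rintegral_cst ?addrK//.
    split; last by exists M.
    exact: (measurableT_comp mF (pair1_measurable x)).
  exact: bounded_measurable_cst.
apply: measurable_funB => //.
apply: measurableT_comp => //.
apply: (@measurable_fun_fubini_tonelli_F _ _ _ _ _ Q (fun p => (F p + M)%:E)).
  by apply/measurable_EFinP; apply: measurable_funD => //; exact: measurable_cst.
by move=> x; rewrite lee_fin -lerBlDr sub0r; have := FM x; rewrite ler_norml => /andP[].
Qed.

End fubini.

End bounded_measurable.

(** * Mehler's formula *)

Section gaussian_rotation.
Context {R : realType} {n : nat}.
Local Notation V := 'rV[R]_n.
Local Notation gamma := (@gaussian_measure R n).
Local Notation leb := (@lebesgue_rV R n).
Local Open Scope ereal_scope.

Lemma measurable_lin (a b : R) :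
  measurable_fun setT (fun p : V * V => a *: p.1 + b *: p.2)%R.
Proof.
apply: measurable_fun_rV => i; under eq_fun do rewrite !mxE.
by apply: measurable_funD; apply: measurable_funM => //;
   apply: (measurableT_comp (measurable_coord_rV i)).
Qed.

Lemma measurable_lin_pair (a b c e : R) :
  measurable_fun setT (fun p : V * V => (a *: p.1 + b *: p.2, c *: p.1 + e *: p.2)%R).
Proof. by apply: measurable_fun_pair; exact: measurable_lin. Qed.

Lemma ge0_integral_gaussian2 (f : V * V -> \bar R) :
  measurable_fun setT f -> (forall p, 0 <= f p) ->
  \int[gamma]_x \int[gamma]_z f (x, z) = \int[leb]_x \int[leb]_z
     (f (x, z) * (gaussian_density x * gaussian_density z)%:E).
Proof.
move=> mf f0.
have mg := @measurable_gaussian_density R n.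
rewrite ge0_integral_gaussian; last 2 first.
- exact: (measurable_fun_fubini_tonelli_F f mf f0).
- by move=> x; apply: integral_ge0.
apply: eq_integral => x _.
have mfx : measurable_fun setT (fun z => f (x, z)).
  exact: (measurableT_comp mf (pair1_measurable x)).
rewrite ge0_integral_gaussian// -ge0_integralZr//; last 3 first.
- by apply: emeasurable_funM => //; exact/measurable_EFinP.
- by move=> z _; rewrite mule_ge0// lee_fin gaussian_density_ge0.
- by rewrite lee_fin gaussian_density_ge0.
by apply: eq_integral => z _; rewrite -muleA; congr (_ * _); rewrite -EFinM mulrC.
Qed.

(** At fixed [z] the shear is a translation in [x]; hence the exchange of the order of integration
    on both sides. *)
Lemma lebesgue_shear1 (a : R) (f : V * V -> \bar R) :
  measurable_fun setT f -> (forall p, 0 <= f p) ->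
  \int[leb]_x \int[leb]_z f (x + a *: z, z)%R = \int[leb]_x \int[leb]_z f (x, z).
Proof.
move=> mf f0.
have mfs : measurable_fun setT (fun p : V * V => f (p.1 + a *: p.2, p.2)%R).
  apply: (measurableT_comp mf); have := measurable_lin_pair 1 a 0 1.
  by under eq_fun do rewrite !scale1r scale0r add0r.
rewrite (fubini_tonelli (m1 := leb) (m2 := leb) _ mfs (fun _ => f0 _)).
rewrite (fubini_tonelli (m1 := leb) (m2 := leb) _ mf f0); apply: eq_integral => z _ /=.
rewrite (@ge0_integral_shift_rV _ _ (a *: z) (fun x => f (x, z)))//.
exact: (measurableT_comp mf (pair2_measurable z)).
Qed.

Lemma lebesgue_shear2 (a : R) (f : V * V -> \bar R) :
  measurable_fun setT f -> (forall p, 0 <= f p) ->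
  \int[leb]_x \int[leb]_z f (x, z + a *: x)%R = \int[leb]_x \int[leb]_z f (x, z).
Proof.
move=> mf f0; apply: eq_integral => x _.
rewrite (@ge0_integral_shift_rV _ _ (a *: x) (fun z => f (x, z)))//.
exact: (measurableT_comp mf (pair1_measurable x)).
Qed.

(* A rotation of the plane is a product of three shears, so only translation
   invariance of the Lebesgue measure is needed. *)
Lemma lebesgue_rotation (c s : R) (f : V * V -> \bar R) : s != 0%R ->
  (c ^+ 2 + s ^+ 2 = 1)%R ->
  measurable_fun setT f -> (forall p, 0 <= f p) ->
  \int[leb]_x \int[leb]_z f (c *: x - s *: z, s *: x + c *: z)%R
  = \int[leb]_x \int[leb]_z f (x, z).
Proof.
(* With c = cos(theta) and s = sin(theta) this is a = - tan(theta / 2), the parameter of the outer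
   two shears; the middle one has parameter s. *)
move=> s0 cs mf f0; pose a := (- ((1 - c) / s))%R.
have mS1 : measurable_fun setT (fun p : V * V => (p.1 + a *: p.2, p.2)%R).
  have := measurable_lin_pair 1 a 0 1.
  by under eq_fun do rewrite !scale1r scale0r add0r.
have mS2 : measurable_fun setT (fun p : V * V => (p.1, p.2 + s *: p.1)%R).
  have := measurable_lin_pair 1 0 s 1.
  under eq_fun do rewrite !scale1r scale0r addr0.
  by under eq_fun do rewrite (addrC (s *: _)%R).
have mf1 := measurableT_comp mf mS1.
have mf2 := measurableT_comp mf1 mS2.
rewrite -[RHS](lebesgue_shear1 a mf f0).
rewrite -[RHS](lebesgue_shear2 s mf1 (fun _ => f0 _)).
rewrite -[RHS](lebesgue_shear1 a mf2 (fun _ => f0 _)) /=.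
apply: eq_integral => x _; apply: eq_integral => z _; congr (f (_, _)).
- apply/rowP => i; rewrite !mxE.
  have ea : (c = 1 + a * s)%R by rewrite /a mulNr divfK// opprB addrC subrK.
  (* This says that the off-diagonal entry a + c a of the product of the shears equals - s. *)
  have es : (s + c * a + a = 0)%R.
    apply: (mulIf s0); rewrite mul0r mulrDl mulrDl -(mulrA c a s).
    have -> : (a * s = c - 1)%R by rewrite ea addrC addKr.
    by move: cs; rewrite !expr2 => cs'; lra.
  rewrite ea; move: es; rewrite ea => es.
  have h : ((s + (1 + a * s) * a + a) * z ord0 i = 0)%R by rewrite es mul0r.
  rewrite -[LHS]addr0 -h; ring.
- apply/rowP => i; rewrite !mxE.
  have ea : (c = 1 + a * s)%R by rewrite /a mulNr divfK// opprB addrC subrK.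
  rewrite ea; ring.
Qed.

(** The product density depends on |x|^2 + |z|^2 only, which the rotation preserves. *)
Lemma gaussian_rotation (c s : R) (f : V * V -> \bar R) : s != 0%R ->
  (c ^+ 2 + s ^+ 2 = 1)%R ->
  measurable_fun setT f -> (forall p, 0 <= f p) ->
  \int[gamma]_x \int[gamma]_z f (c *: x - s *: z, s *: x + c *: z)%R
  = \int[gamma]_x \int[gamma]_z f (x, z).
Proof.
move=> s0 cs mf f0.
have mrot : measurable_fun setT (fun p : V * V => (c *: p.1 - s *: p.2, s *: p.1 + c *: p.2)%R).
  have := measurable_lin_pair c (- s) s c.
  by under eq_fun do rewrite scaleNr.
rewrite (ge0_integral_gaussian2 (measurableT_comp mf mrot) (fun _ => f0 _)).
rewrite (ge0_integral_gaussian2 mf f0).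
have mg : measurable_fun setT (fun p : V * V => gaussian_density p.1 * gaussian_density p.2)%R.
  by apply: measurable_funM; apply: measurableT_comp => //; exact: measurable_gaussian_density.
rewrite -[RHS](lebesgue_rotation s0 cs (f := fun p => f p * (gaussian_density p.1 * gaussian_density p.2)%:E)); last 2 first.
- by apply: emeasurable_funM => //; exact/measurable_EFinP.
- by move=> p; rewrite mule_ge0// lee_fin mulr_ge0// gaussian_density_ge0.
apply: eq_integral => x _; apply: eq_integral => z _; congr (_ * _%:E).
rewrite /gaussian_density /= mulrACA [RHS]mulrACA; congr (_ * _)%R.
rewrite -!expRD; congr expR.
rewrite -!opprD -!mulrDl; congr (- (_ / _))%R.
rewrite !enorm_sqr -!big_split/=; apply: eq_bigr => i _; rewrite !mxE.
rewrite -[LHS]mul1r -cs; ring.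
Qed.

End gaussian_rotation.

Section mehler.
Context {R : realType} {n : nat}.
Local Notation V := 'rV[R]_n.
Local Notation gamma := (@gaussian_measure R n).

Definition expect2 (F : V * V -> R) : R := \int[gamma]_x \int[gamma]_z F (x, z).

Lemma expect2E F : expect2 F = \int[gamma]_x \int[gamma]_z F (x, z).
Proof. by []. Qed.

Lemma bounded_measurable_pair1 (F : V * V -> R) x : bounded_measurable F ->
  bounded_measurable (fun z => F (x, z)).
Proof. exact: (bounded_measurable_comp (pair1_measurable x)). Qed.

Lemma EFin_expect2 (F : V * V -> R) : bounded_measurable F ->
  (expect2 F)%:E = (\int[gamma]_x \int[gamma]_z (F (x, z))%:E)%E.
Proof.
move=> bF; rewrite expect2E bounded_EFin_Rintegral; last exact: bounded_measurable_Rfubini.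
apply: eq_integral => x _; rewrite bounded_EFin_Rintegral//.
exact: bounded_measurable_pair1.
Qed.

Lemma eq_expect2 (F G : V * V -> R) : F =1 G -> expect2 F = expect2 G.
Proof. by move=> /funext ->. Qed.

Lemma expect2D (F G : V * V -> R) : bounded_measurable F -> bounded_measurable G ->
  expect2 (fun p => F p + G p) = expect2 F + expect2 G.
Proof.
move=> bF bG; rewrite !expect2E -bounded_RintegralD; [|exact: bounded_measurable_Rfubini..].
apply: eq_Rintegral => x _; rewrite bounded_RintegralD//; exact: bounded_measurable_pair1.
Qed.

Lemma expect2Zl c (F : V * V -> R) : bounded_measurable F ->
  expect2 (fun p => c * F p) = c * expect2 F.
Proof.
move=> bF; rewrite !expect2E -bounded_RintegralZl; last exact: bounded_measurable_Rfubini.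
apply: eq_Rintegral => x _; rewrite bounded_RintegralZl//; exact: bounded_measurable_pair1.
Qed.

Lemma le_expect2 (F G : V * V -> R) : bounded_measurable F -> bounded_measurable G ->
  (forall p, F p <= G p) -> expect2 F <= expect2 G.
Proof.
move=> bF bG FG; apply: bounded_le_Rintegral; [exact: bounded_measurable_Rfubini..|].
move=> x; apply: bounded_le_Rintegral => [||z]; [exact: bounded_measurable_pair1..|].
exact: FG.
Qed.

Lemma expect2_fst (f : V -> R) : expect2 (fun p => f p.1) = \int[gamma]_x f x.
Proof.
rewrite expect2E; apply: eq_Rintegral => x _ /=; exact: probability_Rintegral_cst.
Qed.

(** Passage from nonnegative to bounded integrands: the invariance is applied to [F + M] and the
    constant is subtracted. *)
Lemma expect2_transfer (psi : V * V -> V * V) : measurable_fun setT psi ->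
  (forall f : V * V -> \bar R, measurable_fun setT f -> (forall p, (0 <= f p)%E) ->
    (\int[gamma]_x \int[gamma]_z f (psi (x, z)) = \int[gamma]_x \int[gamma]_z f (x, z))%E) ->
  forall F : V * V -> R, bounded_measurable F ->
    expect2 (fun p => F (psi p)) = expect2 F.
Proof.
move=> mpsi hpsi F [mF [M FM]].
have bF : bounded_measurable F by split => //; exists M.
have bc : bounded_measurable (fun _ : V * V => M : R) by exact: bounded_measurable_cst.
have bpsi := bounded_measurable_comp mpsi bF.
apply: (@addIr _ (expect2 (fun=> M))).
rewrite -(expect2D bF bc) -(expect2D bpsi bc).
apply: EFin_inj; rewrite (EFin_expect2 (bounded_measurableD bpsi bc)).
rewrite (EFin_expect2 (bounded_measurableD bF bc)).
apply: (hpsi (fun p => (F p + M)%:E)).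
  by apply/measurable_EFinP; apply: measurable_funD => //; exact: measurable_cst.
by move=> p; rewrite lee_fin -lerBlDr sub0r; have := FM p; rewrite ler_norml => /andP[].
Qed.

Lemma expect2_rotation (c s : R) (F : V * V -> R) : s != 0 ->
  c ^+ 2 + s ^+ 2 = 1 -> bounded_measurable F ->
  expect2 (fun p => F (c *: p.1 - s *: p.2, s *: p.1 + c *: p.2)) = expect2 F.
Proof.
move=> s0 cs bF.
have mr : measurable_fun setT (fun p : V * V => (c *: p.1 - s *: p.2, s *: p.1 + c *: p.2)).
  have := @measurable_lin_pair R n c (- s) s c.
  by under eq_fun do rewrite scaleNr.
apply: (expect2_transfer mr _ bF) => f mf f0.
exact: (gaussian_rotation s0 cs mf f0).
Qed.

Lemma expect2_swap (F : V * V -> R) : bounded_measurable F ->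
  expect2 (fun p => F (p.2, p.1)) = expect2 F.
Proof.
move=> bF.
have mr : measurable_fun setT (fun p : V * V => (p.2, p.1)) by apply: measurable_fun_pair.
apply: (expect2_transfer mr _ bF) => f mf f0.
exact/esym/(fubini_tonelli (m1 := gamma) (m2 := gamma) _ mf f0).
Qed.

(** The linear map that interchanges X and cX + sZ is a reflection, hence a rotation combined with a
    swap of the two variables. The rotation used has sine [- c], whence the condition on [c]. *)
Lemma gaussian_exchange (c s : R) (F : V * V -> R) : c != 0 ->
  c ^+ 2 + s ^+ 2 = 1 -> bounded_measurable F ->
  expect2 (fun p => F (p.1, c *: p.1 + s *: p.2))
  = expect2 (fun p => F (c *: p.1 + s *: p.2, p.1)).
Proof.
move=> c0 cs bF.
have bl (a b a' b' : R) : bounded_measurable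
    (fun p : V * V => F (a *: p.1 + b *: p.2, a' *: p.1 + b' *: p.2)).
  exact: (bounded_measurable_comp (@measurable_lin_pair R n a b a' b') bF).
have Nc0 : - c != 0 by rewrite oppr_eq0.
have cs' : s ^+ 2 + (- c) ^+ 2 = 1 by rewrite sqrrN addrC.
transitivity (expect2 (fun p => F (1 *: p.1 + 0 *: p.2, c *: p.1 + s *: p.2))).
  by apply: eq_expect2 => p; rewrite scale1r scale0r addr0.
rewrite -(expect2_rotation Nc0 cs' (bl 1 0 c s)).
transitivity (expect2 (fun p => F (c *: p.1 + s *: p.2, 1 *: p.1 + 0 *: p.2))); last first.
  by apply: eq_expect2 => p; rewrite scale1r scale0r addr0.
rewrite -(expect2_swap (bl c s 1 0)).
apply: eq_expect2 => -[x z] /=; congr (F (_, _)); apply/rowP => i; rewrite !mxE; first by ring.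
rewrite mul1r mul0r addr0 -[RHS]mul1r -cs; ring.
Qed.

(** Rotation of the plane that takes the direction (a, b) to the first axis: aX + bZ has the law of
    sqrt(a^2 + b^2) X. *)
Lemma gaussian_combine (a b : R) (f : V -> R) : b != 0 -> bounded_measurable f ->
  expect2 (fun p => f (a *: p.1 + b *: p.2))
  = \int[gamma]_x f (Num.sqrt (a ^+ 2 + b ^+ 2) *: x).
Proof.
move=> b0 bf; set r := Num.sqrt _.
have ab0 : 0 < a ^+ 2 + b ^+ 2.
  by rewrite ltr_wpDl ?sqr_ge0// lt_neqAle sqr_ge0 andbT eq_sym sqrf_eq0.
have r0 : r != 0 by rewrite gt_eqF// sqrtr_gt0.
have r2 : r ^+ 2 = a ^+ 2 + b ^+ 2 by rewrite sqr_sqrtr// ltW.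
pose F (p : V * V) := f (r *: p.1 + 0 *: p.2).
have bF : bounded_measurable F by exact: (bounded_measurable_comp (@measurable_lin R n r 0) bf).
transitivity (expect2 F); last first.
  rewrite -expect2_fst; apply: eq_expect2 => p.
  by rewrite /F scale0r addr0.
have br0 : - (b / r) != 0 by rewrite oppr_eq0 mulf_neq0// invr_eq0.
have abr : (a / r) ^+ 2 + (- (b / r)) ^+ 2 = 1.
  by rewrite sqrrN !expr_div_n -mulrDl r2 divff// gt_eqF.
rewrite -(expect2_rotation br0 abr bF).
apply: eq_expect2 => p; rewrite /F /=; congr f.
by apply/rowP => i; rewrite !mxE; field.
Qed.

Definition mehler (h : R) (x y : V) : V :=
  expR (- h) *: x + Num.sqrt (1 - expR (- (2 * h))) *: y.

Lemma ou_semigroupE h (w : V -> R) x : ou_semigroup h w x = \int[gamma]_y w (mehler h x y).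
Proof. by []. Qed.

Lemma mehler_sqr h : 0 <= h ->
  expR (- h) ^+ 2 + Num.sqrt (1 - expR (- (2 * h))) ^+ 2 = 1 :> R.
Proof.
move=> h0; rewrite sqr_sqrtr; last by rewrite subr_ge0 -expR0 ler_expR oppr_le0 mulr_ge0.
have -> : expR (- h) ^+ 2 = expR (- (2 * h)) :> R.
  by rewrite -expRM_natl; congr expR; rewrite mulrN.
by rewrite addrC subrK.
Qed.

Lemma mehler_sqrt_gt0 h : 0 < h -> 0 < Num.sqrt (1 - expR (- (2 * h))) :> R.
Proof. by move=> h0; rewrite sqrtr_gt0 subr_gt0 -expR0 ltr_expR oppr_lt0 mulr_gt0. Qed.

Lemma measurable_mehler h : measurable_fun setT (fun p : V * V => mehler h p.1 p.2).
Proof. exact: measurable_lin. Qed.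

Lemma measurable_mehler2 h : measurable_fun setT (fun p : V * V => (p.1, mehler h p.1 p.2)).
Proof. by apply: measurable_fun_pair => //; exact: measurable_mehler. Qed.

Lemma measurable_mehler_time : measurable_fun setT (fun p : R * V * V => mehler p.1.1 p.1.2 p.2).
Proof.
apply: measurable_fun_rV => i; under eq_fun do rewrite !mxE.
apply: measurable_funD; apply: measurable_funM.
- apply: (@measurableT_comp _ _ _ _ _ _ (@expR R)) => //.
  apply: measurableT_comp => //; exact: (measurableT_comp measurable_fst measurable_fst).
- apply: (measurableT_comp (measurable_coord_rV i)).
  exact: (measurableT_comp measurable_snd measurable_fst).
- apply: (@measurableT_comp _ _ _ _ _ _ (@Num.sqrt R)).
    by apply: continuous_measurable_fun; exact: sqrt_continuous.
  apply: measurable_funB => //.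
  apply: (@measurableT_comp _ _ _ _ _ _ (@expR R)) => //.
  apply: measurableT_comp => //; apply: measurable_funM => //.
  exact: (measurableT_comp measurable_fst measurable_fst).
- exact: (measurableT_comp (measurable_coord_rV i) measurable_snd).
Qed.

Lemma ou_bounded h (w : V -> R) : bounded_measurable w ->
  bounded_measurable (ou_semigroup h w).
Proof.
move=> bw.
exact: (bounded_measurable_Rfubini gamma (bounded_measurable_comp (measurable_mehler h) bw)).
Qed.

Lemma ou_norm_le h (w : V -> R) U x : measurable_fun setT w -> (forall y, `|w y| <= U) ->
  `|ou_semigroup h w x| <= U.
Proof.
move=> mw wU; rewrite ou_semigroupE; apply: bounded_Rintegral_norm => //.
apply: (measurableT_comp mw); exact: (measurableT_comp (measurable_mehler h) (pair1_measurable x)).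
Qed.

Lemma ou_bounded_time (u : V -> R) : bounded_measurable u ->
  bounded_measurable (fun p : R * V => ou_semigroup p.1 u p.2).
Proof.
move=> bu.
exact: (bounded_measurable_Rfubini gamma (bounded_measurable_comp measurable_mehler_time bu)).
Qed.

(** The two independent noises add in quadrature: e^(-2s) (1 - e^(-2h)) + (1 - e^(-2s)) = 1 -
    e^(-2(s + h)). *)
Lemma ou_semigroupD s h (u : V -> R) x : 0 < s -> 0 < h -> bounded_measurable u ->
  ou_semigroup h (ou_semigroup s u) x = ou_semigroup (s + h) u x.
Proof.
move=> s0 h0 bu; rewrite !ou_semigroupE.
pose c := expR (- s) : R; pose sg t := Num.sqrt (1 - expR (- (2 * t))) : R.
pose g (y : V) := u (expR (- (s + h)) *: x + y).
have mg : measurable_fun setT (fun y : V => expR (- (s + h)) *: x + y).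
  apply: measurable_fun_rV => i; under eq_fun do rewrite !mxE.
  apply: measurable_funD; [exact: measurable_cst|exact: measurable_coord_rV].
have bg : bounded_measurable g by exact: (bounded_measurable_comp mg bu).
transitivity (expect2 (fun p => g ((c * sg h) *: p.1 + sg s *: p.2))).
  rewrite expect2E; apply: eq_Rintegral => y _; rewrite ou_semigroupE; apply: eq_Rintegral => z _.
  rewrite /g /mehler scalerDr !scalerA addrA; congr (u (_ *: _ + _ + _)).
  by rewrite opprD expRD.
have sgs : sg s != 0 by rewrite gt_eqF// mehler_sqrt_gt0.
rewrite (gaussian_combine _ sgs bg).
apply: eq_Rintegral => y _; rewrite /g /mehler; congr (u (_ + _ *: _)); congr Num.sqrt.
have hs := mehler_sqr (ltW h0); have ss := mehler_sqr (ltW s0).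
rewrite exprMn -/(sg h) -/(sg s) in hs ss *.
have -> : sg h ^+ 2 = 1 - expR (- h) ^+ 2 by rewrite -hs addrC addKr.
have -> : sg s ^+ 2 = 1 - c ^+ 2 by rewrite -ss addrC addKr.
have -> : expR (- (2 * (s + h))) = (c * expR (- h)) ^+ 2.
  rewrite /c -expRD -opprD -expRM_natl; congr expR; ring.
ring.
Qed.

Lemma mehler_exchange h (F : V * V -> R) : 0 < h -> bounded_measurable F ->
  expect2 (fun p => F (p.1, mehler h p.1 p.2)) = expect2 (fun p => F (mehler h p.1 p.2, p.1)).
Proof.
move=> h0 bF; apply: gaussian_exchange => //; first by rewrite gt_eqF ?expR_gt0.
by rewrite mehler_sqr// ltW.
Qed.

Lemma expect2_mehler h (f g : V -> R) : bounded_measurable g ->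
  expect2 (fun p => f p.1 * g (mehler h p.1 p.2)) = \int[gamma]_x (f x * ou_semigroup h g x).
Proof.
move=> bg; rewrite expect2E; apply: eq_Rintegral => x _ /=; rewrite bounded_RintegralZl//.
apply: (bounded_measurable_comp _ bg).
exact: (measurableT_comp (measurable_mehler h) (pair1_measurable x)).
Qed.

(** With Y the Mehler image of X, the two sides are the expectations of f(X) g(Y) and g(X) f(Y);
    exchangeability equates them. *)
Lemma ou_symmetric h (f g : V -> R) : 0 < h -> bounded_measurable f -> bounded_measurable g ->
  \int[gamma]_x (f x * ou_semigroup h g x) = \int[gamma]_x (g x * ou_semigroup h f x).
Proof.
move=> h0 bf bg; rewrite -(expect2_mehler h f bg) -(expect2_mehler h g bf).
have bfg : bounded_measurable (fun p : V * V => f p.1 * g p.2).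
  by apply: bounded_measurableM; apply: bounded_measurable_comp.
rewrite (mehler_exchange h0 bfg).
by apply: eq_expect2 => p; rewrite /= mulrC.
Qed.

End mehler.

(** * A gradient bound by Cameron-Martin and Cauchy-Schwarz *)

Section gradient_bound.
Context {R : realType} {n : nat}.
Local Notation V := 'rV[R]_n.
Local Notation gamma := (@gaussian_measure R n).

(** The Cameron-Martin density of the translation by [k] along coordinate [i]. Its square is a
    multiple of the density for [2 * k], which gives its second moment. *)
Definition shift_density (i : 'I_n) (k : R) (z : V) : R := expR (k * z ord0 i - k ^+ 2 / 2).

Lemma measurable_shift_density i k : measurable_fun setT (shift_density i k).
Proof.
apply: (@measurableT_comp _ _ _ _ _ _ (@expR R)) => //.
apply: measurable_funB => //; apply: measurable_funM => //; exact: measurable_coord_rV.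
Qed.

Lemma ge0_cameron_martin1 i k (f : V -> \bar R) :
  measurable_fun setT f -> (forall x, (0 <= f x)%E) ->
  (\int[gamma]_z f (z + k *: delta_mx ord0 i)%R =
   \int[gamma]_z (f z * (shift_density i k z)%:E))%E.
Proof.
move=> mf f0; rewrite (cameron_martin (k *: delta_mx ord0 i) mf f0); apply: eq_integral => z _.
have -> : (\sum_j z ord0 j * (k *: delta_mx ord0 i : V) ord0 j = k * z ord0 i)%R.
  rewrite (bigD1 i)//= big1 ?addr0; first by rewrite !mxE !eqxx mulr1 mulrC.
  by move=> j ji; rewrite !mxE (negbTE ji) andbF !mulr0.
have -> : (enorm (k *: delta_mx ord0 i : V) ^+ 2 = k ^+ 2)%R.
  rewrite enorm_sqr (bigD1 i)//= big1 ?addr0; first by rewrite !mxE !eqxx mulr1.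
  by move=> j ji; rewrite !mxE (negbTE ji) andbF mulr0 expr0n.
by [].
Qed.

Lemma integral_shift_density i k : (\int[gamma]_z (shift_density i k z)%:E = 1)%E.
Proof.
transitivity (\int[gamma]_z (1 * (shift_density i k z)%:E))%E.
  by apply: eq_integral => z _; rewrite mul1e.
rewrite -(@ge0_cameron_martin1 i k (cst 1%E))// /= integral_cst// mul1e.
exact: gaussian_measureT.
Qed.

Lemma shift_density_sqr i k z :
  shift_density i k z ^+ 2 = expR (k ^+ 2) * shift_density i (2 * k) z.
Proof. by rewrite /shift_density -expRD -expRM_natl; congr expR; field. Qed.

Lemma integral_shift_density_sqr i k :
  (\int[gamma]_z (shift_density i k z ^+ 2)%:E = (expR (k ^+ 2))%:E)%E.
Proof.
under eq_integral do rewrite shift_density_sqr EFinM.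
rewrite ge0_integralZl; [|by []| | |].
- by rewrite integral_shift_density mule1.
- by apply/measurable_EFinP; exact: measurable_shift_density.
- by move=> z _; rewrite lee_fin expR_ge0.
- by rewrite lee_fin expR_ge0.
Qed.

Lemma ge0_integrable_EFin (f : V -> R) (c : R) : measurable_fun setT f -> (forall x, 0 <= f x) ->
  (\int[gamma]_z (f z)%:E = c%:E)%E -> gamma.-integrable setT (EFin \o f).
Proof.
move=> mf f0 fc; apply/integrableP; split; first exact/measurable_EFinP.
by under eq_integral do rewrite /= ger0_norm//; rewrite fc ltry.
Qed.

Lemma integrable_shift_density i k : gamma.-integrable setT (EFin \o shift_density i k).
Proof.
apply: ge0_integrable_EFin (integral_shift_density i k).
  exact: measurable_shift_density.
by move=> z; exact: expR_ge0.
Qed.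

Lemma integrable_shift_density_sqr i k :
  gamma.-integrable setT (EFin \o (fun z => shift_density i k z ^+ 2)).
Proof.
apply: ge0_integrable_EFin (integral_shift_density_sqr i k).
  by apply: measurable_funX; exact: measurable_shift_density.
by move=> z; exact: sqr_ge0.
Qed.

Lemma Rintegral_shift_density i k : \int[gamma]_z shift_density i k z = 1.
Proof. by rewrite /Rintegral integral_shift_density. Qed.

Lemma Rintegral_shift_density_sqr i k :
  \int[gamma]_z (shift_density i k z ^+ 2) = expR (k ^+ 2).
Proof. by rewrite /Rintegral integral_shift_density_sqr. Qed.

Lemma integrable_bounded_shift_density (f : V -> R) i k : bounded_measurable f ->
  gamma.-integrable setT (EFin \o (fun z => f z * shift_density i k z)).
Proof.
move=> [mf [M fM]].
have := @integrableZl _ _ _ gamma setT measurableT M _ (integrable_shift_density i k).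
apply: le_integrable => //.
  by apply/measurable_EFinP; apply: measurable_funM => //; exact: measurable_shift_density.
move=> z _ /=; rewrite lee_fin normrM [leRHS]normrM; apply: ler_wpM2r => //.
exact: le_trans (fM z) (ler_norm _).
Qed.

(** The nonnegative case applied to [f + M]. The density is unbounded, so the right-hand side is
    handled by integrability and not by boundedness. *)
Lemma cameron_martin1 (f : V -> R) i k : bounded_measurable f ->
  \int[gamma]_z f (z + k *: delta_mx ord0 i) = \int[gamma]_z (f z * shift_density i k z).
Proof.
move=> bf; have [mf [M fM]] := bf.
have ma : measurable_fun setT (fun z : V => z + k *: delta_mx ord0 i) by exact: measurable_addrV.
have bs := bounded_measurable_comp ma bf.
have bc := @bounded_measurable_cst R _ V M.
have ifs := integrable_bounded_shift_density i k bf.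
apply: (@addIr _ M); rewrite -{1}(probability_Rintegral_cst gamma M).
rewrite -(bounded_RintegralD gamma bs bc).
have {2}-> : M = \int[gamma]_z (M * shift_density i k z).
  rewrite RintegralZl//; last exact: integrable_shift_density.
  by rewrite Rintegral_shift_density mulr1.
rewrite -RintegralD//; last exact: (integrable_bounded_shift_density i k bc).
rewrite /Rintegral; congr fine.
rewrite (@ge0_cameron_martin1 i k (fun z => (f z + M)%:E)).
- by apply: eq_integral => z _; rewrite -EFinM mulrDl.
- by apply/measurable_EFinP; apply: measurable_funD => //; exact: measurable_cst.
- by move=> z; rewrite lee_fin -lerBlDr sub0r; have := fM z; rewrite ler_norml => /andP[].
Qed.

(** The quadratic is evaluated at its minimum D / A; for A = 0 an affine function bounded below
    forces D = 0. *)
Lemma discriminant_le (A B D : R) : 0 <= A ->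
  (forall t, 0 <= t ^+ 2 * A - 2 * t * D + B) -> D ^+ 2 <= A * B.
Proof.
move=> A0 h; have [A00|Ane0] := eqVneq A 0.
  rewrite A00 mul0r; have [->|D0] := eqVneq D 0; first by rewrite expr0n.
  have := h ((B + 1) / (2 * D)); rewrite A00 mulr0 add0r.
  have -> : - (2 * ((B + 1) / (2 * D)) * D) + B = -1 by field.
  by rewrite ler0N1.
have Ap : 0 < A by rewrite lt_neqAle eq_sym Ane0.
have := h (D / A).
have -> : (D / A) ^+ 2 * A - 2 * (D / A) * D + B = B - D ^+ 2 / A by field.
by rewrite subr_ge0 ler_pdivrMr// mulrC.
Qed.

(* Cauchy-Schwarz against [shift_density - 1], whose second moment is
   [expR (k ^+ 2) - 1]. *)
Lemma shift_difference_sqr (f : V -> R) i k : bounded_measurable f ->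
  (\int[gamma]_z f (z + k *: delta_mx ord0 i) - \int[gamma]_z f z) ^+ 2
  <= \int[gamma]_z (f z ^+ 2) * (expR (k ^+ 2) - 1).
Proof.
move=> bf; rewrite cameron_martin1//.
apply: discriminant_le; first by apply: Rintegral_ge0 => z _; exact: sqr_ge0.
move=> t; set D := \int[gamma]_z _ - _.
have ifr := integrable_bounded_shift_density i k bf.
have ir := integrable_shift_density i k.
have ir2 := integrable_shift_density_sqr i k.
pose g z := t ^+ 2 * f z ^+ 2 + 2 * t * f z + 1.
have b2 : bounded_measurable (fun z => t ^+ 2 * f z ^+ 2).
  by apply: bounded_measurableM; [exact: bounded_measurable_cst|exact: bounded_measurable_sqr].
have b1 : bounded_measurable (fun z => 2 * t * f z).
  by apply: bounded_measurableM => //; exact: bounded_measurable_cst.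
have bc : bounded_measurable (fun z : V => 1 : R) by exact: bounded_measurable_cst.
have bg : bounded_measurable g.
  by apply: bounded_measurableD => //; exact: bounded_measurableD.
have ig := bounded_integrable gamma bg.
(* The quadratic in t is the integral of (t f - ([shift_density] - 1))^2, expanded so that the
   bounded terms, collected in [g], are separated from the merely integrable ones. *)
have -> : t ^+ 2 * (\int[gamma]_z f z ^+ 2) - 2 * t * D + (expR (k ^+ 2) - 1) =
  \int[gamma]_z (((g z + shift_density i k z ^+ 2) + (- (2 * t)) * (f z * shift_density i k z))
     + (-2) * shift_density i k z).
  have i2 : gamma.-integrable setT (EFin \o (fun z => (- (2 * t)) * (f z * shift_density i k z))).
    exact: (integrableZl _ _ ifr).
  have i3 : gamma.-integrable setT (EFin \o (fun z => (-2) * shift_density i k z)).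
    exact: (integrableZl _ _ ir).
  have i1 : gamma.-integrable setT (EFin \o (fun z => g z + shift_density i k z ^+ 2)).
    exact: (integrableD _ ig ir2).
  rewrite RintegralD//; last exact: (integrableD _ i1 i2).
  rewrite RintegralD// RintegralD// !RintegralZl//.
  have -> : \int[gamma]_z g z = t ^+ 2 * (\int[gamma]_z f z ^+ 2) + 2 * t * (\int[gamma]_z f z) + 1.
    rewrite bounded_RintegralD//; last exact: bounded_measurableD.
    rewrite bounded_RintegralD// bounded_RintegralZl ?probability_Rintegral_cst//.
      by rewrite bounded_RintegralZl.
    exact: bounded_measurable_sqr.
  rewrite /D Rintegral_shift_density Rintegral_shift_density_sqr.
  ring.
apply: Rintegral_ge0 => z _; rewrite /g.
have -> : t ^+ 2 * f z ^+ 2 + 2 * t * f z + 1 + shift_density i k z ^+ 2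
   + - (2 * t) * (f z * shift_density i k z) + (-2) * shift_density i k z =
  (t * f z - (shift_density i k z - 1)) ^+ 2 by ring.
exact: sqr_ge0.
Qed.

(** For smooth [w] the quotient by [h] tends to 2 |grad w|^2 as h -> 0: the Mehler image of x is x
    plus a noise of variance about 2h in each coordinate. *)
Definition mehler_dev (h : R) (w : V -> R) (x : V) : R :=
  \int[gamma]_z ((w (mehler h x z) - w x) ^+ 2).

Lemma mehler_dev_ge0 h w x : 0 <= mehler_dev h w x.
Proof. by apply: Rintegral_ge0 => z _; exact: sqr_ge0. Qed.

(** Moving x by [e] amounts to moving the Gaussian noise by [k]. The constant w(x) may be subtracted
    from the integrand without changing the difference, and this is what makes [mehler_dev] appear
    in place of the second moment of w. *)
Lemma ou_difference_sqr h (w : V -> R) x i e : 0 < h -> bounded_measurable w ->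
  e ^+ 2 <= h ->
  (ou_semigroup h w (x + e *: delta_mx ord0 i) - ou_semigroup h w x) ^+ 2
  <= mehler_dev h w x * (e ^+ 2 / h).
Proof.
move=> h0 bw eh.
have sg0 := mehler_sqrt_gt0 h0; set sg := Num.sqrt (1 - expR (- (2 * h))) in sg0.
pose k := e * expR (- h) / sg.
have mm : measurable_fun setT (fun z : V => mehler h x z).
  exact: (measurableT_comp (measurable_mehler h) (pair1_measurable x)).
have bm := bounded_measurable_comp mm bw.
have bf : bounded_measurable (fun z => w (mehler h x z) - w x).
  by apply: bounded_measurableB => //; exact: bounded_measurable_cst.
have mk : measurable_fun setT (fun z : V => z + k *: delta_mx ord0 i) by exact: measurable_addrV.
have := shift_difference_sqr i k bf.
rewrite -/(mehler_dev h w x).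
rewrite (bounded_RintegralB gamma (bounded_measurable_comp mk bm) (bounded_measurable_cst _ _)).
rewrite (bounded_RintegralB gamma bm (bounded_measurable_cst _ _)).
rewrite opprB addrA subrK.
have -> : \int[gamma]_z w (mehler h x (z + k *: delta_mx ord0 i)) =
    ou_semigroup h w (x + e *: delta_mx ord0 i).
  apply: eq_Rintegral => z _; congr w; rewrite /mehler -/sg.
  apply/rowP => j; rewrite !mxE /k; field; by rewrite gt_eqF.
rewrite -ou_semigroupE => /le_trans; apply; apply: ler_wpM2l; first exact: mehler_dev_ge0.
(* Here k^2 = e^2 / (e^(2h) - 1), and e^(2h) - 1 >= 2h. *)
have ke : k ^+ 2 <= e ^+ 2 / (2 * h).
  rewrite /k expr_div_n exprMn -mulrA; apply: ler_wpM2l; first exact: sqr_ge0.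
  rewrite ler_pdivrMr ?exprn_gt0// mulrC ler_pdivlMr ?mulr_gt0//.
  have -> : sg ^+ 2 = 1 - expR (- h) ^+ 2 by rewrite -(mehler_sqr (ltW h0)) -/sg addrAC subrr add0r.
  rewrite -(ler_pM2l (expR_gt0 (2 * h))).
  have e1 : expR (2 * h) * expR (- h) ^+ 2 = 1.
    by rewrite -expRM_natl -expRD -[RHS]expR0; congr expR; ring.
  rewrite mulrA e1 mul1r mulrBr e1 mulr1 lerBrDr addrC; exact: expR_ge1Dx.
have k12 : k ^+ 2 <= 1 / 2.
  by apply: (le_trans ke); rewrite ler_pdivrMr ?mulr_gt0//; lra.
(* For 0 <= q <= 1/2, the inequality (1 - q) e^q <= 1 gives e^q - 1 <= 2q. *)
have : expR (k ^+ 2) - 1 <= 2 * k ^+ 2.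
  have k0 := sqr_ge0 k; set q := k ^+ 2 in k0 k12 *.
  have := expR_ge1Dx (- q); rewrite expRN => hq.
  have eq0 := expR_gt0 q.
  have : (1 - q) * expR q <= 1 by rewrite -ler_pdivlMr// mul1r.
  nra.
move=> /le_trans; apply; rewrite -ler_pdivlMl// mulrA.
have -> : 2^-1 * e ^+ 2 / h = e ^+ 2 / (2 * h) by field; rewrite gt_eqF.
by [].
Qed.

(* If the derivative does not exist, the library gives it the value 0: the bound
   for the difference quotients is enough. *)
Lemma derive_ou_sqr h (w : V -> R) x i : 0 < h -> bounded_measurable w ->
  ('D_(delta_mx ord0 i) (ou_semigroup h w) x) ^+ 2 <= mehler_dev h w x / h.
Proof.
move=> h0 bw; set f := ou_semigroup h w.
have Q0 : 0 <= mehler_dev h w x / h by rewrite divr_ge0 ?mehler_dev_ge0// ltW.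
rewrite /derive; set F := (fun e => _).
have [cF|ncF] := pselect (cvg (F @ 0^')); last by rewrite (dvgP ncF) expr0n.
have Fle : \forall e \near 0^', `|F e| <= Num.sqrt (mehler_dev h w x / h).
  near=> e.
  have e0 : e != 0 by near: e; exact: nbhs_dnbhs_neq.
  rewrite -sqrtr_sqr; apply: ler_wsqrtr.
  rewrite /F /= exprMn exprVn ler_pdivrMl; last by rewrite lt_neqAle sqr_ge0 andbT eq_sym sqrf_eq0.
  have eh : e ^+ 2 <= h.
    have : `|e| < Num.sqrt h by near: e; apply: dnbhs0_lt; rewrite sqrtr_gt0.
    move=> /ltW he; rewrite -(sqr_sqrtr (ltW h0)) -[e ^+ 2]real_normK ?num_real//.
    by rewrite lerXn2r// nnegrE// sqrtr_ge0.
  have := ou_difference_sqr x i h0 bw eh; rewrite (addrC x) -/f => /le_trans; apply.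
  by rewrite mulrCA.
have : `|lim (F @ 0^')| <= Num.sqrt (mehler_dev h w x / h).
  rewrite ler_norml; apply/andP; split.
    apply: limr_ge => //; near=> e; have : `|F e| <= Num.sqrt (mehler_dev h w x / h) by near: e.
    by rewrite ler_norml => /andP[].
  apply: limr_le => //; near=> e; have : `|F e| <= Num.sqrt (mehler_dev h w x / h) by near: e.
  by rewrite ler_norml => /andP[].
by rewrite -(ler_pXn2r (_ : 0 < 2)%N)// ?nnegrE ?sqrtr_ge0// real_normK ?num_real// sqr_sqrtr.
Unshelve. all: by end_near. Qed.

(** The directional bound is used in each coordinate separately, which costs the factor [n]. *)
Lemma gradient_ou_sqr h (w : V -> R) x : 0 < h -> bounded_measurable w ->
  enorm (gradient (ou_semigroup h w) x) ^+ 2 <= n%:R * (mehler_dev h w x / h).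
Proof.
move=> h0 bw; rewrite enorm_sqr.
apply: (@le_trans _ _ (\sum_(i < n) mehler_dev h w x / h)).
  by apply: ler_sum => i _; rewrite mxE; exact: derive_ou_sqr.
by rewrite sumr_const card_ord mulr_natl.
Qed.

End gradient_bound.

(** * The energy inequality *)

Ltac nonneg := repeat match goal with
  | |- is_true (0 <= enorm _) => exact: enorm_ge0
  | |- is_true (0 <= expR _) => exact: expR_ge0
  | |- is_true (0 <= _ ^+ 2) => exact: sqr_ge0
  | |- is_true (0 <= _ ^+ _) => apply: exprn_ge0
  | |- is_true (0 <= _ ^-1) => rewrite invr_ge0
  | |- is_true (0 <= _ * _) => apply: mulr_ge0
  | |- is_true (0 <= _ + _) => apply: addr_ge0
  | _ => first [by [] | exact: ltW]
  end.

Section dirichlet_form.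
Context {R : realType} {n : nat}.
Local Notation V := 'rV[R]_n.
Local Notation gamma := (@gaussian_measure R n).

Lemma bounded_measurable_fst (f : V -> R) : bounded_measurable f ->
  bounded_measurable (fun p : V * V => f p.1).
Proof. exact: bounded_measurable_comp. Qed.

Lemma bounded_measurable_snd (f : V -> R) : bounded_measurable f ->
  bounded_measurable (fun p : V * V => f p.2).
Proof. exact: bounded_measurable_comp. Qed.

Lemma bounded_measurable_mehler h (F : V * V -> R) : bounded_measurable F ->
  bounded_measurable (fun p => F (p.1, mehler h p.1 p.2)).
Proof. exact: (bounded_measurable_comp (@measurable_mehler2 _ _ h)). Qed.

(* Discrete form of the energy identity, obtained by integrating a pointwise
   inequality symmetrized in the two variables. *)
Lemma dirichlet_step h (v eta : V -> R) : 0 < h ->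
  bounded_measurable v -> bounded_measurable eta ->
  \int[gamma]_x (eta x ^+ 2 * mehler_dev h v x) <=
    2 * (\int[gamma]_x (eta x ^+ 2 * v x ^+ 2)
         - \int[gamma]_x (eta x ^+ 2 * ou_semigroup h v x ^+ 2))
  + 2 * \int[gamma]_x (eta x ^+ 2 * (v x - ou_semigroup h v x) ^+ 2)
  + 4 * expect2 (fun p => (eta p.1 - eta (mehler h p.1 p.2)) ^+ 2 * v p.1 ^+ 2).
Proof.
move=> h0 bv be.
have be2 := bounded_measurable_sqr be.
pose G (p : V * V) := (v p.1 - v p.2) * (eta p.1 ^+ 2 * v p.1).
pose K (p : V * V) := (eta p.1 - eta p.2) ^+ 2 * v p.1 ^+ 2.
have bv1 := bounded_measurable_fst bv; have bv2 := bounded_measurable_snd bv.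
have be1 := bounded_measurable_fst be; have be3 := bounded_measurable_snd be.
have bG : bounded_measurable G.
  apply: bounded_measurableM; first exact: bounded_measurableB.
  by apply: bounded_measurableM => //; exact: bounded_measurable_sqr.
have bK : bounded_measurable K.
  apply: bounded_measurableM; apply: bounded_measurable_sqr => //.
  exact: bounded_measurableB.
have bGs := bounded_measurable_comp (measurable_fun_pair measurable_snd measurable_fst : measurable_fun setT (fun p : V * V => (p.2, p.1))) bG.
have bKs := bounded_measurable_comp (measurable_fun_pair measurable_snd measurable_fst : measurable_fun setT (fun p : V * V => (p.2, p.1))) bK.
pose Y (p : V * V) := mehler h p.1 p.2.
pose H (p : V * V) := eta p.1 ^+ 2 * (v p.2 - v p.1) ^+ 2.
have bH : bounded_measurable H.
  apply: bounded_measurableM; apply: bounded_measurable_sqr => //.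
  exact: bounded_measurableB.
have EH : expect2 (fun p => H (p.1, Y p)) = \int[gamma]_x (eta x ^+ 2 * mehler_dev h v x).
  rewrite expect2E; apply: eq_Rintegral => x _; rewrite /H /= bounded_RintegralZl//.
  apply: bounded_measurable_sqr; apply: bounded_measurableB; last exact: bounded_measurable_cst.
  exact: (bounded_measurable_comp (measurableT_comp (measurable_mehler h) (pair1_measurable x)) bv).
have EG : expect2 (fun p => G (p.1, Y p)) =
    \int[gamma]_x (eta x ^+ 2 * v x ^+ 2) - \int[gamma]_x (eta x ^+ 2 * v x * ou_semigroup h v x).
  have -> : (fun p => G (p.1, Y p)) =
      (fun p => eta p.1 ^+ 2 * v p.1 ^+ 2 + (-1) * ((eta p.1 ^+ 2 * v p.1) * v (mehler h p.1 p.2))).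
    by apply/funext => p; rewrite /G /Y /=; ring.
  have b1 : bounded_measurable (fun x => eta x ^+ 2 * v x).
    exact: bounded_measurableM.
  have b2 : bounded_measurable (fun x => eta x ^+ 2 * v x ^+ 2).
    by apply: bounded_measurableM => //; exact: bounded_measurable_sqr.
  have b3 : bounded_measurable (fun p : V * V => (eta p.1 ^+ 2 * v p.1) * v (mehler h p.1 p.2)).
    exact: (bounded_measurable_mehler h (bounded_measurableM (bounded_measurable_fst b1) bv2)).
  rewrite (expect2D (bounded_measurable_fst b2)); last first.
    by apply: bounded_measurableM => //; exact: bounded_measurable_cst.
  rewrite (expect2Zl _ b3) (expect2_fst (fun x => eta x ^+ 2 * v x ^+ 2)).
  by rewrite (expect2_mehler h (fun x => eta x ^+ 2 * v x) bv) mulN1r.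
have step : 2^-1 * expect2 (fun p => H (p.1, Y p)) <=
    2 * expect2 (fun p => G (p.1, Y p)) + 2 * expect2 (fun p => K (p.1, Y p)).
  have bGY := bounded_measurable_mehler h bG; have bKY := bounded_measurable_mehler h bK.
  have bGsY := bounded_measurable_mehler h bGs; have bKsY := bounded_measurable_mehler h bKs.
  have cb (c : R) := @bounded_measurable_cst R _ (V * V)%type c.
  have eGs : expect2 (fun p => G (Y p, p.1)) = expect2 (fun p => G (p.1, Y p)).
    exact/esym/(mehler_exchange h0 bG).
  have eKs : expect2 (fun p => K (Y p, p.1)) = expect2 (fun p => K (p.1, Y p)).
    exact/esym/(mehler_exchange h0 bK).
  rewrite -(expect2Zl _ (bounded_measurable_mehler h bH)).
  (* Exchangeability allows [G] and [K] to be symmetrized. The total weight 2 of [K] is split as 1/2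
     + 3/2, for which the pointwise difference is a sum of two squares. *)
  have -> : 2 * expect2 (fun p => G (p.1, Y p)) + 2 * expect2 (fun p => K (p.1, Y p)) =
     expect2 (fun p => (G (p.1, Y p) + G (Y p, p.1)) + (2^-1 * K (p.1, Y p) + (3 / 2) * K (Y p, p.1))).
    rewrite expect2D; [|exact: bounded_measurableD|by apply: bounded_measurableD; apply: bounded_measurableM].
    rewrite (expect2D bGY bGsY) /= eGs.
    rewrite expect2D; [|exact: bounded_measurableM..].
    rewrite (expect2Zl _ bKY) (expect2Zl _ bKsY) /= eKs.
    have arith (a b : R) : 2 * a + 2 * b = (a + a) + (2^-1 * b + 3 / 2 * b) by field.
    exact: arith.
  apply: le_expect2.
  - exact: (bounded_measurableM (cb _) (bounded_measurable_mehler h bH)).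
  - apply: bounded_measurableD; first exact: bounded_measurableD.
    by apply: bounded_measurableD; apply: bounded_measurableM.
  - move=> p; rewrite /H /G /K /=.
    set e := eta p.1; set e' := eta (Y p); set w := v p.1; set w' := v (Y p).
    rewrite -subr_ge0.
    have -> : (w - w') * (e ^+ 2 * w) + (w' - w) * (e' ^+ 2 * w') +
       (2^-1 * ((e - e') ^+ 2 * w ^+ 2) + 3 / 2 * ((e' - e) ^+ 2 * w' ^+ 2)) -
       2^-1 * (e ^+ 2 * (w' - w) ^+ 2) =
       2^-1 * (((e * w - e' * w') + (e - e') * w') ^+ 2 + ((e - e') * (w - w')) ^+ 2).
      by field.
    nonneg.
rewrite -EH.
(* With Pv for [ou_semigroup h v] this gives the polarization of [EG]: \int eta^2 v (v - Pv) is half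
   of \int eta^2 v^2 - \int eta^2 (Pv)^2 + \int eta^2 (v - Pv)^2. *)
have -> : \int[gamma]_x (eta x ^+ 2 * (v x - ou_semigroup h v x) ^+ 2) =
  \int[gamma]_x (eta x ^+ 2 * v x ^+ 2) + \int[gamma]_x (eta x ^+ 2 * ou_semigroup h v x ^+ 2)
  - 2 * \int[gamma]_x (eta x ^+ 2 * v x * ou_semigroup h v x).
  have bP := ou_bounded h bv.
  have b2 : bounded_measurable (fun x => eta x ^+ 2 * v x ^+ 2).
    by apply: bounded_measurableM => //; exact: bounded_measurable_sqr.
  have b3 : bounded_measurable (fun x => eta x ^+ 2 * ou_semigroup h v x ^+ 2).
    by apply: bounded_measurableM => //; exact: bounded_measurable_sqr.
  have b4 : bounded_measurable (fun x => eta x ^+ 2 * v x * ou_semigroup h v x).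
    by apply: bounded_measurableM => //; exact: bounded_measurableM.
  rewrite -bounded_RintegralD// -bounded_RintegralZl// -bounded_RintegralB//; last 2 first.
  - exact: bounded_measurableD.
  - by apply: bounded_measurableM => //; exact: bounded_measurable_cst.
  by apply: eq_Rintegral => x _; ring.
move: step; rewrite EG /K /=.
move: (expect2 _) (expect2 _) (\int[gamma]_x _) (\int[gamma]_x _) (\int[gamma]_x _) => a b c e f.
lra.
Qed.

(** It dominates |z|^2 and |z|^4, the moments needed for the square and the fourth power of the
    displacement of the Mehler map. *)
Definition moment_weight (z : V) : R := (1 + enorm z ^+ 2) ^+ 2.

Lemma moment_weight_ge0 z : 0 <= moment_weight z.
Proof. exact: sqr_ge0. Qed.

Lemma measurable_moment_weight : measurable_fun setT moment_weight.
Proof.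
apply: measurable_funX; apply: measurable_funD => //; apply: measurable_funX.
exact: measurable_enorm.
Qed.

Lemma exp4_ge (r : R) : r ^+ 4 <= (4 ^+ 4) * (expR r + expR (- r)).
Proof.
have H (s : R) : 0 <= s -> s ^+ 4 <= 4 ^+ 4 * expR s.
  move=> s0.
  have -> : expR s = expR (s / 4) ^+ 4 by rewrite -expRM_natl; congr expR; field.
  have : 1 + s / 4 <= expR (s / 4) := expR_ge1Dx _.
  move=> h; have : (s / 4) ^+ 4 <= expR (s / 4) ^+ 4.
    apply: lerXn2r; rewrite ?nnegrE ?expR_ge0 ?divr_ge0//.
    by apply: le_trans h; rewrite lerDr.
  rewrite expr_div_n ler_pdivrMr ?exprn_gt0// mulrC => /le_trans; apply.
  by rewrite lexx.
have [r0|r0] := leP 0 r.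
  by apply: (le_trans (H _ r0)); rewrite ler_wpM2l// lerDl expR_ge0.
have -> : r ^+ 4 = (- r) ^+ 4 by rewrite !exprS !expr0; ring.
apply: (le_trans (H (- r) _)); first by rewrite oppr_ge0 ltW.
by rewrite ler_wpM2l// lerDr expR_ge0.
Qed.

(** Fourth powers are dominated by e^r + e^(-r), and up to the factor e^(1/2) these exponentials are
    the shift densities for k = 1 and k = -1, already known to be integrable. *)
Lemma integrable_moment_weight : gamma.-integrable setT (EFin \o moment_weight).
Proof.
pose g (z : V) := n.+1%:R + n.+1%:R * \sum_(i < n) ((4 ^+ 4) * (expR (2^-1)
   * (shift_density i 1 z + shift_density i (-1) z))).
have ig : gamma.-integrable setT (EFin \o g).
  apply: (@integrableD _ _ _ gamma setT measurableT (EFin \o cst n.+1%:R)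
     (EFin \o (fun z : V => n.+1%:R * \sum_(i < n) ((4 ^+ 4) * (expR (2^-1)
   * (shift_density i 1 z + shift_density i (-1) z)))))).
    exact: finite_measure_integrable_cst.
  apply: (integrableZl measurableT n.+1%:R (f := fun z => (\sum_(i < n) ((4 ^+ 4) * (expR (2^-1)
   * (shift_density i 1 z + shift_density i (-1) z))))%:E)).
  under eq_fun do rewrite -sumEFin.
  apply: (@integrable_sum _ _ _ gamma setT measurableT) => i _.
  apply: (integrableZl measurableT (4 ^+ 4) (f := fun z => (expR (2^-1)
   * (shift_density i 1 z + shift_density i (-1) z))%:E)).
  apply: (integrableZl measurableT (expR (2^-1)) (f := fun z =>
   (shift_density i 1 z + shift_density i (-1) z)%:E)).
  by apply: (integrableD measurableT (f := EFin \o shift_density i 1)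
    (g := EFin \o shift_density i (-1))); exact: integrable_shift_density.
apply: le_integrable ig => //.
  by apply/measurable_EFinP; exact: measurable_moment_weight.
move=> z _ /=; rewrite lee_fin ger0_norm ?moment_weight_ge0//.
apply: le_trans (ler_norm _).
rewrite /g /moment_weight enorm_sqr.
apply: (@le_trans _ _ (n.+1%:R + n.+1%:R * \sum_(i < n) z ord0 i ^+ 4)); last first.
  rewrite lerD2l ler_wpM2l//; apply: ler_sum => i _.
  apply: (le_trans (exp4_ge _)); rewrite ler_wpM2l// /shift_density mulrDr -!expRD.
  by apply: lerD; rewrite ler_expR; lra.
(* Cauchy-Schwarz for the vector of 1 and the squared coordinates against the constant vector, by
   induction on the list of indices. *)
have H : forall s : seq 'I_n, (1 + \sum_(i <- s) z ord0 i ^+ 2) ^+ 2 <=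
     (size s).+1%:R * (1 + \sum_(i <- s) z ord0 i ^+ 4) .
  elim=> [|i s IH]; first by rewrite !big_nil !addr0 expr1n mul1r.
  rewrite !big_cons /=; move: IH.
  set S2 := \sum_(j <- s) z ord0 j ^+ 2; set S4 := \sum_(j <- s) z ord0 j ^+ 4; set q := z ord0 i ^+ 2.
  have -> : z ord0 i ^+ 4 = q ^+ 2 by rewrite /q -exprM.
  have k0 : 1 <= (size s).+1%:R :> R by rewrite ler1n.
  have -> : (size s).+2%:R = (size s).+1%:R + 1 :> R by rewrite -[(size s).+2]addn1 natrD.
  have S40 : 0 <= 1 + S4.
    by rewrite addr_ge0// sumr_ge0// => j _; rewrite -[4%N]/(2 * 2)%N exprM sqr_ge0.
  set m : R := (size s).+1%:R in k0 *; move=> IH.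
  have : 2 * (1 + S2) * q <= (1 + S2) ^+ 2 / m + m * q ^+ 2.
    rewrite -subr_ge0.
    have -> : (1 + S2) ^+ 2 / m + m * q ^+ 2 - 2 * (1 + S2) * q = (1 + S2 - m * q) ^+ 2 / m.
      by field; rewrite gt_eqF// (lt_le_trans _ k0).
    by rewrite divr_ge0 ?sqr_ge0// (le_trans _ k0).
  have : (1 + S2) ^+ 2 / m <= 1 + S4 by rewrite ler_pdivrMr ?(lt_le_trans _ k0)// mulrC.
  move=> h1 h2.
  have -> : (1 + (q + S2)) ^+ 2 = (1 + S2) ^+ 2 + 2 * (1 + S2) * q + q ^+ 2 by ring.
  have -> : (m + 1) * (1 + (q ^+ 2 + S4)) = m * (1 + S4) + (1 + S4) + m * q ^+ 2 + q ^+ 2 by ring.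
  move: h1 h2 IH; set T := _ / m; set mS := m * (1 + S4); set mq := m * _; lra.
have := H (index_enum 'I_n).
have -> : size (index_enum 'I_n) = n by rewrite -[RHS](card_ord n) cardT enumT.
move=> /le_trans; apply.
by rewrite mulrDr mulr1.
Qed.

Definition moment_constant : R := \int[gamma]_z moment_weight z.

Lemma moment_constant_ge0 : 0 <= moment_constant.
Proof. by apply: Rintegral_ge0 => z _; exact: moment_weight_ge0. Qed.

Lemma EFin_moment_constant : (\int[gamma]_z (moment_weight z)%:E = moment_constant%:E)%E.
Proof.
rewrite /moment_constant /Rintegral fineK//.
by apply: integrable_fin_num => //; exact: integrable_moment_weight.
Qed.

(** The displacement is a drift of size at most h |x| and a noise of size at most sqrt(2h) |z|: only
    the noise is of first order in h after squaring. *)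
Lemma mehler_displacement h (x z : V) : 0 < h ->
  enorm (x - mehler h x z) ^+ 2 <= 2 * h ^+ 2 * enorm x ^+ 2 + 4 * h * enorm z ^+ 2.
Proof.
move=> h0; set sg := Num.sqrt (1 - expR (- (2 * h))).
have sg2 : sg ^+ 2 <= 2 * h.
  rewrite sqr_sqrtr; last by rewrite subr_ge0 -expR0 ler_expR oppr_le0 mulr_ge0// ltW.
  by have := expR_ge1Dx (- (2 * h)); lra.
have eh : 1 - expR (- h) <= h by have := expR_ge1Dx (- h); lra.
have eh0 : 0 <= 1 - expR (- h) by rewrite subr_ge0 -expR0 ler_expR oppr_le0 ltW.
have -> : x - mehler h x z = (1 - expR (- h)) *: x + (- sg) *: z.
  by apply/rowP => i; rewrite /mehler -/sg !mxE; ring.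
apply: (@le_trans _ _ (((1 - expR (- h)) * enorm x + sg * enorm z) ^+ 2)).
  rewrite lerXn2r ?nnegrE ?enorm_ge0//.
    by rewrite addr_ge0// mulr_ge0 ?enorm_ge0 ?sqrtr_ge0.
  apply: (le_trans (enormD _ _)); rewrite !enormZ normrN.
  by rewrite (ger0_norm eh0) (ger0_norm (sqrtr_ge0 _)).
apply: (@le_trans _ _ (2 * ((1 - expR (- h)) * enorm x) ^+ 2 + 2 * (sg * enorm z) ^+ 2)).
  rewrite -subr_ge0; set p := _ * enorm x; set q := _ * enorm z.
  have -> : 2 * p ^+ 2 + 2 * q ^+ 2 - (p + q) ^+ 2 = (p - q) ^+ 2 by ring.
  exact: sqr_ge0.
rewrite !exprMn; apply: lerD.
  rewrite -mulrA ler_wpM2l// ler_wpM2r ?sqr_ge0// lerXn2r// nnegrE//; exact: ltW.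
rewrite mulrA ler_wpM2r ?sqr_ge0//; lra.
Qed.

(** Displacements below [rho] are treated by the local Lipschitz bound, whose noise part is the term
    of order h. Larger ones are rare: they are paid for by the fourth moment, which is of order
    h^2. *)
Lemma oscillation_bound h (v eta L : V -> R) (B U Lm rho : R) : 0 < h <= 1 -> 0 < rho ->
  bounded_measurable v -> bounded_measurable eta -> bounded_measurable L ->
  (forall x, `|v x| <= U) -> (forall x, `|eta x| <= B) -> (forall x, 0 <= L x <= Lm) ->
  (forall x y, enorm (x - y) <= rho -> `|eta x - eta y| <= L x * enorm (x - y)) ->
  expect2 (fun p => (eta p.1 - eta (mehler h p.1 p.2)) ^+ 2 * v p.1 ^+ 2) <=
  4 * h * moment_constant * \int[gamma]_x (v x ^+ 2 * L x ^+ 2)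
  + h ^+ 2 * (2 * (2 * Lm ^+ 2 * U ^+ 2 + 128 * B ^+ 2 * U ^+ 2 / rho ^+ 4) * moment_constant).
Proof.
move=> /andP[h0 h1] rho0 bv be bL vU eB LL etaL.
set K := 2 * Lm ^+ 2 * U ^+ 2 + 128 * B ^+ 2 * U ^+ 2 / rho ^+ 4.
set F := fun p : V * V => _.
have rho4 : 0 < rho ^+ 4 by rewrite exprn_gt0.
have K0 : 0 <= K.
  apply: addr_ge0; first by nonneg.
  nonneg.
have bF : bounded_measurable F.
  have := bounded_measurable_mehler h (bounded_measurableM (bounded_measurable_sqr
    (bounded_measurableB (bounded_measurable_fst be) (bounded_measurable_snd be)))
    (bounded_measurable_sqr (bounded_measurable_fst bv))).
  exact.
have bvL : bounded_measurable (fun x => v x ^+ 2 * L x ^+ 2).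
  by apply: bounded_measurableM; exact: bounded_measurable_sqr.
have vU2 x : v x ^+ 2 <= U ^+ 2 by rewrite -[v x ^+ 2]real_normK ?num_real// lerXn2r ?nnegrE// (le_trans _ (vU x)).
have ptw x z : F (x, z) <= 4 * h * (v x ^+ 2 * L x ^+ 2) * moment_weight z
     + h ^+ 2 * K * (moment_weight x + moment_weight z).
  rewrite /F /=; set y := mehler h x z.
  have dxy := mehler_displacement x z h0; rewrite -/y in dxy.
  set d2 := enorm (x - y) ^+ 2 in dxy.
  have d20 : 0 <= d2 by exact: sqr_ge0.
  set X := enorm x ^+ 2 in dxy; set Z := enorm z ^+ 2 in dxy.
  have X0 : 0 <= X by exact: sqr_ge0.
  have Z0 : 0 <= Z by exact: sqr_ge0.
  have wX : moment_weight x = (1 + X) ^+ 2 by [].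
  have wZ : moment_weight z = (1 + Z) ^+ 2 by [].
  have /andP[Lx0 LxLm] := LL x.
  have L2 : L x ^+ 2 <= Lm ^+ 2 by rewrite lerXn2r ?nnegrE// (le_trans _ LxLm).
  have v20 : 0 <= v x ^+ 2 by exact: sqr_ge0.
  have L20 : 0 <= L x ^+ 2 by exact: sqr_ge0.
  have eta2 : (eta x - eta y) ^+ 2 <= L x ^+ 2 * d2 + 4 * B ^+ 2 / rho ^+ 4 * d2 ^+ 2.
    have [le|gt] := leP (enorm (x - y)) rho.
      apply: (@le_trans _ _ (L x ^+ 2 * d2)).
        rewrite -[(eta x - eta y) ^+ 2]real_normK ?num_real// -exprMn lerXn2r ?nnegrE//.
          by rewrite mulr_ge0// enorm_ge0.
        exact: etaL.
      by rewrite lerDl; nonneg.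
    (* Beyond [rho], as in Chebyshev's inequality, the trivial bound is multiplied by |x - y|^4 /
       rho^4 >= 1. *)
    apply: (@le_trans _ _ (4 * B ^+ 2)).
      rewrite -[(eta x - eta y) ^+ 2]real_normK ?num_real//.
      have -> : 4 * B ^+ 2 = (B + B) ^+ 2 by ring.
      rewrite lerXn2r ?nnegrE// ?addr_ge0// ?(le_trans _ (eB x))//.
      by rewrite (le_trans (ler_normB _ _))// lerD.
    apply: (@le_trans _ _ (4 * B ^+ 2 / rho ^+ 4 * d2 ^+ 2)); last by rewrite lerDr mulr_ge0.
    have -> : 4 * B ^+ 2 / rho ^+ 4 * d2 ^+ 2 = 4 * B ^+ 2 * (d2 ^+ 2 / rho ^+ 4) by ring.
    apply: ler_peMr; first by nonneg.
    rewrite ler_pdivlMr// mul1r.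
    by rewrite /d2 -exprM lerXn2r ?nnegrE ?enorm_ge0// ltW.
  set cB := 4 * B ^+ 2 / rho ^+ 4 in eta2.
  have cB0 : 0 <= cB by rewrite /cB; nonneg.
  have KE : K = 2 * Lm ^+ 2 * U ^+ 2 + 32 * cB * U ^+ 2.
    by rewrite /K /cB; field; rewrite gt_eqF.
  apply: (@le_trans _ _ ((L x ^+ 2 * d2 + cB * d2 ^+ 2) * v x ^+ 2)).
    by rewrite ler_wpM2r.
  (* The noise keeps v(x)^2 L(x)^2 for the main term; in the drift, already of order h^2, [v] and
     [L] are replaced by their uniform bounds. *)
  have T1 : L x ^+ 2 * d2 * v x ^+ 2 <= 4 * h * (v x ^+ 2 * L x ^+ 2) * moment_weight z
      + h ^+ 2 * (2 * Lm ^+ 2 * U ^+ 2) * (moment_weight x + moment_weight z).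
    apply: (@le_trans _ _ (L x ^+ 2 * (2 * h ^+ 2 * X + 4 * h * Z) * v x ^+ 2)).
      by rewrite ler_wpM2r// ler_wpM2l.
    have -> : L x ^+ 2 * (2 * h ^+ 2 * X + 4 * h * Z) * v x ^+ 2 =
      4 * h * (v x ^+ 2 * L x ^+ 2) * Z + h ^+ 2 * (2 * L x ^+ 2 * v x ^+ 2) * X by ring.
    apply: lerD.
      rewrite ler_wpM2l//; first by nonneg.
      by rewrite wZ; nra.
    apply: ler_pM => //.
    - nonneg.
    - rewrite ler_wpM2l ?sqr_ge0// ler_pM// ?mulr_ge0//.
      by rewrite ler_wpM2l.
    - by rewrite wX wZ; nra.
  have T2 : cB * d2 ^+ 2 * v x ^+ 2 <= h ^+ 2 * (32 * cB * U ^+ 2) * (moment_weight x + moment_weight z).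
    have : d2 ^+ 2 <= 32 * h ^+ 2 * (moment_weight x + moment_weight z).
      apply: (@le_trans _ _ ((2 * h ^+ 2 * X + 4 * h * Z) ^+ 2)).
        by rewrite lerXn2r ?nnegrE// (le_trans _ dxy).
      apply: (@le_trans _ _ (8 * h ^+ 4 * X ^+ 2 + 32 * h ^+ 2 * Z ^+ 2)).
        rewrite -subr_ge0.
        have -> : 8 * h ^+ 4 * X ^+ 2 + 32 * h ^+ 2 * Z ^+ 2 - (2 * h ^+ 2 * X + 4 * h * Z) ^+ 2 =
          (2 * h ^+ 2 * X - 4 * h * Z) ^+ 2 by ring.
        exact: sqr_ge0.
      have hh : h ^+ 4 <= h ^+ 2.
        by rewrite -[4%N]/(2 + 2)%N exprD ler_piMr ?sqr_ge0// expr_le1// ltW.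
      rewrite mulrDr; apply: lerD.
        rewrite wX; apply: ler_pM; [by nonneg|by nonneg| |].
          by have := sqr_ge0 h; lra.
        by rewrite lerXn2r ?nnegrE// ?addr_ge0// lerDr.
      rewrite wZ ler_wpM2l//; first by nonneg.
      by rewrite lerXn2r ?nnegrE// ?addr_ge0// lerDr.
    move=> hd.
    have -> : h ^+ 2 * (32 * cB * U ^+ 2) * (moment_weight x + moment_weight z) =
       cB * (32 * h ^+ 2 * (moment_weight x + moment_weight z)) * U ^+ 2 by ring.
    by apply: ler_pM => //; [nonneg|exact: ler_wpM2l].
  rewrite mulrDl KE [h ^+ 2 * _]mulrDr [(_ + _) * (_ + _)]mulrDl addrA.
  exact: lerD.
rewrite -lee_fin (EFin_expect2 bF).
have mw := measurable_moment_weight.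
have wz0 (z : V) : (0 <= (moment_weight z)%:E)%E by rewrite lee_fin moment_weight_ge0.
have F0 p : (0 <= (F p)%:E)%E by rewrite lee_fin mulr_ge0 ?sqr_ge0.
have mFx x : measurable_fun setT (fun z => (F (x, z))%:E).
  by apply/measurable_EFinP; have [] := bounded_measurable_pair1 x bF.
pose a x := 4 * h * (v x ^+ 2 * L x ^+ 2).
have a0 x : 0 <= a x by rewrite /a; nonneg.
have ba : bounded_measurable a by apply: bounded_measurableM => //; exact: bounded_measurable_cst.
pose b x := h ^+ 2 * K * moment_weight x.
have hK0 : 0 <= h ^+ 2 * K by rewrite mulr_ge0 ?sqr_ge0.
have mEw : measurable_fun setT (fun z : V => (moment_weight z)%:E) by exact/measurable_EFinP.
have inner x : (\int[gamma]_z (F (x, z))%:E <= ((a x + h ^+ 2 * K) * moment_constant + b x)%:E)%E.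
  apply: (@le_trans _ _ (\int[gamma]_z (((a x + h ^+ 2 * K)%:E * (moment_weight z)%:E) + (b x)%:E))%E).
    apply: ge0_le_integral => //.
    - apply: emeasurable_funD; last exact: measurable_cst.
      by apply: emeasurable_funM => //; exact: measurable_cst.
    - move=> z _; rewrite -EFinM -EFinD lee_fin; apply: (le_trans (ptw x z)).
      by rewrite -/(a x) /b le_eqVlt; apply/orP; left; apply/eqP; ring.
  rewrite ge0_integralD; [|by []| | | |].
  - rewrite ge0_integralZl//; last by rewrite lee_fin addr_ge0.
    by rewrite EFin_moment_constant integral_cst//= probability_setT mule1 -EFinM -EFinD lexx.
  - by move=> z _; rewrite mule_ge0// lee_fin addr_ge0.
  - by apply: emeasurable_funM => //; exact: measurable_cst.
  - by move=> z _; rewrite lee_fin mulr_ge0// moment_weight_ge0.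
  - exact: measurable_cst.
have bak : bounded_measurable (fun x => a x + h ^+ 2 * K).
  by apply: bounded_measurableD => //; exact: bounded_measurable_cst.
have mak : measurable_fun setT (fun x => (a x + h ^+ 2 * K)%:E).
  by apply/measurable_EFinP; have [] := bak.
apply: (@le_trans _ _ (\int[gamma]_x ((moment_constant%:E * (a x + h ^+ 2 * K)%:E)
    + (h ^+ 2 * K)%:E * (moment_weight x)%:E))%E).
  apply: ge0_le_integral => //.
  - by move=> x _; apply: integral_ge0.
  - apply: (measurable_fun_fubini_tonelli_F (m2 := gamma) (fun p => (F p)%:E)) => //.
    by apply/measurable_EFinP; have [] := bF.
  - by apply: emeasurable_funD; apply: emeasurable_funM => //; exact: measurable_cst.
  - move=> x _; rewrite -!EFinM -EFinD mulrC; exact: inner.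
have M0 := moment_constant_ge0.
rewrite ge0_integralD; [|by []| | | |]; last 4 first.
- by move=> x _; rewrite mule_ge0// lee_fin// addr_ge0.
- by apply: emeasurable_funM => //; exact: measurable_cst.
- by move=> x _; rewrite mule_ge0// lee_fin.
- by apply: emeasurable_funM => //; exact: measurable_cst.
rewrite ge0_integralZl//; last by move=> x _; rewrite lee_fin addr_ge0.
rewrite ge0_integralZl// EFin_moment_constant -(bounded_EFin_Rintegral gamma bak).
rewrite -!EFinM -EFinD lee_fin.
rewrite (bounded_RintegralD gamma ba); last exact: bounded_measurable_cst.
rewrite probability_Rintegral_cst /a bounded_RintegralZl//.
by rewrite le_eqVlt; apply/orP; left; apply/eqP; ring.
Qed.

End dirichlet_form.

(** * Difference quotients in time *)

Section time_calculus.
Context {R : realType}.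
Local Notation mu := (@lebesgue_measure R).

Lemma bounded_Rintegral_continuous d (T : measurableType d) (P : probability T R)
    (f : R -> T -> R) (M : R) :
  (forall s, measurable_fun setT (f s)) -> (forall s y, `|f s y| <= M) ->
  (forall y, continuous (f ^~ y)) -> continuous (fun s : R => \int[P]_y f s y).
Proof.
move=> mf fM cf s.
apply: (@continuity_under_integral R _ T P f setT measurableT (s - 1) (s + 1) _ _ (cst M)).
- by move=> x _; apply: bounded_integrable; split => //; exists M.
- by apply: aeW => y _ x _; exact: cf.
- exact: finite_measure_integrable_cst.
- by move=> x _; apply: aeW => y _; exact: fM.
- by rewrite inE /= in_itv/= ltrBlDr !ltrDl ltr01.
Qed.

Lemma antiderivative (f : R -> R) (a : R) : continuous f ->
  exists F : R -> R, forall x : R, a < x -> is_derive x 1 F (f x).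
Proof.
move=> cf; exists (fun x => \int[mu]_(t in `[a, x]) f t) => x ax.
have [//||dF FE] := @continuous_FTC1_closed R f a x (x + 1) _ _ ax (cf x).
- by rewrite ltrDl.
- apply: continuous_compact_integrable; first exact: segment_compact.
  by apply: continuous_subspaceT => y; exact: cf.
- by apply: (DeriveDef dF); rewrite -derive1E FE.
Qed.

Lemma backward_quotient_cvg (F : R -> R) (s l : R) (h : nat -> R) :
  (forall m, 0 < h m) -> h @ \oo --> 0 -> is_derive s 1 F l ->
  (fun m => (F (s - h m) - F s) / h m) @ \oo --> - l.
Proof.
move=> h0 hcvg [dF Fl].
pose q (k : R) := k^-1 *: ((F \o shift s) (k *: 1) - F s).
have qcvg : q k @[k --> 0^'] --> l.
  by rewrite -Fl; exact: dF.
have h0' : (fun m => - h m) @ \oo --> (0 : R) by rewrite -oppr0; apply: cvgN.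
have hn0 m : - h m != 0 by rewrite oppr_eq0 gt_eqF.
have := (cvgr_dnbhsP q 0 l).1 qcvg (fun m => - h m) (conj hn0 h0').
move=> /cvgN; apply: cvg_trans; apply: near_eq_cvg; near=> m.
have -> : (- (fun m => q (- h m))) m = - q (- h m) by [].
rewrite /q /= invrN scaleNr opprK /GRing.scale/= mulr1 [- h m + s]addrC.
by rewrite mulrC.
Unshelve. all: by end_near. Qed.

Local Notation h := (@harmonic R).

Lemma harmonic_le1 m : h m <= 1.
Proof. by rewrite /harmonic invf_le1// ler1n. Qed.

Lemma continuous_energy_integrand (B b : R -> R) (c1 c2 c3 c4 e : R) :
  continuous B -> continuous b -> continuous (fun t : R =>
    ((c1 * (B (t ^+ 2 - e) - B (t ^+ 2)) + c2 * (b (t ^+ 2 - e)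
        - 2 * b (t ^+ 2 - e / 2) + b (t ^+ 2))) / e + c3 + c4 * e) * (2 * t)).
Proof.
move=> cB cb t.
have ct : continuous (fun t : R => t ^+ 2) by move=> z; exact: exprn_continuous.
have cc (f : R -> R) e' : continuous f -> {for t, continuous (fun t : R => f (t ^+ 2 - e'))}.
  move=> cf; apply: continuous_comp; last exact: cf.
  by apply: cvgB; [exact: ct|exact: cvg_cst].
have cc0 (f : R -> R) : continuous f -> {for t, continuous (fun t : R => f (t ^+ 2))}.
  by move=> cf; apply: continuous_comp; [exact: ct|exact: cf].
apply: cvgM; last by apply: cvgM; [exact: cvg_cst|exact: cvg_id].
apply: cvgD; last exact: cvg_cst.
apply: cvgD; last exact: cvg_cst.
apply: cvgM; last exact: cvg_cst.
apply: cvgD.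
  by apply: cvgM; [exact: cvg_cst|apply: cvgB; [exact: cc|exact: cc0]].
apply: cvgM; first exact: cvg_cst.
apply: cvgD; last exact: cc0.
by apply: cvgB; [exact: cc|apply: cvgM; [exact: cvg_cst|exact: cc]].
Qed.

(* [B] and [b] are only assumed continuous: the difference quotients below are
   integrated exactly, being derivatives of difference quotients of
   antiderivatives of [B] and [b]. *)
Lemma energy_calculus (B b : R -> R) (c1 c2 c3 c4 t1 t0 : R) :
  continuous B -> continuous b -> t1 < t0 ->
  exists r : nat -> R,
  (forall m, (\int[mu]_(t in `[t1, t0])
     (((c1 * (B (t ^+ 2 - h m) - B (t ^+ 2)) + c2 * (b (t ^+ 2 - h m)
        - 2 * b (t ^+ 2 - h m / 2) + b (t ^+ 2))) / h m + c3 + c4 * h m) * (2 * t))%:E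
      = (r m)%:E)%E)
  /\ r @ \oo --> c1 * (B (t1 ^+ 2) - B (t0 ^+ 2)) + c3 * (t0 ^+ 2 - t1 ^+ 2).
Proof.
move=> cB cb t10.
(* Any base point below -1 serves: the arguments are s - h and s - h/2 with s >= 0 and h <= 1. *)
have [A dA] := antiderivative (- 2) cB.
have [a da] := antiderivative (- 2) cb.
(* An antiderivative in s of the integrand; the factor 2t comes from the substitution s = t^2. *)
pose W m (s : R) := (c1 * (A (s - h m) - A s) + c2 * (a (s - h m)
        - 2 * a (s - h m / 2) + a s)) / h m + c3 * s + c4 * h m * s.
have h0 m : 0 < h m by exact: harmonic_gt0.
have dW m (s : R) : 0 <= s -> is_derive s 1 (W m) ((c1 * (B (s - h m) - B s) + c2 * (b (s - h m)
        - 2 * b (s - h m / 2) + b s)) / h m + c3 + c4 * h m).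
  move=> s0; have h1 := harmonic_le1 m; have hm := h0 m.
  have dsh (F f : R -> R) (e : R) : (forall x : R, - 2 < x -> is_derive x 1 F (f x)) -> 0 <= e <= 1 ->
      is_derive s 1 (fun s => F (s - e)) (f (s - e)).
    move=> dF /andP[e0 e1].
    have d1 : is_derive (s - e) 1 F (f (s - e)) by apply: dF; lra.
    have d2 : is_derive s 1 (fun s : R => s - e) 1.
      have := is_deriveB (is_derive_id s 1) (is_derive_cst e s 1).
      by rewrite subr0.
    by have := is_derive1_comp (f := F) (g := fun s => s - e) d1 d2; rewrite mulr1.
  have e1 : 0 <= h m <= 1 by rewrite ltW.
  have e2 : 0 <= h m / 2 <= 1 by lra.
  have dA1 := dsh _ _ _ dA e1.
  have dA0 : is_derive s 1 A (B s) by apply: dA; lra.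
  have da1 := dsh _ _ _ da e1; have da2 := dsh _ _ _ da e2.
  have da0 : is_derive s 1 a (b s) by apply: da; lra.
  have D1 := is_deriveZ c1 (is_deriveB dA1 dA0).
  have D2 := is_deriveZ c2 (is_deriveD (is_deriveB da1 (is_deriveZ 2 da2)) da0).
  have D3 := is_deriveZ (h m)^-1 (is_deriveD D1 D2).
  have D4 := is_deriveZ c3 (is_derive_id s 1).
  have D5 := is_deriveZ (c4 * h m) (is_derive_id s 1).
  have := is_deriveD (is_deriveD D3 D4) D5.
  set G := (X in is_derive s 1 X _) => DD.
  have -> : W m = G.
    apply/funext => x; rewrite /W.
    transitivity ((h m)^-1 * (c1 * (A (x - h m) - A x) + c2 * (a (x - h m)
        - 2 * a (x - h m / 2) + a x)) + c3 * x + c4 * h m * x); last by [].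
    by congr (_ + _ + _); exact: mulrC.
  apply: (@is_derive_eq _ _ _ _ _ _ _ _ DD).
  by rewrite /GRing.scale/= !mulr1; congr (_ + _ + _); exact: mulrC.
exists (fun m => W m (t0 ^+ 2) - W m (t1 ^+ 2)); split.
  move=> m.
  have dV (t : R) : is_derive t 1 (fun t => W m (t ^+ 2))
    (((c1 * (B (t ^+ 2 - h m) - B (t ^+ 2)) + c2 * (b (t ^+ 2 - h m)
        - 2 * b (t ^+ 2 - h m / 2) + b (t ^+ 2))) / h m + c3 + c4 * h m) * (2 * t)).
    have d2 : is_derive t 1 (fun t : R => t ^+ 2) (2 * t).
      apply: (@is_derive_eq _ _ _ _ _ _ _ _ (is_deriveX 2 (is_derive_id t 1))).
      by rewrite /GRing.scale/= mulr1 expr1.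
    exact: (is_derive1_comp (f := W m) (g := fun t => t ^+ 2) (dW m _ (sqr_ge0 t)) d2).
  have cV : continuous (fun t : R => W m (t ^+ 2)).
    by move=> t; apply: differentiable_continuous; apply/derivable1_diffP; have [] := dV t.
  rewrite EFinB; apply: (@continuous_FTC2 R _ (fun t => W m (t ^+ 2)) t1 t0 t10).
  - by apply: continuous_subspaceT => t; exact: continuous_energy_integrand.
  - split.
    + by move=> t _; have [] := dV t.
    + by apply: cvg_at_right_filter; exact: cV.
    + by apply: cvg_at_left_filter; exact: cV.
  - by move=> t _; rewrite derive1E; have [_ ->] := dV t.
have hc : h @ \oo --> (0 : R) by exact: cvg_harmonic.
have Wlim (s : R) : 0 <= s -> (fun m => W m s) @ \oo --> - c1 * B s + c3 * s.
  move=> s0.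
  have dA0 : is_derive s 1 A (B s) by apply: dA; lra.
  have da0 : is_derive s 1 a (b s) by apply: da; lra.
  have q1 := backward_quotient_cvg h0 hc dA0.
  have q2 := backward_quotient_cvg h0 hc da0.
  have h20 m : 0 < h m / 2 by rewrite divr_gt0.
  have h2c : (fun m => h m / 2) @ \oo --> (0 : R).
    by rewrite -(mul0r (2^-1 : R)); apply: cvgM => //; exact: cvg_cst.
  have q3 := backward_quotient_cvg h20 h2c da0.
  (* The second difference divided by h is a difference of two backward quotients, with steps h and
     h/2, of the same antiderivative; they have the same limit, so the [c2] term disappears. *)
  have : (fun m => c1 * ((A (s - h m) - A s) / h m) + c2 * ((a (s - h m) - a s) / h m
     - (a (s - h m / 2) - a s) / (h m / 2)) + c3 * s + c4 * h m * s) @ \oo -->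
     c1 * (- B s) + c2 * (- b s - - b s) + c3 * s + c4 * 0 * s.
    apply: cvgD; last by apply: cvgM; [apply: cvgM => //|]; exact: cvg_cst.
    apply: cvgD; last exact: cvg_cst.
    apply: cvgD; first by apply: cvgM => //; exact: cvg_cst.
    by apply: cvgM; [exact: cvg_cst|exact: cvgB].
  rewrite subrr mulr0 addr0 mulr0 mul0r addr0 mulrN -mulNr.
  apply: cvg_trans; apply: near_eq_cvg; near=> m; rewrite /W.
  by field; rewrite gt_eqF.
have -> : c1 * (B (t1 ^+ 2) - B (t0 ^+ 2)) + c3 * (t0 ^+ 2 - t1 ^+ 2) =
  - c1 * B (t0 ^+ 2) + c3 * t0 ^+ 2 - (- c1 * B (t1 ^+ 2) + c3 * t1 ^+ 2) by ring.
by apply: cvgB; apply: Wlim; exact: sqr_ge0.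
Unshelve. all: by end_near. Qed.

Lemma limn_einf_le_cvg (u : nat -> \bar R) (r : nat -> R) (l : R) :
  (\forall m \near \oo, (u m <= (r m)%:E)%E) -> r @ \oo --> l -> (limn_einf u <= l%:E)%E.
Proof.
move=> ur rl; rewrite limn_einf_lim (cvg_lim _ (@cvg_einfs_sup _ u))//.
apply: ge_ereal_sup => _ [N _ <-]; apply/lee_addgt0Pr => e e0.
have re : \forall m \near \oo, r m <= l + e.
  have := @cvgr_le _ _ _ _ _ _ rl (l + e); apply.
  by rewrite ltrDl.
have [m [Nm um rm]] : exists m, [/\ (N <= m)%N, (u m <= (r m)%:E)%E & r m <= l + e].
  have [m hm] : exists m, (fun m => (N <= m)%N /\ ((u m <= (r m)%:E)%E /\ r m <= l + e)) m.
    apply: (@filter_ex _ (nbhs \oo)); near=> m.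
    by split; [near: m; exact: nbhs_infty_ge|split; near: m].
  by exists m; case: hm => ? [].
apply: (@le_trans _ _ (u m)); last by rewrite (le_trans um)// -EFinD lee_fin.
by apply: ereal_inf_lbound; exists m.
Unshelve. all: by end_near. Qed.

Lemma le_limn_einf (u : nat -> \bar R) (l : \bar R) :
  (\forall m \near \oo, (l <= u m)%E) -> (l <= limn_einf u)%E.
Proof.
move=> [N _ Nu]; rewrite limn_einf_lim (cvg_lim _ (@cvg_einfs_sup _ u))//.
apply: (@le_trans _ _ (einfs u N)); last by apply: ereal_sup_ubound; exists N.
by apply: le_ereal_inf_tmp => _ [m Nm <-]; exact: Nu.
Qed.

Lemma limn_einfZl (c : R) (u : nat -> \bar R) : 0 <= c -> (forall m, (0 <= u m)%E) ->
  (c%:E * limn_einf u <= limn_einf (fun m => c%:E * u m))%E.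
Proof.
rewrite le_eqVlt => /predU1P[<- u0|c0 _].
  by rewrite mul0e; apply: le_limn_einf; near=> m; rewrite mul0e.
rewrite muleC -lee_pdivlMr// limn_einf_lim (cvg_lim _ (@cvg_einfs_sup _ u))//.
apply: ge_ereal_sup => _ [N _ <-]; rewrite lee_pdivlMr// muleC.
apply: le_limn_einf; near=> m; rewrite lee_pmul2l//.
by apply: ereal_inf_lbound; exists m => //=; near: m; exact: nbhs_infty_ge.
Unshelve. all: by end_near. Qed.

End time_calculus.

(** * The local energy inequality along the semigroup *)

Section energy.
#[local] Opaque ou_semigroup.
Context {R : realType} {n : nat}.
Local Notation V := 'rV[R]_n.
Local Notation gamma := (@gaussian_measure R n).
Local Notation mu := (@lebesgue_measure R).
Local Notation h := (@harmonic R).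
Variables (u : V -> R) (U : R).
Hypothesis cu : continuous u.
Hypothesis uU : forall x, `|u x| <= U.
Local Notation v s := (ou_semigroup s u).

Lemma bounded_measurable_u : bounded_measurable u.
Proof. by split; [exact: continuous_measurable_rV|exists U]. Qed.

Lemma ou_le s x : `|v s x| <= U.
Proof. by apply: ou_norm_le => //; exact: continuous_measurable_rV. Qed.

Lemma mehler_continuous_time (x z : V) : continuous (fun s : R => u (mehler s x z)).
Proof.
move=> s; apply: (@continuous_comp _ _ _ (fun s : R => mehler s x z) u); last exact: cu.
apply: cvgD; apply: cvgZr_tmp.
  by apply: continuous_comp; [exact: cvgN|exact: continuous_expR].
apply: (@continuous_comp _ _ _ (fun s : R => 1 - expR (- (2 * s))) (@Num.sqrt R)); last exact: sqrt_continuous.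
apply: cvgB; first exact: cvg_cst.
apply: (@continuous_comp _ _ _ (fun s : R => - (2 * s)) (@expR R)); last exact: continuous_expR.
by apply: cvgN; apply: cvgM; [exact: cvg_cst|exact: cvg_id].
Qed.

Lemma ou_continuous_time x : continuous (fun s : R => v s x).
Proof.
apply: (@bounded_Rintegral_continuous _ _ _ gamma (fun s z => u (mehler s x z)) U).
- move=> s; apply: measurableT_comp; first exact: continuous_measurable_rV.
  exact: (measurableT_comp (measurable_mehler s) (pair1_measurable x)).
- by move=> s y; exact: uU.
- by move=> y; exact: mehler_continuous_time.
Qed.

Lemma ou_energy_continuous (w : V -> R) : bounded_measurable w ->
  continuous (fun s : R => \int[gamma]_x (w x * v s x ^+ 2)).
Proof.
move=> bw; have [mw [W wW]] := bw.
apply: (@bounded_Rintegral_continuous _ _ _ gamma (fun s x => w x * v s x ^+ 2) (W * U ^+ 2)).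
- move=> s; apply: measurable_funM => //; apply: measurable_funX.
  by have [] := ou_bounded s bounded_measurable_u.
- move=> s x; rewrite normrM ler_pM// normrX lerXn2r ?nnegrE// ?ou_le//.
  by rewrite (le_trans _ (uU 0)).
- move=> y s; apply: cvgM; first exact: cvg_cst.
  by apply: (@continuous_comp _ _ _ (fun s : R => v s y) (fun r => r ^+ 2));
    [exact: ou_continuous_time|exact: exprn_continuous].
Qed.

(* By symmetry of the semigroup, \int v_(s-e) v_s = \int v_(s-e/2)^2. *)
Lemma ou_time_difference s e : 0 < e -> e < s ->
  \int[gamma]_x ((v (s - e) x - v s x) ^+ 2) =
  \int[gamma]_x (v (s - e) x ^+ 2) - 2 * \int[gamma]_x (v (s - e / 2) x ^+ 2)
  + \int[gamma]_x (v s x ^+ 2).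
Proof.
move=> e0 es.
have bv r := ou_bounded r bounded_measurable_u.
have e20 : 0 < e / 2 by rewrite divr_gt0.
have se0 : 0 < s - e by rewrite subr_gt0.
have se2 : 0 < s - e / 2 by lra.
have vE : v (s - e / 2) = ou_semigroup (e / 2) (v (s - e)).
  apply/funext => x; rewrite (ou_semigroupD x se0 e20 bounded_measurable_u).
  by congr (ou_semigroup _ u x); field.
have vE' : v s = ou_semigroup (e / 2) (v (s - e / 2)).
  apply/funext => x; rewrite (ou_semigroupD x se2 e20 bounded_measurable_u).
  by congr (ou_semigroup _ u x); field.
have key (f g k : V -> R) : bounded_measurable f -> g = ou_semigroup (e / 2) f ->
    k = ou_semigroup (e / 2) g -> \int[gamma]_x ((f x - k x) ^+ 2) =
    \int[gamma]_x (f x ^+ 2) - 2 * \int[gamma]_x (g x ^+ 2) + \int[gamma]_x (k x ^+ 2).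
  move=> bf gE kE.
  have bg : bounded_measurable g by rewrite gE; exact: ou_bounded.
  have bk : bounded_measurable k by rewrite kE; exact: ou_bounded.
  have mid : \int[gamma]_x (g x ^+ 2) = \int[gamma]_x (f x * k x).
    rewrite kE (ou_symmetric e20 bf bg) -gE.
    by apply: eq_Rintegral => x _; rewrite expr2.
  rewrite mid.
  have bfk := bounded_measurableM bf bk.
  have b2 : bounded_measurable (fun x => 2 * (f x * k x)).
    by apply: bounded_measurableM => //; exact: bounded_measurable_cst.
  have bf2 := bounded_measurable_sqr bf; have bk2 := bounded_measurable_sqr bk.
  rewrite -(bounded_RintegralZl gamma 2 bfk) -(bounded_RintegralB gamma bf2 b2).
  rewrite -(bounded_RintegralD gamma (bounded_measurableB bf2 b2) bk2).
  by apply: eq_Rintegral => x _; ring.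
exact: (key _ _ _ (bv (s - e)) vE vE').
Qed.

(** The time is set back by [h m], because the semigroup at time [h m] carries that function to the
    one at time t^2, to which the gradient bound is to be applied. *)
Definition energy_density (m : nat) (p : V * R) : R :=
  mehler_dev (h m) (v (p.2 ^+ 2 - h m)) p.1 / h m.

Lemma energy_density_ge0 m p : 0 <= energy_density m p.
Proof. by rewrite divr_ge0 ?mehler_dev_ge0// ltW// harmonic_gt0. Qed.

Lemma measurable_energy_density m : measurable_fun setT (energy_density m).
Proof.
apply: measurable_funM => //.
have mt : measurable_fun setT (fun q : V * R * V => q.1.2 ^+ 2 - h m).
  apply: measurable_funB => //; apply: measurable_funX.
  exact: (measurableT_comp measurable_snd measurable_fst).
have m1 : measurable_fun setT (fun q : V * R * V => (q.1.2 ^+ 2 - h m, q.1.1)).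
  apply: measurable_fun_pair => //; exact: (measurableT_comp measurable_fst measurable_fst).
have m2 : measurable_fun setT (fun q : V * R * V => (q.1.2 ^+ 2 - h m, mehler (h m) q.1.1 q.2)).
  apply: measurable_fun_pair => //.
  apply: (measurableT_comp (measurable_mehler (h m)) (f := fun p => mehler (h m) p.1 p.2)
     (g := fun q : V * R * V => (q.1.1, q.2))).
  apply: measurable_fun_pair => //; exact: (measurableT_comp measurable_fst measurable_fst).
have bt := ou_bounded_time bounded_measurable_u.
have b12 := bounded_measurable_sqr (bounded_measurableB
  (bounded_measurable_comp m2 bt) (bounded_measurable_comp m1 bt)).
by have [] := bounded_measurable_Rfubini gamma b12.
Qed.

(* A measurable substitute for |grad v_{t^2}(y)|^2, to which Fatou applies. *)
Definition energy_limit (p : V * R) : \bar R := limn_einf (fun m => (energy_density m p)%:E).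

Lemma energy_limit_ge0 p : (0 <= energy_limit p)%E.
Proof. by apply: le_limn_einf; near=> m; rewrite lee_fin energy_density_ge0.
Unshelve. all: by end_near. Qed.

Lemma measurable_energy_limit : measurable_fun setT energy_limit.
Proof.
apply: (emeasurable_fun_cvg (fun N p => einfs (fun m => (energy_density m p)%:E) N)).
  move=> N; apply: measurable_fun_einfs => m; apply/measurable_EFinP.
  exact: measurable_energy_density.
by move=> p _; rewrite /energy_limit limn_einf_lim; exact: is_cvg_einfs.
Qed.

(** The bound holds for every m with h_m < t^2, hence for the lower limit. The factor is [n.+1] and
    not [n] so that it can be divided out. *)
Lemma gradient_le_energy_limit y t : 0 < t ->
  ((enorm (gradient (v (t ^+ 2)) y) ^+ 2)%:E <= n.+1%:R%:E * energy_limit (y, t))%E.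
Proof.
move=> t0; have t20 : 0 < t ^+ 2 by rewrite exprn_gt0.
have ht : \forall m \near \oo, h m < t ^+ 2.
  have := @cvgr_lt _ _ _ _ _ _ (@cvg_harmonic R) (t ^+ 2); exact.
rewrite -lee_pdivrMl ?ltr0n// -EFinM.
apply: le_limn_einf; near=> m.
rewrite lee_fin ler_pdivrMl ?ltr0n// /energy_density /=.
have hm : h m < t ^+ 2 by near: m.
have th : 0 < t ^+ 2 - h m by rewrite subr_gt0.
have hm0 : 0 < h m by exact: harmonic_gt0.
have -> : v (t ^+ 2) = ou_semigroup (h m) (v (t ^+ 2 - h m)).
  by apply/funext => x; rewrite (ou_semigroupD x th hm0 bounded_measurable_u) subrK.
apply: (le_trans (gradient_ou_sqr y hm0 (ou_bounded _ bounded_measurable_u))).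
by rewrite ler_wpM2r ?ler_nat// divr_ge0 ?mehler_dev_ge0// ltW.
Unshelve. all: by end_near. Qed.

(* Integrated form of d/ds \int eta^2 v_s^2 = -2 \int (eta^2 |grad v_s|^2
   + 2 eta v_s grad v_s . grad eta), where L is a local Lipschitz bound for eta. *)
Lemma local_energy_inequality (eta L : V -> R) (B Lm rho t1 t0 delta Lam : R) :
  0 < t1 -> t1 < t0 -> 0 < delta -> delta < t1 ^+ 2 -> 0 < rho ->
  bounded_measurable eta -> bounded_measurable L ->
  (forall x, `|eta x| <= B) -> (forall x, 0 <= L x <= Lm) ->
  (forall x y, enorm (x - y) <= rho -> `|eta x - eta y| <= L x * enorm (x - y)) ->
  (forall s, t1 ^+ 2 - delta <= s <= t0 ^+ 2 -> \int[gamma]_x (v s x ^+ 2 * L x ^+ 2) <= Lam) ->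
  (\int[gamma \x mu]_p
     ((\1_`[t1, t0] p.2 * (2 * p.2) * eta p.1 ^+ 2)%:E * energy_limit p)
   <= (2 * (\int[gamma]_x (eta x ^+ 2 * v (t1 ^+ 2) x ^+ 2)
            - \int[gamma]_x (eta x ^+ 2 * v (t0 ^+ 2) x ^+ 2))
       + 16 * @moment_constant R n * Lam * (t0 ^+ 2 - t1 ^+ 2))%:E)%E.
Proof.
move=> t10 t1t0 d0 dt1 rho0 be bL eB LL etaL vLam.
have be2 := bounded_measurable_sqr be.
pose Bf (s : R) := \int[gamma]_x (eta x ^+ 2 * v s x ^+ 2).
pose bf (s : R) := \int[gamma]_x (1 * v s x ^+ 2).
have cB : continuous Bf by exact: ou_energy_continuous.
have cb : continuous bf by apply: ou_energy_continuous; exact: bounded_measurable_cst.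
pose K := 2 * (2 * Lm ^+ 2 * U ^+ 2 + 128 * B ^+ 2 * U ^+ 2 / rho ^+ 4) * @moment_constant R n.
have [r [rE rcvg]] := energy_calculus (2) (2 * B ^+ 2) (16 * @moment_constant R n * Lam) (4 * K) cB cb t1t0.
have bv s := ou_bounded s bounded_measurable_u.
have hdelta : \forall m \near \oo, h m < delta.
  have := @cvgr_lt _ _ _ _ _ _ (@cvg_harmonic R) delta; exact.
(* The factor 2t is the Jacobian of s = t^2. *)
pose w (p : V * R) : R := \1_`[t1, t0] p.2 * (2 * p.2) * eta p.1 ^+ 2.
have w0 p : 0 <= w p.
  rewrite /w indicE; case: (boolP (p.2 \in _)) => [|_]; last by rewrite !mul0r.
  rewrite inE /= in_itv/= => /andP[tp _]; rewrite mul1r mulr_ge0 ?sqr_ge0// mulr_ge0//.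
  by rewrite (le_trans _ tp)// ltW.
have mw : measurable_fun setT w.
  apply: measurable_funM; last exact: (measurableT_comp be2.1 measurable_fst).
  apply: measurable_funM; last exact: measurable_funM.
  have mi : measurable_fun setT (\1_`[t1, t0] : R -> R) by exact: measurable_indic.
  exact: (measurableT_comp mi measurable_snd).
pose f m (p : V * R) := (w p * energy_density m p)%:E.
have f0 m p : (0 <= f m p)%E by rewrite lee_fin mulr_ge0// energy_density_ge0.
have mf m : measurable_fun setT (f m).
  by apply/measurable_EFinP; apply: measurable_funM => //; exact: measurable_energy_density.
apply: (@le_trans _ _ (\int[gamma \x mu]_p limn_einf (f^~ p))%E).
  apply: ge0_le_integral => //.
  - by move=> p _; rewrite mule_ge0 ?lee_fin ?w0// energy_limit_ge0.
  - by apply: emeasurable_funM; [exact/measurable_EFinP|exact: measurable_energy_limit].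
  - apply: (emeasurable_fun_cvg (fun N p => einfs (f^~ p) N)).
      by move=> N; exact: measurable_fun_einfs.
    by move=> p _; rewrite limn_einf_lim; exact: is_cvg_einfs.
  - move=> p _; apply: le_trans (limn_einfZl (w0 p) _) _ => [m|].
      by rewrite lee_fin energy_density_ge0.
    by [].
(* After Fatou only an upper bound at each fixed [h m] is needed; its time integral is exactly
   [r m], whose limit is known. *)
apply: le_trans (fatou (gamma \x mu)%E measurableT mf (fun m p _ => f0 m p)) _.
apply: (limn_einf_le_cvg _ rcvg); near=> m.
have hm : h m < delta by near: m.
have hm0 : 0 < h m by exact: harmonic_gt0.
have hm1 : h m <= 1 by exact: harmonic_le1.
rewrite (fubini_tonelli2 (m1 := gamma) (m2 := mu) (f m) (mf m) (f0 m)) -rE.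
rewrite [leRHS]integral_mkcond.
(* At a fixed time, the discrete energy inequality for the step from s - h to s, divided by h. *)
have step t : t1 <= t <= t0 ->
  \int[gamma]_x (eta x ^+ 2 * mehler_dev (h m) (v (t ^+ 2 - h m)) x) / h m <=
   (2 * (Bf (t ^+ 2 - h m) - Bf (t ^+ 2)) + 2 * B ^+ 2 * (bf (t ^+ 2 - h m) -
      2 * bf (t ^+ 2 - h m / 2) + bf (t ^+ 2))) / h m + 16 * @moment_constant R n * Lam + 4 * K * h m.
  move=> /andP[t1t tt0].
  have t00 : 0 <= t by lra.
  have st1 : t1 ^+ 2 <= t ^+ 2 by rewrite lerXn2r ?nnegrE// ltW.
  have st0 : t ^+ 2 <= t0 ^+ 2 by rewrite lerXn2r ?nnegrE// (le_trans t00).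
  set s := t ^+ 2 in st1 st0 *.
  have hs : h m < s by lra.
  have sh0 : 0 < s - h m by rewrite subr_gt0.
  have vs : ou_semigroup (h m) (v (s - h m)) = v s.
    by apply/funext => x; rewrite (ou_semigroupD x sh0 hm0 bounded_measurable_u) subrK.
  have dstep (f1 k : V -> R) : bounded_measurable f1 -> ou_semigroup (h m) f1 = k ->
     \int[gamma]_x (eta x ^+ 2 * mehler_dev (h m) f1 x) <=
    2 * (\int[gamma]_x (eta x ^+ 2 * f1 x ^+ 2) - \int[gamma]_x (eta x ^+ 2 * k x ^+ 2))
    + 2 * \int[gamma]_x (eta x ^+ 2 * (f1 x - k x) ^+ 2)
    + 4 * expect2 (fun p => (eta p.1 - eta (mehler (h m) p.1 p.2)) ^+ 2 * f1 p.1 ^+ 2).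
    by move=> bf' <-; exact: dirichlet_step.
  have D := dstep _ _ (bv (s - h m)) vs.
  have osc := oscillation_bound (h := h m) _ rho0 (bv (s - h m)) be bL
     (fun x => ou_le (s - h m) x) eB LL etaL.
  have {}osc := osc ltac:(by rewrite hm0 hm1).
  (* The inequality looks back to s - h, possibly before t1^2; [delta] leaves room for this once h <
     delta. *)
  have sr : t1 ^+ 2 - delta <= s - h m <= t0 ^+ 2.
    apply/andP; split; first exact: lerB st1 (ltW hm).
    by rewrite lerBlDr ler_wpDr// ltW.
  have Ls := vLam _ sr.
  (* The weight is replaced by its bound, so that the semigroup identity without weight applies; the
     resulting second difference in time vanishes in the limit. *)
  have diff : \int[gamma]_x (eta x ^+ 2 * (v (s - h m) x - v s x) ^+ 2) <=
      B ^+ 2 * (bf (s - h m) - 2 * bf (s - h m / 2) + bf s).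
    have bfE r' : bf r' = \int[gamma]_x (v r' x ^+ 2) by apply: eq_Rintegral => x _; rewrite mul1r.
    have E := ou_time_difference hm0 hs.
    have -> : bf (s - h m) - 2 * bf (s - h m / 2) + bf s = \int[gamma]_x ((v (s - h m) x - v s x) ^+ 2).
      by rewrite (bfE (s - h m)) (bfE (s - h m / 2)) (bfE s).
    have Bsq f1 k : bounded_measurable f1 -> bounded_measurable k ->
       \int[gamma]_x (eta x ^+ 2 * (f1 x - k x) ^+ 2) <= B ^+ 2 * \int[gamma]_x ((f1 x - k x) ^+ 2).
      move=> bf' bk'.
      have bd := bounded_measurable_sqr (bounded_measurableB bf' bk').
      rewrite -(bounded_RintegralZl gamma _ bd).
      apply: bounded_le_Rintegral; [exact: bounded_measurableM|..].
        by apply: bounded_measurableM => //; exact: bounded_measurable_cst.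
      move=> x; rewrite ler_wpM2r ?sqr_ge0// -[eta x ^+ 2]real_normK ?num_real//.
      by rewrite lerXn2r ?nnegrE// (le_trans _ (eB x)).
    exact: Bsq.
  rewrite ler_pdivrMr//.
  have M0 := @moment_constant_ge0 R n.
  have fin (M Bs Bs' Y I1 E2 hh J : R) : 0 < hh -> 0 <= M -> I1 <= B ^+ 2 * Y -> J <= Lam ->
      E2 <= 4 * hh * M * J + hh ^+ 2 * (2 * (2 * Lm ^+ 2 * U ^+ 2 + 128 * B ^+ 2 * U ^+ 2 / rho ^+ 4) * M) ->
      2 * (Bs - Bs') + 2 * I1 + 4 * E2 <= ((2 * (Bs - Bs') + 2 * B ^+ 2 * Y) / hh
      + 16 * M * Lam + 4 * (2 * (2 * Lm ^+ 2 * U ^+ 2 + 128 * B ^+ 2 * U ^+ 2 / rho ^+ 4) * M) * hh) * hh.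
    move: (2 * (2 * Lm ^+ 2 * U ^+ 2 + _) * M) => KK hh0 MM0 hI hJ hE.
    have -> : ((2 * (Bs - Bs') + 2 * B ^+ 2 * Y) / hh + 16 * M * Lam + 4 * KK * hh) * hh =
       2 * (Bs - Bs') + 2 * (B ^+ 2 * Y) + 4 * (4 * hh * M * Lam + hh ^+ 2 * KK).
      by field; rewrite gt_eqF.
    apply: lerD; first by rewrite lerD2l ler_wpM2l.
    rewrite ler_wpM2l//; apply: (le_trans hE); rewrite lerD2r ler_wpM2l//.
    by rewrite !mulr_ge0// ltW.
  exact: (le_trans D (fin _ _ _ _ _ _ _ _ hm0 M0 diff Ls osc)).
pose Rm (t : R) : R := ((2 * (Bf (t ^+ 2 - h m) - Bf (t ^+ 2)) + 2 * B ^+ 2 * (bf (t ^+ 2 - h m) -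
      2 * bf (t ^+ 2 - h m / 2) + bf (t ^+ 2))) / h m + 16 * @moment_constant R n * Lam + 4 * K * h m) * (2 * t).
have mRm : measurable_fun setT Rm.
  apply: continuous_measurable_fun; exact: (@continuous_energy_integrand R Bf bf 2 (2 * B ^+ 2) (16 * @moment_constant R n * Lam) (4 * K) (h m) cB cb).
have bdev t : bounded_measurable (fun y => eta y ^+ 2 * mehler_dev (h m) (v (t ^+ 2 - h m)) y).
  apply: bounded_measurableM => //.
  have bvt := bv (t ^+ 2 - h m).
  exact: (bounded_measurable_Rfubini gamma (bounded_measurable_sqr (bounded_measurableB
     (bounded_measurable_comp (measurable_mehler (h m)) bvt) (bounded_measurable_fst bvt)))).
have inner t : t1 <= t <= t0 -> (\int[gamma]_y f m (y, t) <= (Rm t)%:E)%E.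
  move=> tt; have t00 : 0 <= 2 * t by move: tt => /andP[]; lra.
  have -> : (\int[gamma]_y f m (y, t) = \int[gamma]_y
     ((2 * t / h m) * (eta y ^+ 2 * mehler_dev (h m) (v (t ^+ 2 - h m)) y))%:E)%E.
    apply: eq_integral => y _; rewrite /f /w /energy_density /= indicE mem_set; last first.
      by rewrite /= in_itv.
    by congr (_%:E); rewrite mul1r; ring.
  have b2 : bounded_measurable (fun y => (2 * t / h m) * (eta y ^+ 2 * mehler_dev (h m) (v (t ^+ 2 - h m)) y)).
    by apply: bounded_measurableM => //; exact: bounded_measurable_cst.
  rewrite -(bounded_EFin_Rintegral gamma b2) lee_fin (bounded_RintegralZl gamma _ (bdev t)).
  rewrite /Rm mulrC mulrA [leLHS]mulrC mulrA mulrC.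
  rewrite [leRHS]mulrC ler_wpM2l//.
  by apply: le_trans (step t tt); rewrite mulrC.
have fin0 t : (0 <= \int[gamma]_y f m (y, t))%E by apply: integral_ge0 => y _; exact: f0.
apply: ge0_le_integral => //.
- by move=> t _; exact: fin0.
- exact: (measurable_fun_fubini_tonelli_G (m1 := gamma) (f m) (mf m) (f0 m)).
- apply/measurable_restrict => //; rewrite setTI; apply/measurable_EFinP.
  exact: measurable_funTS mRm.
- move=> t _; rewrite /fubini_G patchE; case: ifPn => [|nt].
    by rewrite inE /= in_itv/= => tt; exact: inner.
  rewrite integral0_eq// => y _; rewrite /f /w indicE.
  have -> : (y, t).2 \in `[t1, t0]%classic = false by exact/negbTE.
  by rewrite !mul0r.
Unshelve. all: by end_near. Qed.

End energy.

(** * Weights built from the maximal function *)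

Section gaussian_balls.
Context {R : realType} {n : nat}.
Local Notation V := 'rV[R]_n.
Local Notation gamma := (@gaussian_measure R n).
Implicit Types (x y z : V) (r t d : R).

Lemma enorm_sqr_dist x y d : enorm (x - y) <= d ->
  `|enorm x ^+ 2 - enorm y ^+ 2| <= d * (2 * enorm y + d).
Proof.
move=> xyd; have d0 : 0 <= d := le_trans (enorm_ge0 _) xyd.
have h1 : enorm x <= enorm y + d.
  rewrite -{1}(subrK y x); apply: (le_trans (enormD _ _)).
  by rewrite addrC lerD2l.
have h2 : enorm y <= enorm x + d.
  rewrite -{1}(subrK x y); apply: (le_trans (enormD _ _)).
  by rewrite addrC lerD2l enorm_distC.
have x0 := enorm_ge0 x; have y0 := enorm_ge0 y.
move: h1 h2 x0 y0; set a := enorm x; set b := enorm y => h1 h2 x0 y0.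
have -> : a ^+ 2 - b ^+ 2 = (a - b) * (a + b) by ring.
rewrite normrM; apply: ler_pM => //.
  by rewrite ler_distl; apply/andP; split; lra.
by rewrite ger0_norm; lra.
Qed.

(** Doubling-type control at admissible scales: when d |y| and d are bounded, the density is
    comparable to its value at y on the ball of radius d. *)
Lemma gaussian_density_le x y d : enorm (x - y) <= d ->
  gaussian_density x <= expR (d * (2 * enorm y + d)) * gaussian_density y.
Proof.
move=> xyd; have := enorm_sqr_dist xyd; rewrite ler_norml => /andP[h _].
have d0 : 0 <= d := le_trans (enorm_ge0 _) xyd.
rewrite /gaussian_density mulrCA ler_wpM2l ?powR_ge0// -expRD ler_expR.
set q := d * _ in h *.
have q0 : 0 <= q by rewrite /q mulr_ge0// addr_ge0// mulr_ge0// enorm_ge0.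
lra.
Qed.

Lemma gaussian_density_ge x y d : enorm (x - y) <= d ->
  gaussian_density y <= expR (d * (2 * enorm y + d)) * gaussian_density x.
Proof.
move=> xyd; have := enorm_sqr_dist xyd; rewrite ler_norml => /andP[_ h].
have d0 : 0 <= d := le_trans (enorm_ge0 _) xyd.
rewrite /gaussian_density mulrCA ler_wpM2l ?powR_ge0// -expRD ler_expR.
set q := d * _ in h *.
have q0 : 0 <= q by rewrite /q mulr_ge0// addr_ge0// mulr_ge0// enorm_ge0.
lra.
Qed.

Lemma lebesgue_eball_le x r : 0 < r -> (lebesgue_rV (eball x r) <= ((2 * r) ^+ n)%:E)%E.
Proof.
move=> r0; rewrite -(lebesgue_rV_cube x r0); apply: le_measure.
- by rewrite inE; exact: measurable_eball.
- by rewrite inE; exact: measurable_cube.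
- move=> y /= yr i; apply: le_lt_trans yr.
  by have := coord_le_enorm (y - x) i; rewrite !mxE.
Qed.

(** A cube of half-side r / (n + 1) fits into the open ball, since |x| is at most n times the
    largest coordinate. *)
Lemma lebesgue_eball_ge x r : 0 < r ->
  (((2 * (r / n.+1%:R)) ^+ n)%:E <= lebesgue_rV (eball x r))%E.
Proof.
move=> r0; have rn0 : 0 < r / n.+1%:R by rewrite divr_gt0.
rewrite -(lebesgue_rV_cube x rn0); apply: le_measure.
- by rewrite inE; exact: measurable_cube.
- by rewrite inE; exact: measurable_eball.
- move=> y /= yr; rewrite /eball/=.
  apply: (@le_lt_trans _ _ (n%:R * (r / n.+1%:R))).
    by apply: enorm_le_cube => i; rewrite !mxE ltW.
  by rewrite mulrA ltr_pdivrMr// mulrC ltr_pM2l// ltr_nat.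
Qed.

Lemma gaussianE (A : set V) : gamma A = (\int[@lebesgue_rV R n]_(x in A) (gaussian_density x)%:E)%E.
Proof. by []. Qed.

Let mg (A : set V) : measurable_fun A (fun x : V => (gaussian_density x)%:E).
Proof. by apply: measurable_funTS; apply/measurable_EFinP; exact: measurable_gaussian_density. Qed.

(** The density is compared at a point [y] that need not be the centre: a ball about a midpoint is
    to be measured by the density at an endpoint. *)
Lemma gaussian_eball_le x y r t : 0 < r -> enorm (x - y) + r <= t ->
  (gamma (eball x r) <= (expR (t * (2 * enorm y + t)) * gaussian_density y * (2 * r) ^+ n)%:E)%E.
Proof.
move=> r0 xyt; rewrite gaussianE.
apply: (@le_trans _ _ (\int[@lebesgue_rV R n]_(z in eball x r)
    (cst (expR (t * (2 * enorm y + t)) * gaussian_density y)%:E) z)%E).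
  apply: ge0_le_integral => //; first exact: measurable_eball.
  - by move=> z _; rewrite lee_fin gaussian_density_ge0.
  - move=> z zx; rewrite lee_fin; apply: gaussian_density_le.
    apply: le_trans (enorm_triangle x _ _) _; apply: le_trans xyt.
    by rewrite addrC lerD2l ltW.
rewrite integral_cst; last exact: measurable_eball.
rewrite [leRHS]EFinM; apply: lee_wpmul2l; last exact: lebesgue_eball_le.
by rewrite lee_fin mulr_ge0 ?expR_ge0 ?gaussian_density_ge0.
Qed.

Lemma gaussian_eball_ge x r t : 0 < r -> r <= t ->
  ((expR (- (t * (2 * enorm x + t))) * gaussian_density x * (2 * (r / n.+1%:R)) ^+ n)%:E
   <= gamma (eball x r))%E.
Proof.
move=> r0 rt; rewrite gaussianE.
apply: (@le_trans _ _ (\int[@lebesgue_rV R n]_(z in eball x r)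
    (cst (expR (- (t * (2 * enorm x + t))) * gaussian_density x)%:E) z)%E).
  rewrite integral_cst; last exact: measurable_eball.
  rewrite EFinM lee_wpmul2l ?lebesgue_eball_ge// lee_fin.
  by rewrite mulr_ge0 ?expR_ge0 ?gaussian_density_ge0.
apply: ge0_le_integral => //; first exact: measurable_eball.
- by move=> z _; rewrite lee_fin mulr_ge0 ?expR_ge0 ?gaussian_density_ge0.
- move=> z zx; rewrite lee_fin expRN ler_pdivrMl ?expR_gt0//.
  by apply: gaussian_density_ge; rewrite (le_trans _ rt)// ltW.
Qed.

Lemma gaussian_eball_gt0 x r : 0 < r -> (0 < gamma (eball x r))%E.
Proof.
move=> r0; apply: lt_le_trans (gaussian_eball_ge x r0 (lexx r)).
rewrite lte_fin; apply: mulr_gt0; last by apply: exprn_gt0; rewrite mulr_gt0// divr_gt0.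
by rewrite mulr_gt0 ?expR_gt0 ?gaussian_density_gt0.
Qed.

End gaussian_balls.

(** * The infimum of the maximal function over balls, and its reciprocal *)

Section ball_infimum.
Context {R : realType} {n : nat}.
Local Notation V := 'rV[R]_n.
Variables (p : V -> R) (eps : R).
Hypothesis eps0 : 0 < eps.
Hypothesis p_ge : forall x, eps <= p x.
Implicit Types (x y z : V) (r t d : R).

Definition ball_inf y r : R := inf [set p x | x in eball y r].

Lemma ball_inf_le y r x : enorm (x - y) < r -> ball_inf y r <= p x.
Proof.
move=> xr; apply: ge_inf; last by exists x.
by exists eps => _ [z _ <-].
Qed.

Lemma ball_inf_ge y r c : 0 < r -> (forall x, enorm (x - y) < r -> c <= p x) ->
  c <= ball_inf y r.
Proof.
move=> r0 h; apply: lb_le_inf; first by exists (p y); exists y => //; exact: eball_center.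
by move=> _ [z zr <-]; exact: h.
Qed.

Lemma ball_inf_ge_eps y r : 0 < r -> eps <= ball_inf y r.
Proof. by move=> r0; apply: ball_inf_ge => // x _; exact: p_ge. Qed.

Lemma ball_inf_gt0 y r : 0 < r -> 0 < ball_inf y r.
Proof. by move=> r0; apply: lt_le_trans eps0 (ball_inf_ge_eps _ r0). Qed.

Lemma ball_inf_le_center y r : 0 < r -> ball_inf y r <= p y.
Proof. by move=> r0; apply: ball_inf_le; rewrite subrr enorm0. Qed.

Lemma ball_inf_mono y y' r r' : 0 < r' -> enorm (y' - y) + r' <= r ->
  ball_inf y r <= ball_inf y' r'.
Proof.
move=> r0 yr; apply: ball_inf_ge => // x xr; apply: ball_inf_le.
apply: lt_le_trans yr; apply: le_lt_trans (enorm_triangle y' _ _) _.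
by rewrite addrC ltrD2l.
Qed.

Lemma ball_inf_lt y r c : 0 < r -> ball_inf y r < c ->
  exists2 x, enorm (x - y) < r & p x < c.
Proof.
move=> r0; apply: contraPP => h; apply/negP; rewrite -leNgt.
apply: ball_inf_ge => // x xr; rewrite leNgt; apply/negP => pc; apply: h.
by exists x.
Qed.

(** A point of the open ball where p < c stays in the ball when y moves a little: strict sublevel
    sets are open, and the infimum is upper semicontinuous in y. *)
Lemma measurable_ball_inf r : 0 < r -> measurable_fun setT (ball_inf^~ r).
Proof.
move=> r0; apply: (measurability _ (RGenInftyO.measurableE R)) => //.
move=> _ [_ [c ->]] <-; rewrite setTI; apply: measurable_eopen => y /=.
rewrite in_itv/= => /(ball_inf_lt r0)[x xr pc].
exists (r - enorm (x - y)); first by rewrite subr_gt0.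
move=> z; rewrite /eball/= => zr; rewrite in_itv/=; apply: le_lt_trans pc.
apply: ball_inf_le; apply: le_lt_trans (enorm_triangle y _ _) _.
by rewrite addrC -ltrBrDr enorm_distC.
Qed.

(** The supremum of 1 / p over the ball: it increases with the radius, and it is lower
    semicontinuous in the centre. *)
Definition ball_sup y r : R := (ball_inf y r)^-1.

Lemma ball_sup_gt0 y r : 0 < r -> 0 < ball_sup y r.
Proof. by move=> r0; rewrite invr_gt0 ball_inf_gt0. Qed.

Lemma ball_sup_le_eps y r : 0 < r -> ball_sup y r <= eps^-1.
Proof. by move=> r0; rewrite lef_pV2 ?posrE ?ball_inf_gt0// ball_inf_ge_eps. Qed.

Lemma ball_sup_mono y y' r r' : 0 < r' -> enorm (y' - y) + r' <= r ->
  ball_sup y' r' <= ball_sup y r.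
Proof.
move=> r0 yr; have r'0 : 0 < r by apply: lt_le_trans yr; rewrite ltr_wpDl ?enorm_ge0.
by rewrite lef_pV2 ?posrE ?ball_inf_gt0// ball_inf_mono.
Qed.

Lemma measurable_ball_sup r : 0 < r -> measurable_fun setT (ball_sup^~ r).
Proof.
move=> r0; apply: (measurability _ (RGenOInfty.measurableE R)) => //.
move=> _ [_ [c ->]] <-; rewrite setTI; apply: measurable_eopen => y /=.
rewrite in_itv/= andbT => cy.
have [c0|c0] := leP c 0.
  exists 1 => // z _ /=; rewrite in_itv/= andbT; apply: le_lt_trans c0 _.
  exact: ball_sup_gt0.
have : ball_inf y r < c^-1 by rewrite -(invrK (ball_inf y r)) ltf_pV2 ?posrE// ball_sup_gt0.
move=> /(ball_inf_lt r0)[x xr pc].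
exists (r - enorm (x - y)); first by rewrite subr_gt0.
move=> z; rewrite /eball/= => zr; rewrite in_itv/= andbT.
rewrite -(invrK c) /ball_sup ltf_pV2 ?posrE ?invr_gt0 ?ball_inf_gt0//; apply: le_lt_trans pc.
apply: ball_inf_le; apply: le_lt_trans (enorm_triangle y _ _) _.
by rewrite addrC -ltrBrDr enorm_distC.
Qed.

(* For [r <= 0] the ball is empty, and [inf set0 = 0], [0^-1 = 0]. *)
Lemma ball_sup_nd y : {homo ball_sup y : r r' / r <= r'}.
Proof.
move=> r r' rr'; have [r0|r0] := ltP 0 r.
  by apply: ball_sup_mono => //; rewrite subrr enorm0 add0r.
have [r'0|r'0] := ltP 0 r'; last first.
  rewrite /ball_sup /ball_inf.
  have E s : s <= 0 -> [set p x | x in eball y s] = set0.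
    move=> s0; rewrite -subset0 => _ [x /= xs _].
    by move: xs; rewrite /eball/= ltNge (le_trans s0)// enorm_ge0.
  by rewrite !E.
apply: le_trans (ltW (ball_sup_gt0 _ r'0)).
rewrite invr_le0 /ball_inf.
rewrite (_ : [set p x | x in eball y r] = set0) ?inf0//.
rewrite -subset0 => _ [x /= xs _].
by move: xs; rewrite /eball/= ltNge (le_trans r0)// enorm_ge0.
Qed.

End ball_infimum.

(** * Moving averages of monotone functions *)

Section moving_average.
Context {R : realType}.
Local Notation mu := (@lebesgue_measure R).
Implicit Types (g : R -> R) (a b c d r t B : R).

(** The window lies to the right of [t], so for nondecreasing [g] the average is squeezed between
    g(t) and g(t + r), and in particular majorizes g(t). *)
Definition moving_average g r t : R := r^-1 * \int[mu]_(s in `]t, t + r]) g s.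

Lemma itv_lebesgue a b : a <= b -> mu `]a, b] = (b - a)%:E.
Proof.
move=> ab; rewrite lebesgue_measure_itv/= lte_fin; case: ltP => // ba.
by rewrite (_ : b - a = 0)//; apply/eqP; rewrite subr_eq0 eq_le ba ab.
Qed.

Lemma itv_lebesgue_fin a b : (mu `]a, b] < +oo)%E.
Proof. by rewrite lebesgue_measure_itv/= lte_fin; case: ifP => _; rewrite ?ltry// -EFinB ltry. Qed.

Lemma nd_integrable g a b : {homo g : s t / s <= t} ->
  mu.-integrable `]a, b] (EFin \o g).
Proof.
move=> ndg; apply: measurable_bounded_integrable => //.
- exact: itv_lebesgue_fin.
- exact: nondecreasing_measurable.
- exists (`|g a| + `|g b|); split; first exact: num_real.
  move=> M hM s /=; rewrite in_itv/= => /andP[/ltW/ndg h1 /ndg h2].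
  apply: le_trans (ltW hM); rewrite ler_norml.
  have := ler_norm (g b); have := lerNnormlW (lexx `|g a|).
  have := normr_ge0 (g a); have := normr_ge0 (g b).
  by move=> h3 h4 h5 h6; apply/andP; split; lra.
Qed.

Lemma nd_Rintegral_le g a b c : {homo g : s t / s <= t} -> a <= b ->
  g b <= c -> \int[mu]_(s in `]a, b]) g s <= (b - a) * c.
Proof.
move=> ndg ab gc.
have -> : (b - a) * c = \int[mu]_(s in `]a, b]) (cst c) s.
  rewrite Rintegral_cst//; have -> := congr1 fine (itv_lebesgue ab).
  by rewrite mulrC.
apply: le_Rintegral => //; first exact: nd_integrable.
  by apply: nd_integrable.
by move=> s /=; rewrite in_itv/= => /andP[_ sb]; apply: le_trans gc; exact: ndg.
Qed.

Lemma nd_Rintegral_ge g a b c : {homo g : s t / s <= t} -> a <= b ->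
  c <= g a -> (b - a) * c <= \int[mu]_(s in `]a, b]) g s.
Proof.
move=> ndg ab gc.
have -> : (b - a) * c = \int[mu]_(s in `]a, b]) (cst c) s.
  rewrite Rintegral_cst//; have -> := congr1 fine (itv_lebesgue ab).
  by rewrite mulrC.
apply: le_Rintegral => //; last 1 first.
  by move=> s /=; rewrite in_itv/= => /andP[/ltW sb _]; apply: le_trans gc _; exact: ndg.
  by apply: nd_integrable.
exact: nd_integrable.
Qed.

Lemma nd_Rintegral_split g a b c : {homo g : s t / s <= t} -> a <= b -> b <= c ->
  \int[mu]_(s in `]a, c]) g s = \int[mu]_(s in `]a, b]) g s + \int[mu]_(s in `]b, c]) g s.
Proof.
move=> ndg ab bc.
rewrite -(@Rintegral_itvB _ g (BRight a) (BRight c) b)//; last exact: nd_integrable.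
by rewrite addrC subrK.
Qed.

Lemma moving_average_ge g r t : {homo g : s t / s <= t} -> 0 < r ->
  g t <= moving_average g r t.
Proof.
move=> ndg r0; rewrite /moving_average ler_pdivlMl//.
have := @nd_Rintegral_ge g t (t + r) (g t) ndg.
by rewrite addrAC subrr add0r lerDl; apply => //; exact: ltW.
Qed.

Lemma moving_average_le g r t : {homo g : s t / s <= t} -> 0 < r ->
  moving_average g r t <= g (t + r).
Proof.
move=> ndg r0; rewrite /moving_average ler_pdivrMl//.
have := @nd_Rintegral_le g t (t + r) (g (t + r)) ndg.
by rewrite addrAC subrr add0r lerDl; apply => //; exact: ltW.
Qed.

Lemma le_moving_average f g r t : {homo f : s t / s <= t} -> {homo g : s t / s <= t} -> 0 < r ->
  (forall s, t < s -> f s <= g s) -> moving_average f r t <= moving_average g r t.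
Proof.
move=> ndf ndg r0 fg; rewrite /moving_average ler_pM2l ?invr_gt0//.
apply: le_Rintegral => //; [exact: nd_integrable|exact: nd_integrable|].
by move=> s /=; rewrite in_itv/= => /andP[ts _]; exact: fg.
Qed.

Lemma Rintegral_shift g a b d : {homo g : s t / s <= t} -> (forall s, 0 <= g s) ->
  \int[mu]_(s in `]a - d, b - d]) g (s + d) = \int[mu]_(s in `]a, b]) g s.
Proof.
move=> ndg g0; rewrite /Rintegral; congr fine.
pose f := (fun s => (g s)%:E) \_ `]a, b] : R -> \bar R.
transitivity (\int[mu]_x f (x + d)%R)%E.
  apply: etrans (integral_mkcond _ _) _.
  apply: eq_integral => x _; rewrite /f !patchE !mem_setE !in_itv/=.
  by rewrite ltrBlDr lerBrDr.
apply: etrans (esym (integral_mkcond _ _)).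
apply: ge0_integral_shift => [|x]; last by rewrite /f patchE; case: ifP; rewrite ?lee_fin.
rewrite /f -measurable_restrictT//.
by apply/measurable_EFinP; apply: nondecreasing_measurable.
Qed.

(** Shifting the window by d removes an interval of length d where g >= g(t) and adds one where g <=
    g(t + r + d). *)
Lemma moving_average_shift_le g r t d : {homo g : s t / s <= t} -> (forall s, 0 <= g s) ->
  0 < r -> 0 <= d ->
  moving_average (fun s : R => g (s + d)) r t <=
  moving_average g r t + d / r * (g (t + r + d) - g t).
Proof.
move=> ndg g0 r0 d0; rewrite /moving_average.
have -> : \int[mu]_(s in `]t, t + r]) g (s + d) = \int[mu]_(s in `]t + d, t + r + d]) g s.
  by rewrite -(@Rintegral_shift g _ _ d)// !addrK.
rewrite (mulrC d) -mulrA -mulrDr ler_pM2l ?invr_gt0//.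
have tt : t <= t + d by rewrite lerDl.
have rr : t + r <= t + r + d by rewrite lerDl.
have tr : t <= t + r by rewrite lerDl ltW.
have dr : t + d <= t + r + d by rewrite lerD2r.
have h1 := nd_Rintegral_split ndg tt dr.
have h2 := nd_Rintegral_split ndg tr rr.
have h3 := nd_Rintegral_ge ndg tt (lexx (g t)).
have h4 := nd_Rintegral_le ndg rr (lexx (g (t + r + d))).
rewrite h1 in h2.
have e3 : t + d - t = d by ring.
have e4 : t + r + d - (t + r) = d by ring.
rewrite e3 in h3; rewrite e4 in h4; rewrite mulrBr.
move: h2 h3 h4; move: (\int[_]_(s in _) _) (\int[_]_(s in _) _) (\int[_]_(s in _) _) (\int[_]_(s in _) _).
by move: (d * _) (d * _) => p q A B C D h2 h3 h4; lra.
Qed.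

End moving_average.

(** * Cutoffs and regularized weights *)

Section cutoff.
Context {R : realType} {n : nat}.
Local Notation V := 'rV[R]_n.
Implicit Types (x y z : V) (c r t d rho : R).

Definition cutoff c y : R := Num.max 0 (Num.min 1 (2 - c * enorm y)).

Lemma cutoff_ge0 c y : 0 <= cutoff c y.
Proof. by rewrite /cutoff le_max lexx. Qed.

Lemma cutoff_le1 c y : cutoff c y <= 1.
Proof. by rewrite /cutoff ge_max ler01 ge_min lexx. Qed.

Lemma cutoff_eq1 c y : c * enorm y <= 1 -> cutoff c y = 1.
Proof.
move=> cy; rewrite /cutoff min_l; last by lra.
by rewrite max_r.
Qed.

Lemma cutoff_eq0 c y : 2 <= c * enorm y -> cutoff c y = 0.
Proof.
move=> cy; rewrite /cutoff max_l// ge_min; apply/orP; right; lra.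
Qed.

Lemma cutoff_mono c c' y : c' <= c -> cutoff c y <= cutoff c' y.
Proof.
move=> cc; have := enorm_ge0 y => y0.
rewrite /cutoff ge_max le_max lexx/= le_max; apply/orP; right.
rewrite le_min !ge_min lexx/=; apply/orP; right.
by rewrite lerD2l lerN2 ler_wpM2r.
Qed.

Lemma clip_lip (a b : R) : 
  `|Num.max 0 (Num.min 1 a) - Num.max 0 (Num.min 1 b)| <= `|a - b|.
Proof.
have [h1|h1] := leP 1 a; have [h2|h2] := leP 1 b;
rewrite !maxEle ?ler01; try (case: ifP => h3); try (case: ifP => h4);
rewrite ler_norml; have := ler_norm (a - b); have := lerNnormlW (lexx `|a - b|);
move=> h5 h6; try (move/negbT: h3; rewrite -ltNge => h3);
try (move/negbT: h4; rewrite -ltNge => h4);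
by apply/andP; split; lra.
Qed.

Lemma cutoff_lip c x y : 0 <= c -> `|cutoff c x - cutoff c y| <= c * enorm (x - y).
Proof.
move=> c0; apply: le_trans (clip_lip _ _) _.
have -> : 2 - c * enorm x - (2 - c * enorm y) = c * (enorm y - enorm x) by ring.
rewrite normrM ger0_norm// ler_wpM2l// ler_norml; apply/andP; split.
  by have := enormD (x - y) y; rewrite subrK; lra.
by have := enormD (y - x) x; rewrite subrK enorm_distC; lra.
Qed.

Lemma measurable_cutoff c : 0 <= c -> measurable_fun setT (cutoff c).
Proof.
move=> c0; apply: eball_continuous_measurable => x e e0.
exists (e / (c + 1)); first by rewrite divr_gt0// ltr_wpDl.
move=> y; rewrite /eball/= => yx; apply: le_lt_trans (cutoff_lip _ _ c0) _.
rewrite enorm_distC; apply: (@le_lt_trans _ _ ((c + 1) * enorm (y - x))).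
  by rewrite ler_wpM2r ?enorm_ge0// lerDl.
by rewrite -ltr_pdivlMl ?ltr_wpDl// mulrC.
Qed.

End cutoff.

Section smoothed_weight.
Context {R : realType} {n : nat}.
Local Notation V := 'rV[R]_n.
Variables (p : V -> R) (eps : R).
Hypothesis eps0 : 0 < eps.
Hypothesis p_ge : forall x, eps <= p x.
Implicit Types (x y z : V) (c r t d rho : R).
Local Notation G := (ball_sup p).

Let ndG y : {homo (fun s => Num.sqrt (G y s)) : s t / s <= t}.
Proof. by move=> s t st; rewrite ler_wsqrtr//; apply: (ball_sup_nd eps0 p_ge) st. Qed.

(* Averaging over the radius makes the local Lipschitz constant a difference of
   values at two radii, as needed for the telescoping. *)
Definition smoothed_weight r t y : R := moving_average (fun s : R => Num.sqrt (G y s)) r t.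

Lemma smoothed_weight_ge r t y : 0 < r -> Num.sqrt (G y t) <= smoothed_weight r t y.
Proof. by move=> r0; apply: (@moving_average_ge _ (fun s : R => Num.sqrt (G y s))) => //; exact: ndG. Qed.

Lemma smoothed_weight_le r t y : 0 < r -> smoothed_weight r t y <= Num.sqrt (G y (t + r)).
Proof. by move=> r0; apply: (@moving_average_le _ (fun s : R => Num.sqrt (G y s))) => //; exact: ndG. Qed.

Lemma smoothed_weight_ge0 r t y : 0 < r -> 0 <= smoothed_weight r t y.
Proof. by move=> r0; apply: le_trans (smoothed_weight_ge t y r0); rewrite sqrtr_ge0. Qed.

(** The ball of radius s about y' lies in the ball of radius s + d about y: a displacement in space
    becomes a shift of the radius, to which the moving-average estimate applies. *)
Lemma smoothed_weight_shift r t y y' d : 0 < r -> 0 <= t -> enorm (y' - y) <= d ->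
  smoothed_weight r t y' <= smoothed_weight r t y
    + d / r * (Num.sqrt (G y (t + r + d)) - Num.sqrt (G y t)).
Proof.
move=> r0 t0 yd; have d0 : 0 <= d := le_trans (enorm_ge0 _) yd.
apply: le_trans (@moving_average_shift_le _ (fun s : R => Num.sqrt (G y s)) r t d _ _ r0 d0).
- have nd' : {homo (fun s : R => Num.sqrt (G y (s + d))) : s t / s <= t}.
    by move=> a b ab; apply: ndG; rewrite lerD2r.
  apply: (le_moving_average (ndG y') nd' r0) => s ts; rewrite ler_wsqrtr//.
  apply: (ball_sup_mono eps0 p_ge); first exact: le_lt_trans ts.
  by rewrite addrC lerD2l.
- exact: ndG.
- by move=> s; rewrite sqrtr_ge0.
Qed.

(** Both one-sided bounds are expressed by values at [y] alone, as a local Lipschitz function of one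
    variable requires. This is why the second one shifts the radius down by d instead of exchanging
    the two points. *)
Lemma smoothed_weight_lip r t y y' rho : 0 < r -> rho < t -> enorm (y - y') <= rho ->
  `|smoothed_weight r t y - smoothed_weight r t y'| <=
   enorm (y - y') / r * (Num.sqrt (G y (t + r + rho)) - Num.sqrt (G y (t - rho))).
Proof.
move=> r0 rt yr; set d := enorm (y - y').
have d0 : 0 <= d := enorm_ge0 _.
have rho0 : 0 <= rho := le_trans d0 yr.
have t0 : 0 < t := le_lt_trans rho0 rt.
have nd := ndG y.
have h1 : Num.sqrt (G y (t + r + d)) <= Num.sqrt (G y (t + r + rho)) by apply: nd; rewrite lerD2l.
have h2 : Num.sqrt (G y (t - rho)) <= Num.sqrt (G y (t - d)) by apply: nd; rewrite lerD2l lerN2.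
have h3 : Num.sqrt (G y (t - d)) <= Num.sqrt (G y t) by apply: nd; rewrite gerBl.
have h4 : Num.sqrt (G y (t + r)) <= Num.sqrt (G y (t + r + d)) by apply: nd; rewrite lerDl.
have dr : 0 <= d / r by rewrite divr_ge0// ltW.
rewrite ler_norml; apply/andP; split.
  rewrite lerNl opprB lerBlDl.
  apply: le_trans (@smoothed_weight_shift r t y y' d r0 (ltW t0) _) _.
    by rewrite enorm_distC.
  by rewrite lerD2l ler_wpM2l//; lra.
rewrite lerBlDl -lerBlDr.
pose f (s : R) := Num.sqrt (G y (s - d)).
have ndf : {homo f : s s' / s <= s'} by move=> s s' ss; apply: nd; rewrite lerD2r.
have f0 s : 0 <= f s by rewrite sqrtr_ge0.
have := moving_average_shift_le t ndf f0 r0 d0.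
rewrite /f (_ : (fun s : R => Num.sqrt (G y (s + d - d))) = (fun s : R => Num.sqrt (G y s))); last first.
  by apply/funext => s; rewrite addrK.
rewrite addrK -/(smoothed_weight r t y) => h.
have : moving_average f r t <= smoothed_weight r t y'.
  apply: (le_moving_average ndf (ndG y') r0) => s ts; rewrite /f ler_wsqrtr//.
  have [sd|sd] := ltP 0 (s - d).
    by apply: (ball_sup_mono eps0 p_ge) => //; rewrite -/d addrC subrK.
  exfalso; move: sd; apply/negP; rewrite -ltNge subr_gt0; apply: le_lt_trans ts.
  by apply: le_trans (ltW rt).
have : d / r * (Num.sqrt (G y (t + r)) - Num.sqrt (G y (t - d))) <=
   d / r * (Num.sqrt (G y (t + r + rho)) - Num.sqrt (G y (t - rho))).
  by rewrite ler_wpM2l//; lra.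
move: h; rewrite /f.
move: (moving_average _ _ _) (smoothed_weight _ _ _) (smoothed_weight _ _ _) (d / r * _) (d / r * _).
by move=> A B C D E i1 i2 i3; lra.
Qed.

Lemma sqrt_ball_sup_le y r : 0 < r -> Num.sqrt (G y r) <= Num.sqrt eps^-1.
Proof. by move=> r0; rewrite ler_wsqrtr//; apply: (ball_sup_le_eps eps0 p_ge). Qed.

Lemma measurable_smoothed_weight r t : 0 < r -> 0 < t -> measurable_fun setT (smoothed_weight r t).
Proof.
move=> r0 t0; apply: eball_continuous_measurable => x e e0.
pose B := Num.sqrt eps^-1.
have B0 : 0 <= B by rewrite sqrtr_ge0.
have B1 : 0 < B + 1 by lra.
exists (Num.min (t / 2) (e * r / (B + 1))).
  by rewrite lt_min divr_gt0//= divr_gt0// mulr_gt0.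
move=> y; rewrite /eball/= lt_min => /andP[yx1 yx2].
have t2 : t / 2 < t by lra.
apply: (@le_lt_trans _ _ _ _ _ (smoothed_weight_lip r0 t2 (y := x) (y' := y) _)).
  by rewrite enorm_distC ltW.
apply: (@le_lt_trans _ _ (enorm (y - x) / r * (B + 1))).
  rewrite enorm_distC ler_wpM2l ?divr_ge0 ?enorm_ge0// 1?ltW//.
  have := @sqrt_ball_sup_le x (t + r + t / 2) ltac:(lra); rewrite -/B.
  by have := sqrtr_ge0 (G x (t - t / 2)); lra.
by rewrite mulrAC ltr_pdivrMr// -ltr_pdivlMr.
Qed.

End smoothed_weight.

Lemma ler_sqr_ge0 {R : realDomainType} (a b : R) : 0 <= a -> a <= b -> a ^+ 2 <= b ^+ 2.
Proof. by move=> a0 ab; rewrite ler_pXn2r ?nnegrE// (le_trans a0). Qed.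

Section localized_weight.
Context {R : realType} {n : nat}.
Local Notation V := 'rV[R]_n.
Variables (p : V -> R) (eps : R).
Hypothesis eps0 : 0 < eps.
Hypothesis p_ge : forall x, eps <= p x.
Implicit Types (x y z : V) (c r t : R).
Local Notation G := (ball_sup p).
Local Notation sw := (smoothed_weight p).

(** At c = c_k and t = t_k this is eta_k; the averaging window for the radius has length t / 10. *)
Definition localized_weight c t y : R := cutoff c y * sw (t / 10) t y.

(** The product rule for cutoff times average: 11/10 t is the largest radius in the window, 12/10 t
    and 9/10 t allow for a displacement of t / 10. The threshold exceeds the edge of the cutoff by
    the same displacement. *)
Definition localized_lip c t y : R :=
  if c * enorm y <= 2 + c * (t / 10) then
    c * Num.sqrt (G y (11 / 10 * t))
    + 10 / t * (Num.sqrt (G y (12 / 10 * t)) - Num.sqrt (G y (9 / 10 * t)))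
  else 0.

Let nd y s t : s <= t -> Num.sqrt (G y s) <= Num.sqrt (G y t).
Proof. by move=> st; rewrite ler_wsqrtr//; apply: (ball_sup_nd eps0 p_ge) st. Qed.

Lemma localized_weight_ge0 c t y : 0 < t -> 0 <= localized_weight c t y.
Proof.
by move=> t0; rewrite mulr_ge0 ?cutoff_ge0// (smoothed_weight_ge0 eps0 p_ge)// divr_gt0.
Qed.

Lemma localized_weight_le c t y : 0 < t -> localized_weight c t y <= Num.sqrt eps^-1.
Proof.
move=> t0; have t10 : 0 < t / 10 by rewrite divr_gt0.
rewrite -[leRHS]mul1r; apply: ler_pM; rewrite ?cutoff_ge0 ?cutoff_le1//.
  exact: (smoothed_weight_ge0 eps0 p_ge).
apply: le_trans (smoothed_weight_le eps0 p_ge _ _ t10) _.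
by apply: (sqrt_ball_sup_le eps0 p_ge); rewrite addr_gt0.
Qed.

Lemma bounded_measurable_localized_weight c t : 0 <= c -> 0 < t ->
  bounded_measurable (localized_weight c t).
Proof.
move=> c0 t0; apply: (@bounded_measurable_itv _ _ _ _ 0 (Num.sqrt eps^-1)); last first.
  by move=> y; rewrite localized_weight_ge0 ?localized_weight_le.
apply: measurable_funM; first exact: measurable_cutoff.
by apply: (measurable_smoothed_weight eps0 p_ge) => //; rewrite divr_gt0.
Qed.

Lemma localized_weight_sqr_le c t y : 0 < t ->
  localized_weight c t y ^+ 2 <= cutoff c y ^+ 2 * G y (11 / 10 * t).
Proof.
move=> t0; have t10 : 0 < t / 10 by rewrite divr_gt0.
rewrite exprMn ler_wpM2l ?sqr_ge0//.
have tt : 0 < 11 / 10 * t by rewrite mulr_gt0.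
rewrite -(sqr_sqrtr (ltW (ball_sup_gt0 eps0 p_ge y tt))).
apply: ler_sqr_ge0; first exact: (smoothed_weight_ge0 eps0 p_ge).
have -> : 11 / 10 * t = t + t / 10 by field.
exact: (smoothed_weight_le eps0 p_ge).
Qed.

Lemma localized_weight_sqr_ge c t y : 0 < t ->
  cutoff c y ^+ 2 * G y t <= localized_weight c t y ^+ 2.
Proof.
move=> t0; have t10 : 0 < t / 10 by rewrite divr_gt0.
rewrite exprMn ler_wpM2l ?sqr_ge0//.
rewrite -[X in X <= _](sqr_sqrtr (ltW (ball_sup_gt0 eps0 p_ge y t0))).
apply: ler_sqr_ge0; first exact: sqrtr_ge0.
exact: (smoothed_weight_ge eps0 p_ge).
Qed.

Lemma localized_lip_ge0 c t y : 0 <= c -> 0 < t -> 0 <= localized_lip c t y.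
Proof.
move=> c0 t0; rewrite /localized_lip; case: ifP => // _.
apply: addr_ge0; first by rewrite mulr_ge0 ?sqrtr_ge0.
apply: mulr_ge0; first by rewrite divr_ge0// ltW.
by rewrite subr_ge0; apply: nd; rewrite ler_pM2r//; lra.
Qed.

Lemma localized_lip_le c t y : 0 <= c -> 0 < t ->
  localized_lip c t y <= (c + 10 / t) * Num.sqrt eps^-1.
Proof.
move=> c0 t0; have B0 := sqrtr_ge0 eps^-1; have h : 0 <= 10 / t by rewrite divr_ge0// ltW.
rewrite /localized_lip; case: ifP => // _; last by rewrite mulr_ge0// addr_ge0.
rewrite [leRHS]mulrDl; apply: lerD; apply: ler_wpM2l => //.
  by apply: (sqrt_ball_sup_le eps0 p_ge); rewrite mulr_gt0.
have := @sqrt_ball_sup_le _ _ p eps eps0 p_ge y (12 / 10 * t) ltac:(by rewrite mulr_gt0).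
by have := sqrtr_ge0 (G y (9 / 10 * t)); lra.
Qed.

Lemma bounded_measurable_localized_lip c t : 0 <= c -> 0 < t ->
  bounded_measurable (localized_lip c t).
Proof.
move=> c0 t0; apply: (@bounded_measurable_itv _ _ _ _ 0 ((c + 10 / t) * Num.sqrt eps^-1)); last first.
  by move=> y; rewrite localized_lip_ge0 ?localized_lip_le.
have mG s : 0 < s -> measurable_fun setT (fun y => Num.sqrt (G y s)).
  move=> s0; apply: (@measurableT_comp _ _ _ _ _ _ (@Num.sqrt R)) => //.
    by apply: continuous_measurable_fun; exact: sqrt_continuous.
  exact: (measurable_ball_sup eps0 p_ge).
apply: measurable_fun_ifT.
- apply: measurable_fun_ler => //; apply: measurable_funM => //; exact: measurable_enorm.
- apply: measurable_funD; apply: measurable_funM => //; first by apply: mG; rewrite mulr_gt0.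
  by apply: measurable_funB; apply: mG; rewrite mulr_gt0.
- exact: measurable_cst.
Qed.

Lemma localized_weight_lip c t x y : 0 <= c -> 0 < t -> enorm (x - y) <= t / 10 ->
  `|localized_weight c t x - localized_weight c t y| <= localized_lip c t x * enorm (x - y).
Proof.
move=> c0 t0 xyt; have t10 : 0 < t / 10 by rewrite divr_gt0.
rewrite /localized_lip; case: ifPn => [_|]; last first.
  (* Beyond the threshold both points lie outside the support of the cutoff. *)
  rewrite -ltNge => cx.
  have xy : enorm x <= enorm y + t / 10.
    by have := enormD (x - y) y; rewrite subrK; lra.
  have cxy : c * enorm x <= c * (enorm y + t / 10) by rewrite ler_wpM2l.
  have cx2 : 2 <= c * enorm x by apply: le_trans (ltW cx); rewrite lerDl mulr_ge0// ltW.
  have cy2 : 2 <= c * enorm y by move: cx cxy; rewrite mulrDr; lra.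
  have E z : 2 <= c * enorm z -> localized_weight c t z = 0.
    by move=> cz; rewrite /localized_weight (cutoff_eq0 cz) mul0r.
  by rewrite (E _ cx2) (E _ cy2) subr0 normr0 mul0r.
have -> : localized_weight c t x - localized_weight c t y =
    (cutoff c x - cutoff c y) * sw (t / 10) t x
    + cutoff c y * (sw (t / 10) t x - sw (t / 10) t y).
  rewrite /localized_weight; move: (cutoff c x) (cutoff c y) (sw _ _ x) (sw _ _ y).
  by move=> *; ring.
apply: le_trans (ler_normD _ _) _; rewrite [leRHS]mulrDl; apply: lerD.
  rewrite normrM [leRHS]mulrAC; apply: ler_pM => //; first exact: cutoff_lip.
  rewrite ger0_norm; last exact: (smoothed_weight_ge0 eps0 p_ge).
  have -> : 11 / 10 * t = t + t / 10 by field.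
  exact: (smoothed_weight_le eps0 p_ge).
rewrite normrM ger0_norm ?cutoff_ge0//.
apply: (@le_trans _ _ (1 * `|sw (t / 10) t x - sw (t / 10) t y|)).
  by rewrite ler_wpM2r// cutoff_le1.
rewrite mul1r.
have tt : t / 10 < t by lra.
apply: le_trans (smoothed_weight_lip eps0 p_ge t10 tt xyt) _.
have -> : t + t / 10 + t / 10 = 12 / 10 * t by field.
have -> : t - t / 10 = 9 / 10 * t by field.
have -> : enorm (x - y) / (t / 10) = enorm (x - y) * (10 / t) by field; rewrite gt_eqF.
rewrite (mulrC (enorm (x - y)) (10 / t)) mulrAC; exact: lexx.
Qed.

(** Besides (X + Y)^2 <= 2 X^2 + 2 Y^2, the point is (B - A)^2 <= B^2 - A^2 for 0 <= A <= B, which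
    makes the bound linear in increments of G. The constant is 200 = 2 * 10^2. *)
Lemma localized_lip_sqr_le c t y : 0 <= c -> 0 < t ->
  localized_lip c t y ^+ 2 <=
  if c * enorm y <= 2 + c * (t / 10) then
    2 * c ^+ 2 * G y (12 / 10 * t)
    + 200 / t ^+ 2 * (G y (12 / 10 * t) - G y (9 / 10 * t))
  else 0.
Proof.
move=> c0 t0; rewrite /localized_lip; case: ifP => // _; last by rewrite expr0n.
have [t9 t11 t12] : [/\ 0 < 9 / 10 * t, 0 < 11 / 10 * t & 0 < 12 / 10 * t].
  by split; rewrite mulr_gt0.
have l1 : 9 / 10 * t <= 12 / 10 * t by lra.
have l2 : 11 / 10 * t <= 12 / 10 * t by lra.
have n1 := nd y l1; have n2 := nd y l2.
have E s : 0 < s -> G y s = Num.sqrt (G y s) ^+ 2.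
  by move=> s0; rewrite sqr_sqrtr// ltW// (ball_sup_gt0 eps0 p_ge).
rewrite (E _ t12) (E _ t9).
have := sqrtr_ge0 (G y (9 / 10 * t)); have := sqrtr_ge0 (G y (11 / 10 * t)).
move: n1 n2; move: (Num.sqrt (G y (9 / 10 * t))) (Num.sqrt (G y (12 / 10 * t))) (Num.sqrt (G y (11 / 10 * t))).
move=> A B C AB CB C0 A0; rewrite !sqrtr_sqr !ger0_norm//; last by lra.
have -> : 200 / t ^+ 2 = 2 * (10 / t) ^+ 2 by field; rewrite gt_eqF.
set k := 10 / t; have k0 : 0 <= k by rewrite /k divr_ge0// ltW.
have h1 : (c * C) ^+ 2 <= c ^+ 2 * B ^+ 2.
  by rewrite exprMn ler_wpM2l ?sqr_ge0// ler_pXn2r ?nnegrE//; lra.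
have h2 : (k * (B - A)) ^+ 2 <= k ^+ 2 * (B ^+ 2 - A ^+ 2).
  by rewrite exprMn ler_wpM2l ?sqr_ge0//; nra.
have h3 := sqr_ge0 (c * C - k * (B - A)).
have -> : 2 * c ^+ 2 * B ^+ 2 + 2 * k ^+ 2 * (B ^+ 2 - A ^+ 2)
  = 2 * (c ^+ 2 * B ^+ 2) + 2 * (k ^+ 2 * (B ^+ 2 - A ^+ 2)) by ring.
move: h1 h2 h3; move: (c * C) (k * (B - A)) (c ^+ 2 * _) (k ^+ 2 * _) => X Y P Q h1 h2 h3.
nra.
Qed.

(** The price of changing the weight between consecutive scales. The cutoff only grows when c
    decreases, so the loss is an increment of G in the radius. *)
Lemma localized_weight_decr c c' t t' y : 0 <= c' -> c' <= c -> 0 < t' -> t' <= t ->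
  localized_weight c t y ^+ 2 - localized_weight c' t' y ^+ 2 <=
  if c * enorm y <= 2 then G y (11 / 10 * t) - G y t' else 0.
Proof.
move=> c'0 cc t'0 tt; have t0 := lt_le_trans t'0 tt.
have h1 := localized_weight_sqr_le c y t0.
have h2 := localized_weight_sqr_ge c' y t'0.
have G0 := ball_sup_gt0 eps0 p_ge y t'0.
have GG : G y t' <= G y (11 / 10 * t) by apply: (ball_sup_nd eps0 p_ge); lra.
have ch0 := cutoff_ge0 c y.
case: ifPn => [_|]; last first.
  rewrite -ltNge => /ltW cy; move: h1; rewrite cutoff_eq0// expr0n mul0r.
  by have := sqr_ge0 (localized_weight c' t' y); lra.
have h3 : cutoff c y ^+ 2 * G y t' <= cutoff c' y ^+ 2 * G y t'.
  apply: ler_wpM2r; first exact: ltW.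
  by apply: ler_sqr_ge0 => //; exact: cutoff_mono.
have h4 : cutoff c y ^+ 2 <= 1 by rewrite expr_le1// cutoff_le1.
have h5 : cutoff c y ^+ 2 * (G y (11 / 10 * t) - G y t') <= G y (11 / 10 * t) - G y t'.
  by rewrite ler_piMl// subr_ge0.
by move: h5; rewrite mulrBr; lra.
Qed.

End localized_weight.

(** The first two factors bound gamma of a ball of radius t' near z by t^n times the density at z;
    the others come from the lower bound for balls of radius t / 10, where (5 (n + 1))^n is the
    inverse of (2 / (10 (n + 1)))^n. *)
Definition averaging_constant {R : realType} (n : nat) (K kappa : R) : R :=
  expR (4 * (K + 2 * kappa ^+ 2)) * 2 ^+ n
  * (expR (2 * (K + kappa ^+ 2)) * (5 * n.+1%:R) ^+ n).

Lemma measurable_gaussian_densityV {R : realType} n :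
  measurable_fun setT (fun x : 'rV[R]_n => (gaussian_density x)^-1).
Proof.
have -> : (fun x : 'rV[R]_n => (gaussian_density x)^-1) =
  (fun x => ((2 * pi) `^ (- (n%:R / 2)))^-1 * expR (enorm x ^+ 2 / 2)).
  by apply/funext => x; rewrite /gaussian_density invfM expRN invrK.
apply: measurable_funM => //.
apply: (@measurableT_comp _ _ _ _ _ _ (@expR R)) => //.
by apply: measurable_funM => //; apply: measurable_funX; exact: measurable_enorm.
Qed.

(** * Averages of the semigroup against slowly varying weights *)

Section averaging.
Context {R : realType} {n : nat}.
Local Notation V := 'rV[R]_n.
Local Notation gamma := (@gaussian_measure R n).
Implicit Types (x y z w : V).

Lemma integral_eball_if y r (f : V -> \bar R) :
  (\int[gamma]_(z in eball y r) f z = \int[gamma]_z (if (enorm (z - y) < r)%R then f z else 0))%E.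
Proof.
apply: etrans (integral_mkcond _ _) _; apply: eq_integral => z _.
by rewrite patchE mem_setE.
Qed.

Variables (p : V -> R) (eps : R).
Hypothesis eps0 : 0 < eps.
Hypothesis p_ge : forall x, eps <= p x.
Variables (v : V -> R) (kappa K t t' : R).
Hypothesis K0 : 0 <= K.
Hypothesis t0 : 0 < t.
Hypothesis tk : t <= kappa.
Hypothesis t't : 79 / 100 * t <= t' <= t.
Hypothesis mv : measurable_fun setT v.
Hypothesis v_average : forall x z,
  t' * enorm x <= K + 2 * kappa ^+ 2 -> enorm (z - x) < t' ->
  (\int[gamma]_(w in eball z t') (v w ^+ 2)%:E <= (p x ^+ 2)%:E * gamma (eball z t'))%E.
Local Notation H := (ball_inf p).

Let A : R := expR (4 * (K + 2 * kappa ^+ 2)) * 2 ^+ n.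

Let A0 : 0 < A.
Proof. by rewrite mulr_gt0 ?expR_gt0// exprn_gt0. Qed.

Let B z : R := A * t ^+ n * gaussian_density z.

Let B0 z : 0 < B z.
Proof. by rewrite mulr_gt0 ?gaussian_density_gt0// mulr_gt0// exprn_gt0. Qed.

Let tk2 : t * t <= kappa ^+ 2.
Proof. by rewrite expr2 ler_pM// ltW. Qed.

Let mv2 (D : set V) : measurable_fun D (fun w => (v w ^+ 2)%:E).
Proof. by apply/measurable_EFinP; apply: measurable_funTS; exact: measurable_funX. Qed.

(* The ball of radius [t / 10] about [z] lies in the ball of radius [t'] about the
   midpoint of [x] and [z], which is admissible for [x]. *)
Lemma local_average_center x z : t * enorm z <= K + kappa ^+ 2 / 10 ->
  enorm (x - z) < 13 / 10 * t ->
  (\int[gamma]_(w in eball z (t / 10)) (v w ^+ 2)%:E <= (p x ^+ 2 * B z)%:E)%E.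
Proof.
case/andP: t't => t't1 t't2.
have t'0 : 0 < t' by apply: lt_le_trans t't1; rewrite mulr_gt0.
(* The midpoint is within 13/20 t of both x and z, and 13/20 + 1/10 = 3/4 is below the lower bound
   79/100 for t' / t. *)
move=> tz xz; pose z' : V := 2^-1 *: (z + x).
have Ez : z' - z = 2^-1 *: (x - z).
  by apply/rowP => i; rewrite !mxE; field.
have Ex : z' - x = 2^-1 *: (z - x).
  by apply/rowP => i; rewrite !mxE; field.
have nz : enorm (z' - z) < 13 / 20 * t.
  by rewrite Ez enormZ ger0_norm; lra.
have nx : enorm (z' - x) < 13 / 20 * t.
  by rewrite Ex enormZ ger0_norm; rewrite 1?enorm_distC; lra.
have xle : enorm x <= enorm z + 13 / 10 * t.
  by have := enormD (x - z) z; rewrite subrK; lra.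
have tx : t' * enorm x <= K + 2 * kappa ^+ 2.
  apply: (@le_trans _ _ (t * (enorm z + 13 / 10 * t))).
    by apply: ler_pM => //; [exact: ltW|exact: enorm_ge0].
  have -> : t * (enorm z + 13 / 10 * t) = t * enorm z + 13 / 10 * (t * t) by ring.
  move: tz tk2 (sqr_ge0 kappa) K0.
  by move: (t * enorm z) (t * t) (kappa ^+ 2) => a b k; lra.
have zx' : enorm (z' - x) < t' by apply: lt_le_trans nx _; lra.
apply: (@le_trans _ _ (\int[gamma]_(w in eball z' t') (v w ^+ 2)%:E)%E).
  apply: ge0_subset_integral => //; try exact: measurable_eball.
  - by move=> w _; rewrite lee_fin sqr_ge0.
  - move=> w; rewrite /eball/= => wz; apply: le_lt_trans (enorm_triangle z _ _) _.
    by rewrite (enorm_distC z); lra.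
apply: le_trans (v_average tx zx') _.
rewrite [leRHS]EFinM; apply: lee_wpmul2l; first by rewrite lee_fin sqr_ge0.
have h : enorm (z' - z) + t' <= 2 * t by lra.
apply: le_trans (gaussian_eball_le t'0 h) _; rewrite lee_fin.
have e1 : 2 * t * (2 * enorm z + 2 * t) <= 4 * (K + 2 * kappa ^+ 2).
  have -> : 2 * t * (2 * enorm z + 2 * t) = 4 * (t * enorm z) + 4 * (t * t) by ring.
  move: tz tk2 (sqr_ge0 kappa) K0.
  by move: (t * enorm z) (t * t) (kappa ^+ 2) => a b k; lra.
rewrite /B /A; move: (gaussian_density z) (gaussian_density_ge0 z) => g g0.
rewrite -!mulrA; apply: ler_pM; rewrite ?expR_ge0//.
- by apply: mulr_ge0 => //; rewrite exprn_ge0// mulr_ge0// ltW.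
- by rewrite ler_expR mulrA.
rewrite [leRHS]mulrA [leRHS]mulrC; apply: ler_wpM2l => //; rewrite -exprMn.
have : 2 * t' <= 2 * t by lra.
move=> h2; have : 0 <= 2 * t' by rewrite mulr_ge0// ltW.
by move=> h3; apply: lerXn2r; rewrite ?nnegrE// (le_trans h3).
Qed.

(** The bound by [p x] holds for all x in the ball, so sqrt(I / B(z)), with I the integral on the
    left, is a lower bound of [p] there and hence at most its infimum. *)
Lemma local_average z : t * enorm z <= K + kappa ^+ 2 / 10 ->
  (\int[gamma]_(w in eball z (t / 10)) (v w ^+ 2)%:E <= (B z * H z (13 / 10 * t) ^+ 2)%:E)%E.
Proof.
move=> tz; have t13 : 0 < 13 / 10 * t by rewrite mulr_gt0.
have := fun x => @local_average_center x z tz.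
set I := (\int[gamma]_(w in _) _)%E => h.
have I0 : (0 <= I)%E by apply: integral_ge0 => w _; rewrite lee_fin sqr_ge0.
have If : I \is a fin_num.
  rewrite ge0_fin_numE//; apply: le_lt_trans (h z _) (ltry _).
  by rewrite subrr enorm0.
move: I0 h; rewrite -(fineK If) lee_fin => I0 h.
set i := fine I in I0 h *; rewrite lee_fin.
have -> : i = B z * Num.sqrt (i / B z) ^+ 2.
  by rewrite sqr_sqrtr ?divr_ge0// 1?ltW// mulrCA divff ?mulr1// gt_eqF.
rewrite ler_pM2l//; apply: ler_sqr_ge0; first exact: sqrtr_ge0.
apply: ball_inf_ge => // x xz; have := h x xz; rewrite lee_fin => ix.
have px : 0 <= p x := le_trans (ltW eps0) (p_ge x).
rewrite -(ger0_norm px) -sqrtr_sqr; apply: ler_wsqrtr.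
by rewrite ler_pdivrMr.
Qed.

Let rho := t / 10.
Let rho0 : 0 < rho. Proof. by rewrite divr_gt0. Qed.

Let c : R := expR (- (2 * (K + kappa ^+ 2))) * (2 * (rho / n.+1%:R)) ^+ n.

Let c0 : 0 < c.
Proof.
apply: mulr_gt0; first exact: expR_gt0.
by apply: exprn_gt0; rewrite mulr_gt0// divr_gt0.
Qed.

Let ball_ge y z : t * enorm y <= K -> enorm (z - y) < rho ->
  ((c * gaussian_density z)%:E <= gamma (eball y rho))%E.
Proof.
move=> ty zy; apply: le_trans (gaussian_eball_ge y rho0 (lexx rho)); rewrite lee_fin /c mulrAC.
apply: ler_wpM2r; first by rewrite exprn_ge0// mulr_ge0// divr_ge0// ltW.
apply: (@le_trans _ _ (expR (- (2 * (K + kappa ^+ 2))) *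
    (expR (rho * (2 * enorm y + rho)) * gaussian_density y))).
  by apply: ler_wpM2l; [exact: expR_ge0|exact: gaussian_density_le (ltW zy)].
rewrite mulrA -expRD; apply: ler_wpM2r; first exact: gaussian_density_ge0.
rewrite ler_expR /rho.
have -> : t / 10 * (2 * enorm y + t / 10) = (t * enorm y) / 5 + (t * t) / 100 by field.
move: ty tk2 (sqr_ge0 kappa) K0.
by move: (t * enorm y) (t * t) (kappa ^+ 2) => a b k; lra.
Qed.

Let w z : R := if t * enorm z <= K + kappa ^+ 2 / 10 then (c * gaussian_density z)^-1 else 0.

Let w0 z : 0 <= w z.
Proof.
rewrite /w; case: ifP => // _; rewrite invr_ge0 mulr_ge0 ?gaussian_density_ge0//; exact: ltW.
Qed.

Let mw : measurable_fun setT w.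
Proof.
apply: measurable_fun_ifT => //.
  by apply: measurable_fun_ler => //; apply: measurable_funM => //; exact: measurable_enorm.
move: c => c1; under eq_fun do rewrite invfM.
by apply: measurable_funM => //; exact: measurable_gaussian_densityV.
Qed.

Variables D Dt : V -> R.
Hypothesis D0 : forall y, 0 <= D y.
Hypothesis Dt0 : forall y, 0 <= Dt y.
Hypothesis mD : measurable_fun setT D.
Hypothesis mDt : measurable_fun setT Dt.
Hypothesis Dsupp : forall y, K < t * enorm y -> D y = 0.
Hypothesis DDt : forall y z, t * enorm y <= K -> enorm (z - y) < t / 10 -> D y <= Dt z.

(* Averaging over [eball y rho] is done with the density of gamma in place of the
   measures of the balls, whose measurability is thus not needed. *)
Let F (q : V * V) : \bar R :=
  if (enorm (q.2 - q.1) < rho)%R then (v q.1 ^+ 2 * (Dt q.2 * w q.2))%:E else 0%E.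

Let F0 q : (0 <= F q)%E.
Proof. rewrite /F; case: ifP => // _; rewrite lee_fin; apply: mulr_ge0; first exact: sqr_ge0.
exact: mulr_ge0. Qed.

Let mF : measurable_fun setT F.
Proof.
apply: measurable_fun_ifT => //.
  apply: measurable_fun_ltr => //; apply: measurableT_comp; first exact: measurable_enorm.
  have := @measurable_lin R n (-1) 1.
  by under eq_fun do rewrite scaleN1r scale1r addrC.
apply/measurable_EFinP; apply: measurable_funM.
  by apply: measurable_funX; exact: (measurableT_comp mv measurable_fst).
apply: measurable_funM; first exact: (measurableT_comp mDt measurable_snd).
exact: (measurableT_comp mw measurable_snd).
Qed.

Let F_lower y : ((v y ^+ 2 * D y)%:E <= \int[gamma]_z F (y, z))%E.
Proof.
have [ty|ty] := leP (t * enorm y) K; last first.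
  by rewrite Dsupp// mulr0; apply: integral_ge0 => z _; exact: F0.
have b0 := gaussian_eball_gt0 y rho0.
have bf : gamma (eball y rho) \is a fin_num.
  by rewrite ge0_fin_numE ?ltW// (le_lt_trans (probability_le1 _ (measurable_eball _ _)))// ltry.
set b := fine (gamma (eball y rho)).
have bE : gamma (eball y rho) = b%:E by rewrite /b fineK.
have {}b0 : 0 < b by move: b0; rewrite bE lte_fin.
apply: (@le_trans _ _ (\int[gamma]_(z in eball y rho) (cst (v y ^+ 2 * D y / b)%:E) z)%E).
  apply: (@le_trans _ _ ((v y ^+ 2 * D y / b)%:E * gamma (eball y rho))%E).
    by rewrite bE -EFinM divfK ?gt_eqF.
  by rewrite integral_cst//; exact: measurable_eball.
rewrite integral_mkcond; apply: ge0_le_integral => //.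
- move=> z _; rewrite patchE; case: ifP => // _.
  rewrite lee_fin; apply: divr_ge0; last exact: ltW.
  by apply: mulr_ge0 => //; exact: sqr_ge0.
- by apply/(measurable_restrictT _ (measurable_eball _ _)); exact: measurable_cst.
- exact: (measurableT_comp mF (pair1_measurable y)).
move=> z _; rewrite patchE; case: ifPn => [/set_mem zy|_]; last exact: F0.
have zrho : enorm (z - y) < rho := zy.
rewrite /F/= zrho lee_fin -mulrA; apply: ler_wpM2l; first exact: sqr_ge0.
(* Passing from y to z within t / 10 costs at most t^2 / 10 <= kappa^2 / 10: the threshold in
   [w]. *)
have tz : t * enorm z <= K + kappa ^+ 2 / 10.
  have h : enorm z <= enorm y + t / 10.
    by have := enormD (z - y) y; rewrite subrK /rho in zrho *; lra.
  have : t * enorm z <= t * (enorm y + t / 10) by rewrite ler_wpM2l// ltW.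
  rewrite mulrDr mulrA; move: ty tk2.
  by move: (t * enorm y) (t * enorm z) (t * t) (kappa ^+ 2) => e a d k; lra.
rewrite /w tz; apply: ler_pM; rewrite ?invr_ge0 ?(ltW b0)//; first exact: DDt.
rewrite lef_pV2 ?posrE//; last by rewrite mulr_gt0// gaussian_density_gt0.
by rewrite -lee_fin -bE; exact: ball_ge.
Qed.

Let F_upper z : (\int[gamma]_y F (y, z) <=
  (averaging_constant n K kappa)%:E * (Dt z * H z (13 / 10 * t) ^+ 2)%:E)%E.
Proof.
have C0 : 0 <= averaging_constant n K kappa.
  by rewrite /averaging_constant; nonneg.
rewrite /F /w /=; case: ifPn => [tz|_]; last first.
  rewrite integral0_eq; first by rewrite -EFinM lee_fin; apply: mulr_ge0 => //; apply: mulr_ge0 => //; exact: sqr_ge0.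
  by move=> y _; case: ifP => // _; rewrite !mulr0.
apply: (@le_trans _ _ ((Dt z * (c * gaussian_density z)^-1)%:E
    * \int[gamma]_(y in eball z rho) (v y ^+ 2)%:E)%E).
  rewrite -ge0_integralZl//; last first.
  - by rewrite lee_fin mulr_ge0// invr_ge0 mulr_ge0 ?gaussian_density_ge0// ltW.
  - by move=> y _; rewrite lee_fin sqr_ge0.
  - exact: measurable_eball.
  rewrite integral_eball_if le_eqVlt; apply/orP; left; apply/eqP.
  apply: eq_integral => y _; rewrite enorm_distC; case: ifP => // _.
  by rewrite -EFinM mulrC.
have Q0 : (0 <= (Dt z * (c * gaussian_density z)^-1)%:E)%E.
  by rewrite lee_fin mulr_ge0// invr_ge0 mulr_ge0 ?gaussian_density_ge0// ltW.
apply: le_trans (lee_wpmul2l Q0 (local_average tz)) _.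
rewrite -!EFinM lee_fin le_eqVlt; apply/orP; left; apply/eqP.
have g0 : gaussian_density z != 0 by rewrite gt_eqF ?gaussian_density_gt0.
rewrite /B /A /c /rho /averaging_constant expRN.
have e0 : expR (2 * (K + kappa ^+ 2)) != 0 by rewrite gt_eqF ?expR_gt0.
have -> : 2 * (t / 10 / n.+1%:R) = t / (5 * n.+1%:R).
  have : n.+1%:R != 0 :> R by rewrite pnatr_eq0.
  by move: (n.+1%:R) => m m0; field.
rewrite expr_div_n.
have t0' : t ^+ n != 0 by rewrite gt_eqF// exprn_gt0.
have n0' : (5 * n.+1%:R) ^+ n != 0 :> R by rewrite gt_eqF// exprn_gt0// mulr_gt0.
move: (gaussian_density z) (expR (2 * _)) (expR (4 * _)) (t ^+ n) (_ ^+ n) g0 e0 t0' n0' (2 ^+ n) (H _ _ ^+ 2) (Dt z).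
by move=> g e1 e2 tn nn g0 e0 tn0 nn0 two h d; field; rewrite g0 e0 tn0 nn0.
Qed.

(** The value of v^2 D at y is spread over the ball of radius t / 10, where D(y) is dominated by
    [Dt]; after Tonelli the inner integral is a local average of v^2 about z, which [local_average]
    bounds by H^2. *)
Lemma averaging : (\int[gamma]_y (v y ^+ 2 * D y)%:E <=
  (averaging_constant n K kappa)%:E * \int[gamma]_z (Dt z * H z (13 / 10 * t) ^+ 2)%:E)%E.
Proof.
have t13 : 0 < 13 / 10 * t by rewrite mulr_gt0.
apply: (@le_trans _ _ (\int[gamma]_y \int[gamma]_z F (y, z))%E).
  apply: ge0_le_integral => //.
  - by move=> y _; rewrite lee_fin mulr_ge0// sqr_ge0.
  - by apply/measurable_EFinP; apply: measurable_funM => //; exact: measurable_funX.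
  - exact: (measurable_fun_fubini_tonelli_F F mF F0).
rewrite (fubini_tonelli F mF F0) -ge0_integralZl//; last first.
- by rewrite lee_fin /averaging_constant; nonneg.
- by move=> z _; rewrite lee_fin mulr_ge0// sqr_ge0.
- apply/measurable_EFinP; apply: measurable_funM => //; apply: measurable_funX.
  exact: (measurable_ball_inf p_ge t13).
have mG : measurable_fun setT (fun z => ((averaging_constant n K kappa)%:E * (Dt z * H z (13 / 10 * t) ^+ 2)%:E)%E).
  under eq_fun do rewrite -EFinM; apply/measurable_EFinP; apply: measurable_funM => //.
  apply: measurable_funM => //; apply: measurable_funX.
  exact: (measurable_ball_inf p_ge t13).
apply: ge0_le_integral => //.
- by move=> z _; apply: integral_ge0 => y _; exact: F0.
- exact: (measurable_fun_fubini_tonelli_G F mF F0).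
Qed.

End averaging.

(** * Summation over the scales *)

(** The boundary term, then 3 times the coefficient of the telescoping sum, which leaves three
    terms, then 5 times that of the cutoff errors, where 5 is the sum of (4/5)^k. *)
Definition scale_constant {R : realType} (n : nat) (kappa : R) : R :=
  let C := averaging_constant n (4 * kappa + kappa ^+ 2) kappa in
  let m := @moment_constant R n in
  2 * C + 3 * (2 * C + 144 / 25 * (200 * (m * C))) + 5 * (3 * (m * C * kappa ^+ 2)).

Section scales.
Context {R : realType} {n : nat}.
Local Notation V := 'rV[R]_n.
Local Notation gamma := (@gaussian_measure R n).
Local Notation mu := (@lebesgue_measure R).
Implicit Types (x y z w : V) (s t : R).
Variables (u : V -> R) (U : R).
Hypothesis cu : continuous u.
Hypothesis uU : forall x, `|u x| <= U.
Variables (p : V -> R) (eps : R).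
Hypothesis eps0 : 0 < eps.
Hypothesis p_ge : forall x, eps <= p x.
Hypothesis bp : bounded_measurable p.
Variables (kappa : R).
Hypothesis kappa0 : 0 < kappa.
Local Notation v s := (ou_semigroup s u).
Local Notation H := (ball_inf p).
Local Notation G := (ball_sup p).
(** A bound for t_k |y| on the support of the Lipschitz function: 4 kappa for the cutoff, and less
    than kappa^2 for the extra displacement. *)
Let K : R := 4 * kappa + kappa ^+ 2.
Hypothesis ou_average : forall x z s, 0 < s -> s <= kappa ->
  s * enorm x <= K + 2 * kappa ^+ 2 -> enorm (z - x) < s ->
  (\int[gamma]_(w in eball z s) (v (s ^+ 2) w ^+ 2)%:E <= (p x ^+ 2)%:E * gamma (eball z s))%E.
Let CA : R := averaging_constant n K kappa.
Let P : R := \int[gamma]_z p z.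
Let N t : R := \int[gamma]_z H z t.

Let K0 : 0 <= K.
Proof. by rewrite /K addr_ge0 ?sqr_ge0// mulr_ge0// ltW. Qed.

Let bv s : bounded_measurable (v s).
Proof. by apply: ou_bounded; exact: bounded_measurable_u cu uU. Qed.

Let p0 x : 0 <= p x.
Proof. exact: le_trans (ltW eps0) (p_ge x). Qed.

Let CA0 : 0 <= CA.
Proof. by rewrite /CA /averaging_constant; nonneg. Qed.

Lemma bounded_measurable_ball_inf r : 0 < r -> bounded_measurable (H^~ r).
Proof.
move=> r0; have [_ [M pM]] := bp.
apply: (@bounded_measurable_itv _ _ _ _ 0 M); first exact: (measurable_ball_inf p_ge r0).
move=> y; rewrite (ltW (ball_inf_gt0 eps0 p_ge _ r0))/=.
apply: le_trans (ball_inf_le_center p_ge _ r0) _.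
exact: le_trans (ler_norm _) (pM y).
Qed.

Lemma bounded_measurable_ball_sup r : 0 < r -> bounded_measurable (G^~ r).
Proof.
move=> r0; apply: (@bounded_measurable_itv _ _ _ _ 0 eps^-1).
  exact: (measurable_ball_sup eps0 p_ge r0).
by move=> y; rewrite (ltW (ball_sup_gt0 eps0 p_ge _ r0)) (ball_sup_le_eps eps0 p_ge _ r0).
Qed.

Let bsup := bounded_measurable_ball_sup.
Let binf := bounded_measurable_ball_inf.

Lemma averaging_Rintegral t t' (D Dt Q : V -> R) :
  0 < t -> t <= kappa -> 79 / 100 * t <= t' <= t ->
  bounded_measurable D -> bounded_measurable Dt -> bounded_measurable Q ->
  (forall y, 0 <= D y) -> (forall y, 0 <= Dt y) ->
  (forall y, K < t * enorm y -> D y = 0) ->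
  (forall y z, t * enorm y <= K -> enorm (z - y) < t / 10 -> D y <= Dt z) ->
  (forall z, Dt z * H z (13 / 10 * t) ^+ 2 <= Q z) ->
  \int[gamma]_y (v (t' ^+ 2) y ^+ 2 * D y) <= CA * \int[gamma]_z Q z.
Proof.
move=> t0 tk t't bD bDt bQ D0 Dt0 Dsupp DDt DQ.
have t'0 : 0 < t' by case/andP: t't => h _; apply: lt_le_trans h; rewrite mulr_gt0.
have t'k : t' <= kappa by case/andP: t't => _ h; exact: le_trans h tk.
have t13 : 0 < 13 / 10 * t by rewrite mulr_gt0.
have b1 := bounded_measurableM (bounded_measurable_sqr (bv (t' ^+ 2))) bD.
have bQ' : bounded_measurable (fun z => Dt z * H z (13 / 10 * t) ^+ 2).
  by apply: bounded_measurableM => //; apply: bounded_measurable_sqr; exact: binf.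
rewrite -lee_fin (bounded_EFin_Rintegral _ b1) EFinM (bounded_EFin_Rintegral _ bQ).
apply: le_trans (averaging eps0 p_ge K0 t0 tk t't (proj1 (bv _)) _ D0 Dt0 (proj1 bD) (proj1 bDt) Dsupp DDt) _.
  by move=> x z tx zx; exact: ou_average.
apply: lee_wpmul2l; first by rewrite lee_fin.
rewrite -(bounded_EFin_Rintegral _ bQ) -(bounded_EFin_Rintegral _ bQ') lee_fin.
exact: bounded_le_Rintegral.
Qed.

Let GH r y : 0 < r -> G y r * H y r = 1.
Proof. by move=> r0; rewrite /ball_sup mulVf// gt_eqF// (ball_inf_gt0 eps0 p_ge _ r0). Qed.

(** [Dt] is G at radius 13/10 t, and G H^2 = H <= p at that radius. *)
Lemma averaging_ball_sup t t' (D : V -> R) :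
  0 < t -> t <= kappa -> 79 / 100 * t <= t' <= t -> bounded_measurable D ->
  (forall y, K < t * enorm y -> D y = 0) ->
  (forall y, 0 <= D y <= G y (12 / 10 * t)) ->
  \int[gamma]_y (v (t' ^+ 2) y ^+ 2 * D y) <= CA * P.
Proof.
move=> t0 tk t't bD Dsupp DG.
have t13 : 0 < 13 / 10 * t by rewrite mulr_gt0.
have t12 : 0 < 12 / 10 * t by rewrite mulr_gt0.
apply: (averaging_Rintegral t0 tk t't bD (bsup t13) bp) => //.
- by move=> y; case/andP: (DG y).
- by move=> y; exact: ltW (ball_sup_gt0 eps0 p_ge _ t13).
- move=> y z _ zy; case/andP: (DG y) => _ h; apply: le_trans h _.
  by apply: (ball_sup_mono eps0 p_ge) => //; rewrite enorm_distC; lra.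
- move=> z; rewrite expr2 mulrA GH// mul1r.
  exact: (ball_inf_le_center p_ge).
Qed.

(** Moving the centre by t / 10 widens the radii 8/10 t and 12/10 t to 7/10 t and 13/10 t; H at
    radius 13/10 t then turns the increment of G into one of H. *)
Lemma averaging_ball_sup_diff t t' (D : V -> R) :
  0 < t -> t <= kappa -> 79 / 100 * t <= t' <= t -> bounded_measurable D ->
  (forall y, K < t * enorm y -> D y = 0) ->
  (forall y, 0 <= D y <= G y (12 / 10 * t) - G y (8 / 10 * t)) ->
  \int[gamma]_y (v (t' ^+ 2) y ^+ 2 * D y) <= CA * (N (7 / 10 * t) - N (13 / 10 * t)).
Proof.
move=> t0 tk t't bD Dsupp DG.
have t13 : 0 < 13 / 10 * t by rewrite mulr_gt0.
have t12 : 0 < 12 / 10 * t by rewrite mulr_gt0.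
have t7 : 0 < 7 / 10 * t by rewrite mulr_gt0.
rewrite /N -(bounded_RintegralB _ (binf t7) (binf t13)).
apply: (averaging_Rintegral t0 tk t't bD (bounded_measurableB (bsup t13) (bsup t7))) => //.
- by apply: bounded_measurableB; exact: binf.
- by move=> y; case/andP: (DG y).
- by move=> y; rewrite subr_ge0; apply: (ball_sup_nd eps0 p_ge); lra.
- move=> y z _ zy; case/andP: (DG y) => _ h; apply: le_trans h _.
  apply: lerB; apply: (ball_sup_mono eps0 p_ge) => //; last by lra.
  by rewrite enorm_distC; lra.
- move=> z; have h1 := ball_inf_gt0 eps0 p_ge z t7; have h2 := ball_inf_gt0 eps0 p_ge z t13.
  rewrite /ball_sup; move: (H z (7 / 10 * t)) (H z (13 / 10 * t)) h1 h2 => a b a0 b0.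
  have -> : (b^-1 - a^-1) * b ^+ 2 = b - b ^+ 2 / a by field; rewrite !gt_eqF.
  have : 2 * b - a <= b ^+ 2 / a.
    rewrite ler_pdivlMr// -subr_ge0.
    have -> : b ^+ 2 - (2 * b - a) * a = (b - a) ^+ 2 by ring.
    exact: sqr_ge0.
  by lra.
Qed.

Definition scale (k : nat) : R := kappa * (4 / 5) ^+ k.

Lemma scale_gt0 k : 0 < scale k.
Proof. by rewrite mulr_gt0// exprn_gt0. Qed.

Lemma scaleS k : scale k.+1 = 4 / 5 * scale k.
Proof. by rewrite /scale exprS mulrCA. Qed.

Lemma scale_le k : scale k <= kappa.
Proof.
by apply: ler_piMr; [exact: ltW|apply: exprn_ile1; lra].
Qed.

(** The cutoff is 1 for t_k |y| <= 2 kappa. This covers t |y| <= kappa for all t between t_(k+1) and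
    t_k, as t_k <= 5/4 t. *)
Let c k : R := scale k / (2 * kappa).

Let c_gt0 k : 0 < c k.
Proof. by rewrite divr_gt0 ?scale_gt0// mulr_gt0. Qed.

Let cE k a : c k * a = scale k * a / (2 * kappa).
Proof. by rewrite mulrAC. Qed.

Let eta k : V -> R := localized_weight p (c k) (scale k).
Let L k : V -> R := localized_lip p (c k) (scale k).
Let b k : R := \int[gamma]_y (eta k y ^+ 2 * v (scale k ^+ 2) y ^+ 2).
Let b' k : R := \int[gamma]_y (eta k y ^+ 2 * v (scale k.+1 ^+ 2) y ^+ 2).
(* [13 / 10 * (4 / 5) ^+ 3 <= 7 / 10]. *)
Let d k : R := N (13 / 10 * scale k.+3) - N (13 / 10 * scale k).

Let beta k : bounded_measurable (eta k).
Proof. by apply: (bounded_measurable_localized_weight eps0 p_ge); [exact: ltW|exact: scale_gt0]. Qed.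

Let bL k : bounded_measurable (L k).
Proof. by apply: (bounded_measurable_localized_lip eps0 p_ge); [exact: ltW|exact: scale_gt0]. Qed.

Let diff_le_telescope k : N (7 / 10 * scale k) - N (13 / 10 * scale k) <= d k.
Proof.
rewrite /d lerD2r /N; have t0 := scale_gt0 k; have t3 := scale_gt0 k.+3.
have E : 13 / 10 * scale k.+3 <= 7 / 10 * scale k by rewrite !scaleS; lra.
have h0 : 0 < 7 / 10 * scale k by rewrite mulr_gt0.
have h3 : 0 < 13 / 10 * scale k.+3 by rewrite mulr_gt0.
apply: bounded_le_Rintegral; [exact: binf|exact: binf|] => z.
by apply: (ball_inf_mono p_ge) => //; rewrite subrr enorm0 add0r.
Qed.

Let outside_region k y : K < scale k * enorm y -> (c k * enorm y <= 2 + c k * (scale k / 10)) = false.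
Proof.
move=> Ky; apply/negbTE; rewrite -ltNge !cE ltr_pdivlMr ?mulr_gt0// mulrDl divfK ?gt_eqF ?mulr_gt0//.
apply: le_lt_trans Ky; rewrite /K.
have t0 := scale_gt0 k; have tk := scale_le k.
have : scale k * scale k <= kappa ^+ 2 by rewrite expr2; apply: ler_pM => //; exact: ltW.
rewrite mulrA; have := sqr_ge0 kappa; move: (scale k * scale k) (kappa ^+ 2) => e f; lra.
Qed.

(** The square of the Lipschitz function splits into a cutoff part [D1] and an increment part [D2],
    to which the two averaging estimates apply. *)
Let energy_lip k s : scale k.+1 ^+ 2 - scale k ^+ 2 / 100 <= s <= scale k ^+ 2 ->
  \int[gamma]_x (v s x ^+ 2 * L k x ^+ 2) <=
  CA * (2 * c k ^+ 2 * P + 200 / scale k ^+ 2 * d k).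
Proof.
have t0 := scale_gt0 k; have tk := scale_le k; rewrite scaleS => /andP[s1 s2].
have s0 : 0 <= s.
  apply: le_trans s1; rewrite exprMn subr_ge0.
  by have := sqr_ge0 (scale k); move: (scale k ^+ 2) => e; lra.
(* The margin 1/100 before t_(k+1)^2 is harmless: (4/5)^2 - 1/100 = 0.63 exceeds (79/100)^2. *)
have t't : 79 / 100 * scale k <= Num.sqrt s <= scale k.
  rewrite -{2}(ger0_norm (ltW t0)) -sqrtr_sqr ler_wsqrtr// andbT.
  have h : 0 <= 79 / 100 * scale k by rewrite mulr_ge0// ltW.
  rewrite -(ger0_norm h) -sqrtr_sqr ler_wsqrtr//; apply: le_trans s1.
  move: (scale k) => e; rewrite -subr_ge0.
  have -> : (4 / 5 * e) ^+ 2 - e ^+ 2 / 100 - (79 / 100 * e) ^+ 2 = 59 / 10000 * e ^+ 2 by field.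
  by apply: mulr_ge0; [lra|exact: sqr_ge0].
rewrite -(sqr_sqrtr s0); set t' := Num.sqrt s.
have t12 : 0 < 12 / 10 * scale k by rewrite mulr_gt0.
have t8 : 0 < 8 / 10 * scale k by rewrite mulr_gt0.
pose R1 y := c k * enorm y <= 2 + c k * (scale k / 10).
pose D1 y := if R1 y then G y (12 / 10 * scale k) else 0.
pose D2 y := if R1 y then G y (12 / 10 * scale k) - G y (8 / 10 * scale k) else 0.
have mR : measurable_fun setT R1.
  by apply: measurable_fun_ler => //; apply: measurable_funM => //; exact: measurable_enorm.
have bif (f : V -> R) : bounded_measurable f -> bounded_measurable (fun y => if R1 y then f y else 0).
  move=> [mf [M fM]]; split; first exact: measurable_fun_ifT.
  by exists `|M| => y; case: ifP; rewrite ?normr0// => _; exact: le_trans (fM y) (ler_norm _).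
have bD1 : bounded_measurable D1 by apply: bif; exact: bsup.
have bD2 : bounded_measurable D2 by apply: bif; apply: bounded_measurableB; exact: bsup.
have G812 y : G y (8 / 10 * scale k) <= G y (12 / 10 * scale k).
  by apply: (ball_sup_nd eps0 p_ge); lra.
have h1 : \int[gamma]_y (v (t' ^+ 2) y ^+ 2 * D1 y) <= CA * P.
  apply: (@averaging_ball_sup (scale k)) => //.
    by move=> y /outside_region Ry; rewrite /D1 /R1 Ry.
  move=> y; have := ball_sup_gt0 eps0 p_ge y t12.
  by rewrite /D1; case: ifP => _ /ltW ->; rewrite ?lexx.
have h2 : \int[gamma]_y (v (t' ^+ 2) y ^+ 2 * D2 y) <= CA * d k.
  apply: (@le_trans _ _ (CA * (N (7 / 10 * scale k) - N (13 / 10 * scale k)))); last first.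
    by apply: ler_wpM2l => //; exact: diff_le_telescope.
  apply: (@averaging_ball_sup_diff (scale k)) => //.
    by move=> y /outside_region Ry; rewrite /D2 /R1 Ry.
  move=> y; rewrite /D2; case: ifP => _; rewrite ?lexx ?subr_ge0 ?G812//.
apply: (@le_trans _ _ (2 * c k ^+ 2 * \int[gamma]_y (v (t' ^+ 2) y ^+ 2 * D1 y) +
    200 / scale k ^+ 2 * \int[gamma]_y (v (t' ^+ 2) y ^+ 2 * D2 y))); last first.
  have : 2 * c k ^+ 2 * \int[gamma]_y (v (t' ^+ 2) y ^+ 2 * D1 y) <= 2 * c k ^+ 2 * (CA * P).
    by apply: ler_wpM2l => //; rewrite mulr_ge0// sqr_ge0.
  have : 200 / scale k ^+ 2 * \int[gamma]_y (v (t' ^+ 2) y ^+ 2 * D2 y) <= 200 / scale k ^+ 2 * (CA * d k).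
    by apply: ler_wpM2l => //; rewrite divr_ge0// sqr_ge0.
  have arith (e f x y z : R) : z * (e * x + f * y) = e * (z * x) + f * (z * y) by ring.
  by move=> a1 a2; rewrite arith; exact: lerD.
have bv1 : bounded_measurable (fun y => v (t' ^+ 2) y ^+ 2 * D1 y).
  by apply: bounded_measurableM => //; exact: bounded_measurable_sqr.
have bv2 : bounded_measurable (fun y => v (t' ^+ 2) y ^+ 2 * D2 y).
  by apply: bounded_measurableM => //; exact: bounded_measurable_sqr.
rewrite -(bounded_RintegralZl _ _ bv1) -(bounded_RintegralZl _ _ bv2) -bounded_RintegralD; last 2 first.
- by apply: bounded_measurableM => //; exact: bounded_measurable_cst.
- by apply: bounded_measurableM => //; exact: bounded_measurable_cst.
apply: bounded_le_Rintegral.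
- by apply: bounded_measurableM; exact: bounded_measurable_sqr.
- by apply: bounded_measurableD; apply: bounded_measurableM => //; exact: bounded_measurable_cst.
move=> y; have := localized_lip_sqr_le eps0 p_ge y (ltW (c_gt0 k)) t0.
rewrite -/(L k) /D1 /D2 -/(R1 y); have := sqr_ge0 (v (t' ^+ 2) y); move: (v (t' ^+ 2) y ^+ 2) => q q0.
case: ifP => _ h.
  have h9 : G y (8 / 10 * scale k) <= G y (9 / 10 * scale k) by apply: (ball_sup_nd eps0 p_ge); lra.
  apply: (@le_trans _ _ (q * (2 * c k ^+ 2 * G y (12 / 10 * scale k) +
      200 / scale k ^+ 2 * (G y (12 / 10 * scale k) - G y (8 / 10 * scale k))))).
    apply: ler_wpM2l => //; apply: le_trans h _.
    by rewrite lerD2l; apply: ler_wpM2l; [rewrite divr_ge0// sqr_ge0|rewrite lerD2l lerN2].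
  by rewrite mulrDr (mulrCA q) (mulrCA q (200 / _)).
by rewrite !mulr0 addr0; apply: mulr_ge0_le0.
Qed.

Let A1 : R := 2 * CA + 144 / 25 * (200 * (@moment_constant R n * CA)).
Let A2 : R := 3 * (@moment_constant R n * CA * kappa ^+ 2).

(** The energy inequality with the fixed weight eta_k leaves boundary terms at t_k and t_(k+1).
    Exchanging eta_k for eta_(k+1) in the latter makes the boundary terms telescope, at the cost of
    one more increment. *)
Let energy_scale k :
  (\int[gamma \x mu]_q
    ((\1_`[scale k.+1, scale k] q.2 * (2 * q.2) * eta k q.1 ^+ 2)%:E * energy_limit u q)
   <= (2 * (b k.+1 - b k) + A1 * d k + A2 * (4 / 5) ^+ k * P)%:E)%E.
Proof.
have t0 := scale_gt0 k; have t1 := scale_gt0 k.+1; have tk := scale_le k.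
have d0 : 0 < scale k ^+ 2 / 100 by rewrite divr_gt0// exprn_gt0.
have dlt : scale k ^+ 2 / 100 < scale k.+1 ^+ 2.
  rewrite scaleS -subr_gt0.
  have -> : (4 / 5 * scale k) ^+ 2 - scale k ^+ 2 / 100 = 63 / 100 * scale k ^+ 2 by field.
  by rewrite mulr_gt0// exprn_gt0.
have eB x : `|eta k x| <= Num.sqrt eps^-1.
  by rewrite ger0_norm ?(localized_weight_ge0 eps0 p_ge)// (localized_weight_le eps0 p_ge).
have LB x : 0 <= L k x <= (c k + 10 / scale k) * Num.sqrt eps^-1.
  by rewrite (localized_lip_ge0 eps0 p_ge) ?(localized_lip_le eps0 p_ge)// ltW.
have r0 : 0 < scale k / 10 by rewrite divr_gt0.
have tlt : scale k.+1 < scale k by rewrite scaleS; lra.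
have lip x y : enorm (x - y) <= scale k / 10 -> `|eta k x - eta k y| <= L k x * enorm (x - y).
  by move=> xy; apply: (localized_weight_lip eps0 p_ge) => //; exact: ltW.
have key : (\int[gamma \x mu]_q
    ((\1_`[scale k.+1, scale k] q.2 * (2 * q.2) * eta k q.1 ^+ 2)%:E * energy_limit u q)
   <= (2 * (b' k - b k) + 16 * @moment_constant R n *
      (CA * (2 * c k ^+ 2 * P + 200 / scale k ^+ 2 * d k)) * (scale k ^+ 2 - scale k.+1 ^+ 2))%:E)%E.
  exact: (local_energy_inequality cu uU t1 tlt d0 dlt r0 (beta k) (bL k) eB LB lip (@energy_lip k)).
apply: (le_trans key); clear key; rewrite lee_fin.
(* The change of weight is an increment of G between t_(k+1) = 8/10 t_k and 11/10 t_k, hence of the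
   type already estimated. *)
have hb : b' k - b k.+1 <= CA * d k.
  have t8 : 0 < 8 / 10 * scale k by rewrite mulr_gt0.
  have t12 : 0 < 12 / 10 * scale k by rewrite mulr_gt0.
  pose D y := if c k * enorm y <= 2 then G y (12 / 10 * scale k) - G y (8 / 10 * scale k) else 0.
  have bD : bounded_measurable D.
    have [mf [M fM]] := bounded_measurableB (bsup t12) (bsup t8).
    split; last by exists `|M| => y; rewrite /D; case: ifP; rewrite ?normr0// => _;
      exact: le_trans (fM y) (ler_norm _).
    apply: measurable_fun_ifT => //; apply: measurable_fun_ler => //.
    by apply: measurable_funM => //; exact: measurable_enorm.
  have b1 : bounded_measurable (fun y => eta k y ^+ 2 * v (scale k.+1 ^+ 2) y ^+ 2).
    by apply: bounded_measurableM; exact: bounded_measurable_sqr.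
  have b2 : bounded_measurable (fun y => eta k.+1 y ^+ 2 * v (scale k.+1 ^+ 2) y ^+ 2).
    by apply: bounded_measurableM; exact: bounded_measurable_sqr.
  rewrite /b' /b -(bounded_RintegralB _ b1 b2).
  apply: (@le_trans _ _ (\int[gamma]_y (v (scale k.+1 ^+ 2) y ^+ 2 * D y))).
    apply: bounded_le_Rintegral.
    - exact: bounded_measurableB.
    - by apply: bounded_measurableM => //; exact: bounded_measurable_sqr.
    move=> y; rewrite -mulrBl mulrC; apply: ler_wpM2l; first exact: sqr_ge0.
    have cc : c k.+1 <= c k.
      by rewrite /c ler_pM2r ?invr_gt0 ?mulr_gt0//; exact: ltW.
    apply: le_trans (localized_weight_decr eps0 p_ge y (ltW (c_gt0 _)) cc t1 (ltW tlt)) _.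
    rewrite /D; case: ifP => // _; apply: lerB; apply: (ball_sup_nd eps0 p_ge); first by lra.
    by rewrite scaleS; lra.
  apply: (@le_trans _ _ (CA * (N (7 / 10 * scale k) - N (13 / 10 * scale k)))); last first.
    by apply: ler_wpM2l => //; exact: diff_le_telescope.
  apply: averaging_ball_sup_diff => //.
  - by rewrite scaleS; apply/andP; split; lra.
  - move=> y /outside_region Ry; rewrite /D; case: ifP => // Dy; move: Ry => /negbT.
    by rewrite (le_trans Dy)// lerDl mulr_ge0// ltW.
  - move=> y; rewrite /D; case: ifP => _.
      by rewrite lexx andbT subr_ge0; apply: (ball_sup_nd eps0 p_ge); lra.
    by rewrite lexx subr_ge0; apply: (ball_sup_nd eps0 p_ge); lra.
have m0 : 0 <= @moment_constant R n := moment_constant_ge0.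
have P0 : 0 <= P by apply: Rintegral_ge0 => x _.
have hS : scale k ^+ 2 - scale k.+1 ^+ 2 = 9 / 25 * scale k ^+ 2.
  by rewrite scaleS; move: (scale k) => e; field.
(* In fact c_k^2 t_k^2 = (kappa^2 / 4) (4/5)^(4k); the first power of (4/5)^k is enough for
   summability. *)
have hc : c k ^+ 2 * scale k ^+ 2 <= kappa ^+ 2 / 4 * (4 / 5) ^+ k.
  have -> : c k ^+ 2 * scale k ^+ 2 = (scale k / kappa) ^+ 3 * (scale k / kappa * (kappa ^+ 2 / 4)).
    by rewrite /c; field; rewrite gt_eqF.
  have -> : scale k / kappa = (4 / 5) ^+ k by rewrite /scale mulrAC divff ?mul1r// gt_eqF.
  have q1 : (4 / 5 : R) ^+ k <= 1 by apply: exprn_ile1; lra.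
  rewrite mulrA [leRHS]mulrC; apply: ler_wpM2r; first by rewrite divr_ge0// sqr_ge0.
  by apply: ler_piMl => //; exact: exprn_ile1.
rewrite hS.
(* 144/25 = 16 (1 - (4/5)^2). The cutoff part gets 144/25 * 2 / 4 = 72/25, which is rounded up to 3
   in [A2]. *)
have arith1 (m C c2 Pv e t2 dd : R) : t2 != 0 ->
  16 * m * (C * (2 * c2 * Pv + e / t2 * dd)) * (9 / 25 * t2) =
  144 / 25 * (2 * (m * C * Pv * (c2 * t2)) + e * (m * C * dd)) by move=> h; field.
rewrite arith1 ?gt_eqF ?exprn_gt0//.
have mP : 0 <= @moment_constant R n * CA * P by rewrite !mulr_ge0.
have hX := ler_wpM2l mP hc.
have hY : 0 <= @moment_constant R n * CA * P * (kappa ^+ 2 / 4 * (4 / 5) ^+ k).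
  apply: mulr_ge0 => //; apply: mulr_ge0; first by rewrite divr_ge0// sqr_ge0.
  by apply: exprn_ge0; lra.
have arith2 (m C Pv e kk q dd : R) :
  (2 * C + 144 / 25 * (e * (m * C))) * dd + 3 * (m * C * kk) * q * Pv =
  2 * (C * dd) + 144 / 25 * (e * (m * C * dd)) + 12 * (m * C * Pv * (kk / 4 * q)) by field.
rewrite -(addrA _ (A1 * d k)) /A1 /A2 arith2.
move: hb hX hY; move: (_ * (kappa ^+ 2 / 4 * _)) (_ * (c k ^+ 2 * _)) (CA * d k) => a1 a2 a3.
move: (200 * _) (b' k) (b k) (b k.+1) => e x1 x2 x3 *; lra.
Qed.

Let boundary_le k : b k <= CA * P.
Proof.
have t0 := scale_gt0 k; have tk := scale_le k.
rewrite /b; under eq_Rintegral do rewrite mulrC.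
apply: (@averaging_ball_sup (scale k)) => //.
- by apply/andP; split; lra.
- exact: bounded_measurable_sqr.
- move=> y /outside_region Ry; rewrite /eta /localized_weight cutoff_eq0 ?mul0r ?expr0n//.
  move: Ry => /negbT; rewrite -ltNge => /ltW; apply: le_trans.
  rewrite lerDl; apply: mulr_ge0; [exact: ltW|apply: divr_ge0 => //; exact: ltW].
- move=> y; rewrite sqr_ge0/=.
  have t11 : 0 < 11 / 10 * scale k by rewrite mulr_gt0.
  apply: le_trans (localized_weight_sqr_le eps0 p_ge (c k) y t0) _.
  apply: (@le_trans _ _ (G y (11 / 10 * scale k))).
    apply: ler_piMl; first exact: ltW (ball_sup_gt0 eps0 p_ge _ t11).
    by apply: exprn_ile1; [exact: cutoff_ge0|exact: cutoff_le1].
  by apply: (ball_sup_nd eps0 p_ge); lra.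
Qed.

Let g k (q : V * R) : \bar R :=
  ((\1_`[scale k.+1, scale k] q.2 * (2 * q.2) * eta k q.1 ^+ 2)%:E * energy_limit u q)%E.

Let g0 k q : (0 <= g k q)%E.
Proof.
apply: mule_ge0; last exact: energy_limit_ge0.
rewrite lee_fin indicE; case: (boolP (_ \in _)) => [/set_mem/=|_]; last by rewrite !mul0r.
rewrite in_itv/= => /andP[tq _]; apply: mulr_ge0; last exact: sqr_ge0.
by rewrite mul1r mulr_ge0// (le_trans _ tq)// ltW// scale_gt0.
Qed.

Let mg k : measurable_fun setT (g k).
Proof.
apply: emeasurable_funM; last exact: measurable_energy_limit cu uU.
apply/measurable_EFinP; apply: measurable_funM.
  apply: measurable_funM; last by apply: measurable_funM => //; exact: measurable_snd.
  by apply: (measurableT_comp _ measurable_snd); exact: measurable_indic.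
apply: measurable_funX; exact: (measurableT_comp (proj1 (beta k)) measurable_fst).
Qed.

Let N0 k : 0 <= N (13 / 10 * scale k).
Proof.
have t0 : 0 < 13 / 10 * scale k by rewrite mulr_gt0// scale_gt0.
by apply: Rintegral_ge0 => z _; exact: ltW (ball_inf_gt0 eps0 p_ge _ t0).
Qed.

Let NP k : N (13 / 10 * scale k) <= P.
Proof.
have t0 : 0 < 13 / 10 * scale k by rewrite mulr_gt0// scale_gt0.
apply: bounded_le_Rintegral => //; first exact: binf.
by move=> z; exact: (ball_inf_le_center p_ge).
Qed.

(** Since d_k = M_(k+3) - M_k, the sum of the increments is the last three values minus the first
    three, at most 3 P by 0 <= M <= P. The boundary terms leave b_m <= CA P. *)
Let energy_partial_sum m :
  (\sum_(0 <= k < m) \int[gamma \x mu]_q g k q <= (scale_constant n kappa * P)%:E)%E.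
Proof.
pose M k := N (13 / 10 * scale k).
have P0 : 0 <= P by apply: Rintegral_ge0 => x _.
have m0 : 0 <= @moment_constant R n := moment_constant_ge0.
have A10 : 0 <= A1.
  rewrite /A1; apply: addr_ge0; first exact: mulr_ge0.
  by apply: mulr_ge0; [lra|apply: mulr_ge0 => //; exact: mulr_ge0].
have A20 : 0 <= A2 by rewrite /A2; apply: mulr_ge0 => //; apply: mulr_ge0; [exact: mulr_ge0|exact: sqr_ge0].
have h : (\sum_(0 <= k < m) \int[gamma \x mu]_q g k q <=
   (2 * (b m - b 0) + A1 * ((M m + M m.+1 + M m.+2) - (M 0%N + M 1%N + M 2%N))
     + A2 * (5 * (1 - (4 / 5) ^+ m)) * P)%:E)%E.
  elim: m => [|m IH].
    by rewrite big_geq// expr0 !subrr !mulr0 mul0r !addr0.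
  rewrite big_nat_recr//=; apply: le_trans (leeD IH (energy_scale m)) _.
  rewrite -EFinD lee_fin /d -/(M m) -/(M m.+3) exprS.
  have arith (b1 b2 b3 a1 a2 x0 x1 x2 x3 y q PP : R) :
    2 * (b1 - b2) + a1 * (x0 + x1 + x2 - y) + a2 * (5 * (1 - q)) * PP
    + (2 * (b3 - b1) + a1 * (x3 - x0) + a2 * q * PP) =
    2 * (b3 - b2) + a1 * (x1 + x2 + x3 - y) + a2 * (5 * (1 - 4 / 5 * q)) * PP by field.
  by rewrite arith.
apply: le_trans h _; rewrite lee_fin.
have b00 : 0 <= b 0 by apply: Rintegral_ge0 => y _; apply: mulr_ge0; exact: sqr_ge0.
have bm := boundary_le m.
have h1 : A1 * ((M m + M m.+1 + M m.+2) - (M 0%N + M 1%N + M 2%N)) <= A1 * (3 * P).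
  apply: ler_wpM2l => //.
  have MP k : M k <= P := NP k.
  have M0 k : 0 <= M k := N0 k.
  have -> : 3 * P = P + P + P - 0 by ring.
  apply: lerB; last by apply: addr_ge0 => //; exact: addr_ge0.
  by apply: lerD => //; exact: lerD.
have h2 : A2 * (5 * (1 - (4 / 5) ^+ m)) * P <= A2 * 5 * P.
  apply: ler_wpM2r => //; apply: ler_wpM2l => //.
  by apply: ler_piMr => //; rewrite gerBl; apply: exprn_ge0; apply: divr_ge0.
have -> : scale_constant n kappa * P = 2 * (CA * P) + A1 * (3 * P) + A2 * 5 * P.
  have arith (C a1 a2 PP : R) : (2 * C + 3 * a1 + 5 * a2) * PP = 2 * (C * PP) + a1 * (3 * PP) + a2 * 5 * PP by ring.
  by rewrite -arith.
move: h1 h2 bm b00; move: (A1 * _) (A1 * _) (A2 * _ * _) (A2 * _ * _) (CA * P) (b m) (b 0) => *; lra.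
Qed.

Lemma scale_exists t : 0 < t -> t <= kappa -> exists k, scale k.+1 <= t <= scale k.
Proof.
move=> t0 tk; have ex : exists k, scale k <= t.
  have : (fun k : nat => (4 / 5 : R) ^+ k) @ \oo --> (0 : R) by apply: cvg_expr; rewrite ger0_norm; lra.
  move=> /cvgrPdist_lt/(_ (t / kappa)); rewrite divr_gt0// => /(_ isT)[m _ /(_ m (leqnn _))].
  rewrite /= sub0r normrN ger0_norm; last by apply: exprn_ge0; lra.
  rewrite ltr_pdivlMr// => h; exists m; rewrite /scale mulrC; exact: ltW.
(* The least k with t_k <= t; if it is 0 then t = kappa, and the first interval is taken. *)
case: (ex_minnP ex) => -[|k] hk kmin.
  have e0 : scale 0 = kappa by rewrite /scale expr0 mulr1.
  by exists 0%N; rewrite scaleS e0; rewrite e0 in hk; apply/andP; split; lra.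
exists k; rewrite hk/= leNgt; apply/negP => /ltW/kmin.
by rewrite ltnn.
Qed.

(** At a point where [f] may be nonzero, t lies in some dyadic-like interval, and the one term of
    the series of [g] for that scale already dominates [f]. Integrating the series term by term
    leaves the partial sums. *)
Lemma energy_total (f : V * R -> \bar R) :
  measurable_fun setT f -> (forall q, (0 <= f q)%E) ->
  (forall y t, t <= 0 \/ kappa < t \/ kappa < t * enorm y -> f (y, t) = 0%E) ->
  (forall y t k, scale k.+1 <= t -> t <= scale k -> t * enorm y <= kappa ->
     (f (y, t) <= (2 * t * G y (scale k))%:E * energy_limit u (y, t))%E) ->
  (\int[gamma \x mu]_q f q <= (scale_constant n kappa * P)%:E)%E.
Proof.
move=> mf f0 fsupp fle.
apply: (@le_trans _ _ (\int[gamma \x mu]_q \sum_(k <oo) g k q)%E).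
  apply: ge0_le_integral => //.
    by apply: ge0_emeasurable_sum => [k q _ _|k _]; [exact: g0|exact: mg].
  move=> [y t] _.
  have S0 : (0 <= \sum_(k <oo) g k (y, t))%E by apply: nneseries_ge0 => k _ _; exact: g0.
  have [t0|t0] := leP t 0; first by rewrite fsupp//; left.
  have [tk|tk] := ltP kappa t; first by rewrite fsupp//; right; left.
  have [ty|ty] := ltP kappa (t * enorm y); first by rewrite fsupp//; right; right.
  have [k /andP[k1 k2]] := scale_exists t0 tk.
  apply: (@le_trans _ _ (g k (y, t))).
    apply: le_trans (fle _ _ _ k1 k2 ty) _; rewrite /g/=; apply: lee_wpmul2r.
      exact: energy_limit_ge0.
    rewrite lee_fin indicE mem_set/= ?in_itv/= ?k1//= mul1r.
    apply: ler_wpM2l; first by rewrite mulr_ge0// ltW.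
    apply: le_trans (localized_weight_sqr_ge eps0 p_ge (c k) y (scale_gt0 k)).
    (* t_k |y| <= 5/4 t |y| <= 5/4 kappa < 2 kappa. *)
    rewrite cutoff_eq1 ?expr1n ?mul1r// cE ler_pdivrMr ?mulr_gt0// mul1r.
    apply: (@le_trans _ _ (5 / 4 * t * enorm y)).
      apply: ler_wpM2r; first exact: enorm_ge0.
      by move: k1; rewrite scaleS; lra.
    by rewrite -mulrA; lra.
  apply: (@le_trans _ _ (\sum_(0 <= j < k.+1) g j (y, t))%E).
    rewrite big_nat_recr//= leeDr// sume_ge0// => j _; exact: g0.
  by apply: nneseries_lim_ge => *; exact: g0.
rewrite integral_nneseries//; apply: lime_le.
  by apply: is_cvg_nneseries => k _ _; apply: integral_ge0 => q _; exact: g0.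
by apply: nearW => m; exact: energy_partial_sum.
Qed.

End scales.

(** * The square function *)

(* The integrands of S and T* are not known to be measurable. *)
Lemma ge0_le_integral_nonmeasurable d (T : measurableType d) (R : realType)
    (m : {measure set T -> \bar R}) (f g : T -> \bar R) :
  (forall x, (0 <= f x)%E) -> (forall x, (f x <= g x)%E) ->
  (\int[m]_x f x <= \int[m]_x g x)%E.
Proof.
move=> f0 fg; rewrite !ge0_integralTE//; last by move=> x; exact: le_trans (f0 x) (fg x).
apply: le_ereal_sup => _ [h hf <-]; exists h => // x.
exact: le_trans (hf x) (fg x).
Qed.

Lemma sqrte_le_avg {R : realType} (z : \bar R) (q : R) : (0 <= z)%E -> 0 < q ->
  (sqrte z <= (2^-1)%:E * ((q^-1)%:E * z + q%:E))%E.
Proof.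
move=> z0 q0; case: z z0 => [z||//].
- rewrite lee_fin => z0; rewrite (_ : (_ * (_ + _))%E = (2^-1 * (q^-1 * z + q))%:E)// lee_fin.
  rewrite -[X in _ * (_ * X + _)](sqr_sqrtr z0); move: (Num.sqrt z) (sqrtr_ge0 z) => w w0.
  rewrite -subr_ge0.
  have -> : 2^-1 * (q^-1 * w ^+ 2 + q) - w = (2 * q)^-1 * (w - q) ^+ 2 by field; rewrite gt_eqF.
  by apply: mulr_ge0; [rewrite invr_ge0 mulr_ge0// ltW|exact: sqr_ge0].
- by move=> _; rewrite mulry gtr0_sg ?invr_gt0// mul1e addye// mulry gtr0_sg ?invr_gt0// mul1e.
Qed.

Section cones.
Context {R : realType} {n : nat}.
Local Notation V := 'rV[R]_n.
Local Notation gamma := (@gaussian_measure R n).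
Local Notation mu := (@lebesgue_measure R).
Implicit Types (x y z : V) (a s t : R).

(** Clearing the denominator gives conditions that are uniform in x, the origin included, and
    visibly open in x. *)
Lemma lt_admissible_radius a s x : 0 < a ->
  (s < a * admissible_radius x) = (s < a) && (s * enorm x < a).
Proof.
move=> a0; rewrite /admissible_radius; case: eqP => [->|/eqP x0].
  by rewrite enorm0 mulr1 mulr0 a0 andbT.
have e0 : 0 < enorm x.
  by rewrite lt_def enorm_ge0 andbT; apply: contra x0 => /eqP/enorm_eq0 ->.
rewrite minr_pMr ?ltW// mulr1 lt_min; congr andb.
by rewrite ltr_pdivlMr.
Qed.

Lemma admissible_coneP a x y t : 0 < a -> admissible_cone a x (y, t) <->
  [/\ 0 < t, enorm (y - x) < t, t < a & t * enorm x < a].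
Proof.
move=> a0; rewrite /admissible_cone/= lt_admissible_radius//.
by split=> [[h1 h2 /andP[]]|[h1 h2 h3 h4]]; split => //; exact/andP.
Qed.

Variables (u : V -> R) (U : R).
Hypothesis cu : continuous u.
Hypothesis uU : forall x, `|u x| <= U.
Local Notation v s := (ou_semigroup s u).
Variable a : R.
Hypothesis a0 : 0 < a.
Local Notation T := (nontangential_maximal_function a u).

Let U0 : 0 <= U.
Proof. exact: le_trans (normr_ge0 _) (uU 0). Qed.

Lemma gaussian_eball_fin y t : 0 < t -> exists2 b, 0 < b & gamma (eball y t) = b%:E.
Proof.
move=> t0; have b0 := gaussian_eball_gt0 y t0.
have bf : gamma (eball y t) \is a fin_num.
  by rewrite ge0_fin_numE ?ltW// (le_lt_trans (probability_le1 _ (measurable_eball _ _)))// ltry.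
by exists (fine (gamma (eball y t))); rewrite ?fineK// -lte_fin fineK.
Qed.

Lemma ball_average_le y t s : 0 < t ->
  (\int[gamma]_(z in eball y t) (`|v s z| ^+ 2)%:E <= (U ^+ 2)%:E * gamma (eball y t))%E.
Proof.
move=> t0; have mb := measurable_eball y t.
have -> : ((U ^+ 2)%:E * gamma (eball y t) = \int[gamma]_(z in eball y t) (cst (U ^+ 2)%:E) z)%E.
  by rewrite integral_cst.
apply: ge0_le_integral => //.
- apply/measurable_EFinP; apply: measurable_funTS; apply: measurable_funX.
  apply: measurableT_comp => //.
  exact: (proj1 (ou_bounded s (bounded_measurable_u cu uU))).
- move=> z _; rewrite lee_fin; apply: ler_sqr_ge0 => //; exact: (ou_le cu uU).
Qed.

(** The supremum over an empty set would be -oo, so a point (x, t) of the cone is exhibited, with t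
    < a and t (|x| + 1) < a. *)
Lemma maximal_function_ge0 x : (0 <= T x)%E.
Proof.
pose t := (Num.min a (a / (enorm x + 1))) / 2.
have e1 : 0 < enorm x + 1 by rewrite ltr_wpDl ?enorm_ge0.
have m0 : 0 < Num.min a (a / (enorm x + 1)) by rewrite lt_min a0/= divr_gt0.
have t0 : 0 < t by rewrite divr_gt0.
have tm : t < Num.min a (a / (enorm x + 1)) by rewrite /t; lra.
have [ta te] : t < a /\ t < a / (enorm x + 1) by move: tm; rewrite lt_min => /andP[].
have c : admissible_cone a x (x, t).
  apply/admissible_coneP => //; split => //; first by rewrite subrr enorm0.
  move: te; rewrite ltr_pdivlMr//; apply: le_lt_trans.
  by rewrite ler_pM2l// lerDl.
by apply: ereal_sup_ge; exists (sqrte ((gamma (eball x t))^-1 * \int[gamma]_(z in eball x t) (`|v (t ^+ 2) z| ^+ 2)%:E)%E); [exists (x, t)|exact: sqrte_ge0].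
Qed.

Lemma maximal_function_le x : (T x <= U%:E)%E.
Proof.
apply: ge_ereal_sup => _ [[y t] /admissible_coneP[]// t0 _ _ _ <-]/=.
have [b b0 bE] := gaussian_eball_fin y t0.
have := @ball_average_le y t (t ^+ 2) t0; rewrite bE inver gt_eqF//.
move=> h; have U2 : (sqrte (U ^+ 2)%:E = U%:E)%E by rewrite /= sqrtr_sqr ger0_norm.
rewrite -U2 lee_sqrt ?lee_fin ?sqr_ge0//.
apply: le_trans (lee_wpmul2l _ h) _; first by rewrite lee_fin invr_ge0 ltW.
by rewrite -!EFinM mulrCA mulVf ?mulr1// gt_eqF.
Qed.

Lemma maximal_function_fin x : T x \is a fin_num.
Proof.
rewrite ge0_fin_numE ?maximal_function_ge0//.
exact: le_lt_trans (maximal_function_le x) (ltry _).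
Qed.

Let M x : R := fine (T x).

Lemma maximal_functionE x : T x = (M x)%:E.
Proof. by rewrite /M fineK// maximal_function_fin. Qed.

(** Membership of a fixed (y, t) in the cone at x is an open condition on x, so the maximal function
    is lower semicontinuous. *)
Lemma bounded_measurable_maximal_function : bounded_measurable M.
Proof.
apply: (@bounded_measurable_itv _ _ _ _ 0 U); last first.
  by move=> x; rewrite -!lee_fin -maximal_functionE maximal_function_ge0 maximal_function_le.
apply: (measurability _ (RGenOInfty.measurableE R)) => //.
move=> _ [_ [c ->]] <-; rewrite setTI; apply: measurable_eopen => x /=.
rewrite in_itv/= andbT -lte_fin -maximal_functionE => /ereal_sup_gt[_ [[y t] cyt <-] cw].
have [t0 yx ta tx] := proj1 (@admissible_coneP _ _ _ _ a0) cyt.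
exists (Num.min (t - enorm (y - x)) (a / t - enorm x)).
  by rewrite lt_min !subr_gt0 yx/= ltr_pdivlMr// mulrC.
move=> x'; rewrite /eball/= lt_min => /andP[h1 h2].
rewrite in_itv/= andbT -lte_fin -maximal_functionE.
apply: lt_le_trans cw _; apply: ereal_sup_ubound; exists (y, t) => //.
apply/admissible_coneP => //; split => //.
  apply: le_lt_trans (enorm_triangle x _ _) _.
  by rewrite (enorm_distC x) addrC -ltrBrDr.
rewrite mulrC -ltr_pdivlMr//; have := enormD (x' - x) x; rewrite subrK; lra.
Qed.

Lemma maximal_function_average x y t : 0 < t -> enorm (y - x) < t -> t < a -> t * enorm x < a ->
  (\int[gamma]_(z in eball y t) (v (t ^+ 2) z ^+ 2)%:E <= (M x ^+ 2)%:E * gamma (eball y t))%E.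
Proof.
move=> t0 yx ta tx.
have c : admissible_cone a x (y, t) by apply/admissible_coneP.
have [b b0 bE] := gaussian_eball_fin y t0.
set I := (\int[_]_(z in _) _)%E.
have I0 : (0 <= I)%E by apply: integral_ge0 => z _; rewrite lee_fin sqr_ge0.
have h : (sqrte ((b^-1)%:E * I) <= (M x)%:E)%E.
  rewrite -maximal_functionE; apply: ereal_sup_ubound; exists (y, t) => //=.
  rewrite bE inver gt_eqF//; congr (sqrte (_ * _)%E); apply: eq_integral => z _.
  by rewrite real_normK ?num_real.
have M0 : 0 <= M x by rewrite -lee_fin -maximal_functionE maximal_function_ge0.
have {h} : ((b^-1)%:E * I <= (M x ^+ 2)%:E)%E.
  have E : (sqrte (M x ^+ 2)%:E = (M x)%:E)%E by rewrite /= sqrtr_sqr ger0_norm.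
  by move: h; rewrite -E lee_sqrt// lee_fin sqr_ge0.
have b0' : (0 <= b%:E)%E by rewrite lee_fin ltW.
move=> /(lee_wpmul2l b0'); rewrite bE muleA -EFinM divff ?gt_eqF// mul1e => h.
by rewrite muleC.
Qed.

End cones.

(* A copy of [gamma \x mu]: sigma-finiteness of [_ \x _] is not inferred. *)
Definition cone_measure {R : realType} n :=
  (@gaussian_measure R n \x @lebesgue_measure R)%E.

HB.instance Definition _ {R : realType} n := Measure.on (@cone_measure R n).

Lemma cone_measure_sigma_finite {R : realType} n : sigma_finite setT (@cone_measure R n).
Proof.
have /sigma_finiteP[F [TF ndF Foo]] := sigma_finiteT (@lebesgue_measure R).
exists (fun k => setT `*` F k).
  by rewrite -setX_bigcupr -TF setXTT.
move=> k; have [mF Fk] := Foo k; split; first exact: measurableX.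
rewrite /cone_measure product_measure1E// lte_mul_pinfty//.
by rewrite ge0_fin_numE//; apply: le_lt_trans (probability_le1 _ _) (ltry _).
Qed.

HB.instance Definition _ {R : realType} n := Measure_isSigmaFinite.Build _ _ _ (@cone_measure R n)
  (cone_measure_sigma_finite n).

Section assembly.
Context {R : realType} {n : nat}.
Local Notation V := 'rV[R]_n.
Local Notation gamma := (@gaussian_measure R n).
Local Notation mu := (@lebesgue_measure R).
Implicit Types (x y z : V) (s t : R).
Variables (u : V -> R) (U : R).
Hypothesis cu : continuous u.
Hypothesis uU : forall x, `|u x| <= U.
Variables (p : V -> R) (eps : R).
Hypothesis eps0 : 0 < eps.
Hypothesis p_ge : forall x, eps <= p x.
Hypothesis bp : bounded_measurable p.
Variables (a : R).
Hypothesis a0 : 0 < a.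
Local Notation v s := (ou_semigroup s u).
Let kappa : R := a + a ^+ 2.
Hypothesis ou_average : forall x z s, 0 < s -> s <= kappa ->
  s * enorm x <= 4 * kappa + kappa ^+ 2 + 2 * kappa ^+ 2 -> enorm (z - x) < s ->
  (\int[gamma]_(w in eball z s) (v (s ^+ 2) w ^+ 2)%:E <= (p x ^+ 2)%:E * gamma (eball z s))%E.

Let kappa0 : 0 < kappa.
Proof. by rewrite /kappa addr_gt0// exprn_gt0. Qed.

Definition ball_constant (k : R) : R := expR (2 * k + k ^+ 2) * 2 ^+ n.

(** The quotient of the upper and lower bounds for gamma of a ball, times [n.+1] from the gradient
    bound; the 2 in the denominator cancels the 2 in [weight]. *)
Definition cone_constant (k : R) : R :=
  n.+1%:R * ball_constant k * expR (2 * k + k ^+ 2) / 2 * (n.+1%:R / 2) ^+ n.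

Let B := ball_constant kappa.
Let C := cone_constant kappa.

Let B0 : 0 < B.
Proof. by rewrite /B /ball_constant; apply: mulr_gt0; [exact: expR_gt0|exact: exprn_gt0]. Qed.

Let in_cone x y t := [&& 0 < t, enorm (y - x) < t, t < a & t * enorm x < a].

(** The origin of kappa: |y| <= |x| + t gives t |y| < a + a^2. *)
Let in_cone_bound x y t : in_cone x y t -> [/\ 0 < t, t < kappa & t * enorm y < kappa].
Proof.
move=> /and4P[t0 yx ta tx]; have a2 : 0 < a ^+ 2 by rewrite exprn_gt0.
split => //; first by rewrite /kappa; lra.
have h : enorm y <= enorm x + t by have := enormD (y - x) x; rewrite subrK; lra.
apply: le_lt_trans (ler_wpM2l (ltW t0) h) _; rewrite mulrDr /kappa.
have : t * t <= a ^+ 2 by rewrite expr2; apply: ler_pM => //; exact: ltW.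
by move: (t * enorm x) (t * t) tx => e f *; lra.
Qed.

(** 2t divided by the upper bound for gamma of the ball: integrating it over x in that ball gives at
    most 2t, the factor in the energy inequality. Unlike gamma of a ball it is explicit, hence
    visibly measurable in (y, t). *)
Let weight y t : R := 2 / B * t * t `^ (- n%:R) * (gaussian_density y)^-1.

Let weightE y t : 0 < t -> weight y t = 2 * t / (B * t ^+ n * gaussian_density y).
Proof.
move=> t0; rewrite /weight powRN powR_mulrn; last exact: ltW.
have tn : t ^+ n != 0 by rewrite gt_eqF// exprn_gt0.
move: (gaussian_density y) (t ^+ n) (gaussian_density_gt0 y) tn B B0 => g tn g0 tn0 b b0.
by field; rewrite tn0 !gt_eqF.
Qed.

Let F x (q : V * R) : \bar R :=
  if in_cone x q.1 q.2 then ((weight q.1 q.2)%:E * energy_limit u q)%E else 0%E.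

Let weight0 y t : 0 <= t -> 0 <= weight y t.
Proof.
move=> t0; rewrite /weight; apply: mulr_ge0; last by rewrite invr_ge0 gaussian_density_ge0.
apply: mulr_ge0; last exact: powR_ge0.
by apply: mulr_ge0 => //; apply: divr_ge0 => //; exact: ltW.
Qed.

Let F0 x q : (0 <= F x q)%E.
Proof.
rewrite /F; case: ifP => // /and4P[t0 _ _ _]; apply: mule_ge0; last exact: energy_limit_ge0.
by rewrite lee_fin; apply: weight0; exact: ltW.
Qed.

Let upper_ball y t : 0 < t -> t < kappa -> t * enorm y < kappa ->
  (gamma (eball y t) <= (B * t ^+ n * gaussian_density y)%:E)%E.
Proof.
move=> t0 tk ty; have h : enorm (y - y) + t <= t by rewrite subrr enorm0 add0r.
apply: le_trans (gaussian_eball_le t0 h) _; rewrite lee_fin exprMn /B /ball_constant.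
move: (gaussian_density y) (gaussian_density_ge0 y) => g g0.
have -> : expR (t * (2 * enorm y + t)) * g * (2 ^+ n * t ^+ n) =
   expR (t * (2 * enorm y + t)) * (2 ^+ n * t ^+ n * g) by ring.
have -> : expR (2 * kappa + kappa ^+ 2) * 2 ^+ n * t ^+ n * g =
  expR (2 * kappa + kappa ^+ 2) * (2 ^+ n * t ^+ n * g) by ring.
apply: ler_wpM2r; first by apply: mulr_ge0 => //; apply: mulr_ge0; apply: exprn_ge0 => //; exact: ltW.
rewrite ler_expR mulrDr.
have : t * t <= kappa ^+ 2 by rewrite expr2; apply: ler_pM => //; exact: ltW.
by move: (t * t) (mulrCA t 2 (enorm y)) => e ->; lra.
Qed.

Let lower_ball y t : 0 < t -> t < kappa -> t * enorm y < kappa ->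
  ((expR (- (2 * kappa + kappa ^+ 2)) * (2 / n.+1%:R) ^+ n * t ^+ n * gaussian_density y)%:E
    <= gamma (eball y t))%E.
Proof.
move=> t0 tk ty; apply: le_trans (gaussian_eball_ge y t0 (lexx t)).
rewrite lee_fin; move: (gaussian_density y) (gaussian_density_ge0 y) => g g0.
have -> : 2 * (t / n.+1%:R) = 2 / n.+1%:R * t by rewrite mulrAC mulrA.
rewrite [(2 / n.+1%:R * t) ^+ n]exprMn.
have q0 : 0 <= (2 / n.+1%:R : R) ^+ n by apply: exprn_ge0; apply: divr_ge0.
move: ((2 / n.+1%:R) ^+ n) q0 => q q0.
have tn0 : 0 <= t ^+ n by apply: exprn_ge0; exact: ltW.
move: (t ^+ n) tn0 => tn tn0.
have arith1 (e : R) : e * q * tn * g = e * (q * (tn * g)) by ring.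
have arith2 (e : R) : e * g * (q * tn) = e * (q * (tn * g)) by ring.
rewrite arith1 arith2; apply: ler_wpM2r; first by apply: mulr_ge0 => //; exact: mulr_ge0.
rewrite ler_expR lerN2 mulrDr.
have : t * t <= kappa ^+ 2 by rewrite expr2; apply: ler_pM => //; exact: ltW.
by move: (t * t) (mulrCA t 2 (enorm y)) => e ->; lra.
Qed.

Let square_function_integrand_le x y t : in_cone x y t ->
  ((gamma (eball y t))^-1 * (enorm (t *: gradient (v (t ^+ 2)) y) ^+ 2 / t)%:E
   <= C%:E * F x (y, t))%E.
Proof.
move=> xyt; have [t0 tk ty] := in_cone_bound xyt.
have [b b0 bE] := gaussian_eball_fin y t0.
have := lower_ball t0 tk ty; rewrite bE lee_fin => lb.
rewrite inver gt_eqF// /F/= xyt.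
have g0 := gaussian_density_gt0 y.
have -> : enorm (t *: gradient (v (t ^+ 2)) y) ^+ 2 / t = t * enorm (gradient (v (t ^+ 2)) y) ^+ 2.
  by rewrite enormZ ger0_norm ?ltW//; field; rewrite gt_eqF.
rewrite -EFinM mulrA [leLHS]EFinM.
have tb : (0 <= (b^-1 * t)%:E)%E by rewrite lee_fin; apply: mulr_ge0; rewrite ?invr_ge0; exact: ltW.
apply: le_trans (lee_wpmul2l tb (gradient_le_energy_limit cu uU y t0)) _.
rewrite !muleA -!EFinM; apply: lee_wpmul2r; first exact: energy_limit_ge0.
rewrite lee_fin weightE// /C /cone_constant -/B.
move: lb; rewrite expRN expr_div_n [(n.+1%:R / 2) ^+ n]expr_div_n.
have e0 : 0 < expR (2 * kappa + kappa ^+ 2) by exact: expR_gt0.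
have tn0 : 0 < t ^+ n by exact: exprn_gt0.
have two0 : 0 < (2 : R) ^+ n by exact: exprn_gt0.
have nn0 : 0 < (n.+1%:R : R) ^+ n by exact: exprn_gt0.
have n10 : 0 < (n.+1%:R : R) by [].
move: B B0 n10 g0 e0 tn0 two0 nn0 => b' b'0.
move: (n.+1%:R : R) (gaussian_density y) (expR _) (t ^+ n) (2 ^+ n) (n.+1%:R ^+ n).
move=> n1 g e tn two nn n10 g0 e0 tn0 two0 nn0 lb.
have -> : n1 * b' * e / 2 * (nn / two) * (2 * t / (b' * tn * g)) =
   (e^-1 * (two / nn) * tn * g)^-1 * (t * n1).
  by field; rewrite !gt_eqF.
rewrite -[b^-1 * t * n1]mulrA; apply: ler_wpM2r; first by apply: mulr_ge0; exact: ltW.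
rewrite lef_pV2 ?posrE//.
by apply: mulr_gt0 => //; apply: mulr_gt0 => //; apply: mulr_gt0; [rewrite invr_gt0|exact: divr_gt0].
Qed.

Lemma measurable_cone_integrand : measurable_fun setT (fun r : V * (V * R) => F r.1 r.2).
Proof.
have m1 : measurable_fun setT (fun r : V * (V * R) => r.1) by exact: measurable_fst.
have m21 : measurable_fun setT (fun r : V * (V * R) => r.2.1).
  exact: (measurableT_comp measurable_fst measurable_snd).
have m22 : measurable_fun setT (fun r : V * (V * R) => r.2.2).
  exact: (measurableT_comp measurable_snd measurable_snd).
have me : measurable_fun setT (@enorm R n) by exact: measurable_enorm.
apply: measurable_fun_ifT => //.
  apply: measurable_and; first exact: measurable_fun_ltr.
  apply: measurable_and.
    apply: measurable_fun_ltr => //; apply: (measurableT_comp me).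
    have := measurableT_comp (@measurable_lin R n 1 (-1)) (measurable_fun_pair m21 m1).
    by apply: eq_measurable_fun => r _ /=; rewrite scale1r scaleN1r.
  apply: measurable_and; apply: measurable_fun_ltr => //.
  by apply: measurable_funM => //; exact: (measurableT_comp me m1).
apply: emeasurable_funM; last first.
  exact: (measurableT_comp (measurable_energy_limit cu uU) measurable_snd).
apply/measurable_EFinP; apply: measurable_funM; last first.
  exact: (measurableT_comp (@measurable_gaussian_densityV R n) m21).
apply: measurable_funM; first exact: measurable_funM.
exact: (measurableT_comp (@measurable_powR R _) m22).
Qed.

Let square_function_le x : (conical_square_function a u x <=
  (2^-1)%:E * (((p x)^-1)%:E * (C%:E * \int[gamma \x mu]_q F x q) + (p x)%:E))%E.
Proof.
have px : 0 < p x := lt_le_trans eps0 (p_ge x).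
have C0 : 0 <= C by rewrite /C /cone_constant /ball_constant; nonneg.
have I0 : (0 <= C%:E * \int[gamma \x mu]_q F x q)%E.
  by apply: mule_ge0; [rewrite lee_fin|apply: integral_ge0 => q _; exact: F0].
apply: le_trans (sqrte_le_avg I0 px).
rewrite /conical_square_function lee_sqrt//.
rewrite -ge0_integralZl//; last exact: (measurableT_comp measurable_cone_integrand (pair1_measurable x)).
have E := @integral_mkcond _ _ R (gamma \x mu)%E (admissible_cone a x) (fun q : V * R =>
  ((gamma (eball q.1 q.2))^-1 * (enorm (q.2 *: gradient (v (q.2 ^+ 2)) q.1) ^+ 2 / q.2)%:E)%E).
apply: le_trans (_ : _ <= _)%E _; first by rewrite le_eqVlt; apply/orP; left; apply/eqP; exact: E.
apply: (@ge0_le_integral_nonmeasurable _ _ R (gamma \x mu)%E) => [q|[y t]].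
  rewrite patchE; case: ifP => // /set_mem[t0 _ _].
  have [b b0 bE] := gaussian_eball_fin q.1 t0.
  by rewrite bE inver gt_eqF// -EFinM lee_fin mulr_ge0 ?invr_ge0 ?divr_ge0 ?sqr_ge0// ltW.
rewrite patchE; case: ifPn => [/set_mem/(proj1 (admissible_coneP _ _ _ a0))[t0 yx ta tx]|_].
  by apply: square_function_integrand_le; apply/and4P.
by apply: mule_ge0; [rewrite lee_fin|exact: F0].
Qed.

Let fubini_integrand (q : V * R) : \bar R := (\int[gamma]_x (((p x)^-1)%:E * F x q))%E.

Let p0 x : 0 < p x. Proof. exact: lt_le_trans eps0 (p_ge x). Qed.

Let pF (r : V * (V * R)) : \bar R := (((p r.1)^-1)%:E * F r.1 r.2)%E.

Let pF0 r : (0 <= pF r)%E.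
Proof. by apply: mule_ge0; [rewrite lee_fin invr_ge0 ltW|exact: F0]. Qed.

Let measurable_pV : measurable_fun setT (fun x => (p x)^-1).
Proof.
have -> : (fun x => (p x)^-1) = (fun x => p x `^ (- 1)).
  by apply/funext => x; rewrite powR_inv1// ltW.
exact: (measurableT_comp (@measurable_powR R _) (proj1 bp)).
Qed.

Let mpF : measurable_fun setT pF.
Proof.
apply: emeasurable_funM; last exact: measurable_cone_integrand.
by apply/measurable_EFinP; exact: (measurableT_comp measurable_pV measurable_fst).
Qed.

(** Every x whose cone contains (y, t) lies in the ball of radius t <= s about y, so 1 / p(x) is at
    most G(y, s). *)
Let fubini_integrand_le y t s : 0 < t -> t < kappa -> t * enorm y < kappa -> t <= s ->
  (fubini_integrand (y, t) <= (2 * t * ball_sup p y s)%:E * energy_limit u (y, t))%E.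
Proof.
move=> t0 tk ty ts; have e0 := energy_limit_ge0 u (y, t).
have w0 := weight0 y (ltW t0); have s0 := lt_le_trans t0 ts.
have G0 := ball_sup_gt0 eps0 p_ge y s0.
have D0 : 0 < B * t ^+ n * gaussian_density y.
  by rewrite mulr_gt0 ?gaussian_density_gt0// mulr_gt0// exprn_gt0.
apply: (@le_trans _ _ (\int[gamma]_(x in eball y t)
   (cst ((ball_sup p y s * weight y t)%:E * energy_limit u (y, t))%E) x)%E).
  rewrite [leRHS]integral_mkcond; apply: ge0_le_integral_nonmeasurable => x; first exact: (pF0 (x, (y, t))).
  rewrite patchE /F/=; case: ifPn => [xyt|_]; last first.
    rewrite mule0; case: ifP => // _; apply: mule_ge0 => //.
    by rewrite lee_fin; apply: mulr_ge0 => //; exact: ltW.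
  have /and4P[_ yx _ _] := xyt.
  rewrite mem_set; last by rewrite /eball/= enorm_distC.
  rewrite muleA -EFinM; apply: lee_wpmul2r => //; rewrite lee_fin; apply: ler_wpM2r => //.
  rewrite /ball_sup lef_pV2 ?posrE ?(ball_inf_gt0 eps0 p_ge)//.
  by apply: (ball_inf_le p_ge); rewrite enorm_distC; exact: lt_le_trans yx ts.
rewrite integral_cst; last exact: measurable_eball.
have [b b0 bE] := gaussian_eball_fin y t0.
apply: (@le_trans _ _ (((ball_sup p y s * weight y t)%:E * energy_limit u (y, t)) * gamma (eball y t))%E) => //.
have := upper_ball t0 tk ty; rewrite bE lee_fin => bD.
rewrite muleAC -EFinM; apply: lee_wpmul2r => //; rewrite lee_fin weightE//.
apply: (@le_trans _ _ (ball_sup p y s * (2 * t / (B * t ^+ n * gaussian_density y)) * (B * t ^+ n * gaussian_density y))).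
  apply: ler_wpM2l => //; rewrite -weightE//; apply: mulr_ge0 => //; exact: ltW.
by rewrite -mulrA divfK ?gt_eqF// mulrC.
Qed.

Lemma square_function_integral_le :
  (\int[gamma]_x conical_square_function a u x <=
   ((C * scale_constant n kappa + 1) * \int[gamma]_x p x)%:E)%E.
Proof.
have C0 : 0 <= C by rewrite /C /cone_constant /ball_constant; nonneg.
have mFx : measurable_fun setT (fun x => \int[gamma \x mu]_q pF (x, q))%E.
  exact: (@measurable_fun_fubini_tonelli_F _ _ _ _ _ (@cone_measure R n) pF mpF pF0).
have IF0 x : (0 <= \int[gamma \x mu]_q pF (x, q))%E by apply: integral_ge0 => q _.
have mpE : measurable_fun setT (fun x => (p x)%:E) by apply/measurable_EFinP; exact: (proj1 bp).
have h : (\int[gamma]_x conical_square_function a u x <=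
    \int[gamma]_x ((2^-1)%:E * (C%:E * \int[gamma \x mu]_q pF (x, q) + (p x)%:E)))%E.
  apply: ge0_le_integral_nonmeasurable => x; first exact: sqrte_ge0.
  apply: le_trans (square_function_le x) _.
  rewrite muleCA -ge0_integralZl//.
  - exact: (measurableT_comp measurable_cone_integrand (pair1_measurable x)).
  - by rewrite lee_fin invr_ge0 ltW.
apply: le_trans h _.
rewrite ge0_integralZl//; last 2 first.
- by apply: emeasurable_funD => //; exact: measurable_funeM.
- by move=> x _; apply: adde_ge0; [apply: mule_ge0|rewrite lee_fin ltW].
rewrite ge0_integralD//; last 3 first.
- by move=> x _; apply: mule_ge0.
- exact: measurable_funeM.
- by move=> x _; rewrite lee_fin ltW.
rewrite ge0_integralZl//.
rewrite (@fubini_tonelli _ _ _ _ _ gamma (@cone_measure R n) pF mpF pF0) -(bounded_EFin_Rintegral _ bp).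
have main : (\int[gamma \x mu]_q fubini_integrand q <= (scale_constant n kappa * \int[gamma]_x p x)%:E)%E.
  apply: (energy_total cu uU eps0 p_ge bp kappa0 ou_average).
  - exact: (@measurable_fun_fubini_tonelli_G _ _ _ _ _ gamma pF mpF pF0).
  - by move=> q; apply: integral_ge0 => x _; exact: (pF0 (x, q)).
  - move=> y t yt; rewrite /fubini_integrand integral0_eq// => x _.
    rewrite /F/=; case: ifPn => [/in_cone_bound[t0 tk ty]|_]; last by rewrite mule0.
    case: yt => [yt|[yt|yt]]; exfalso.
    + by move: t0; rewrite ltNge yt.
    + by have := lt_trans tk yt; rewrite ltxx.
    + by have := lt_trans ty yt; rewrite ltxx.
  - move=> y t k k1 k2 ty.
    have t0 : 0 < t by apply: lt_le_trans k1; exact: scale_gt0.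
    have e0 := energy_limit_ge0 u (y, t).
    (* The scales only give t <= kappa and t |y| <= kappa; in the cases of equality no cone contains
       (y, t) and the integrand vanishes. *)
    have [/andP[tk ty']|nt] := boolP ((t < kappa) && (t * enorm y < kappa)).
      exact: fubini_integrand_le.
    rewrite /fubini_integrand integral0_eq.
      apply: mule_ge0 => //; rewrite lee_fin; apply: mulr_ge0; first by apply: mulr_ge0 => //; exact: ltW.
      by apply: ltW; apply: (ball_sup_gt0 eps0 p_ge); exact: scale_gt0.
    move=> x _; rewrite /F/=; case: ifPn => [/in_cone_bound[_ tk ty']|_]; last by rewrite mule0.
    by move: nt; rewrite tk ty'.
set I := (\int[gamma]_x p x).
have I0 : 0 <= I by apply: Rintegral_ge0 => x _; exact: ltW.
apply: (@le_trans _ _ ((2^-1)%:E * (C%:E * (scale_constant n kappa * I)%:E + I%:E))%E).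
  apply: lee_wpmul2l; first by rewrite lee_fin invr_ge0.
  by apply: leeD => //; apply: lee_wpmul2l; rewrite ?lee_fin.
rewrite (_ : (_ * (_ + _))%E = (2^-1 * (C * (scale_constant n kappa * I) + I))%:E)// lee_fin.
have -> : 2^-1 * (C * (scale_constant n kappa * I) + I) = 2^-1 * ((C * scale_constant n kappa + 1) * I) by ring.
have s0 : 0 <= scale_constant n kappa.
  have m0 : 0 <= @moment_constant R n := moment_constant_ge0.
  have A0 : 0 <= averaging_constant n (4 * kappa + kappa ^+ 2) kappa by rewrite /averaging_constant; nonneg.
  by rewrite /scale_constant; nonneg.
have : 0 <= (C * scale_constant n kappa + 1) * I.
  by apply: mulr_ge0 => //; apply: addr_ge0 => //; exact: mulr_ge0.
by move: (_ * I) => w w0; lra.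
Qed.

End assembly.

Lemma continuous_compact_support_bounded {R : realType} n (u : 'rV[R]_n -> R) :
  continuous_compact_support u -> exists U, forall x, `|u x| <= U.
Proof.
move=> [cu ks].
have : compact (u @` closure [set x | u x != 0]).
  by apply: continuous_compact => //; exact: continuous_subspaceT.
move=> /compact_bounded[M [_ hM]]; exists (`|M| + 1) => x.
have [->|ux] := eqVneq (u x) 0; first by rewrite normr0 addr_ge0.
apply: hM; first by rewrite (le_lt_trans (ler_norm M))// ltrDl.
by exists x => //; exact: subset_closure.
Qed.

Theorem theorem1p1 (R : realType) (n : nat) (n_ge1 : (1 <= n)%N)
    (a : R) (a_gt0 : 0 < a) :
  exists2 a' : R, 0 < a' &
  exists C : R, forall u : 'rV[R]_n -> R, continuous_compact_support u ->
    ('N[gaussian_measure]_1[conical_square_function a u]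
     <= C%:E * 'N[gaussian_measure]_1[nontangential_maximal_function a' u])%E.
Proof.
pose k := a + a ^+ 2.
have k0 : 0 < k by rewrite addr_gt0// exprn_gt0.
(* Averages are needed for s <= k and s |x| <= 4k + 3k^2; [a'] exceeds both bounds, as the cone
   conditions are strict. *)
pose a' := 5 * k + 3 * k ^+ 2 + 1.
have a'0 : 0 < a' by rewrite !addr_gt0// mulr_gt0// exprn_gt0.
exists a' => //.
pose C := @cone_constant R n k * @scale_constant R n k + 1.
have C1 : 0 < C.
  have m0 : 0 <= @moment_constant R n := moment_constant_ge0.
  have A0 : 0 <= averaging_constant n (4 * k + k ^+ 2) k by rewrite /averaging_constant; nonneg.
  have h1 : 0 <= @cone_constant R n k by rewrite /cone_constant /ball_constant; nonneg.
  have h2 : 0 <= @scale_constant R n k by rewrite /scale_constant; nonneg.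
  by apply: ltr_wpDl => //; exact: mulr_ge0.
exists C => u ucs; have [cu _] := ucs.
have [U uU] := continuous_compact_support_bounded ucs.
pose M x := fine (nontangential_maximal_function a' u x).
have ME x : nontangential_maximal_function a' u x = (M x)%:E := maximal_functionE cu uU a'0 x.
have bM : bounded_measurable M := bounded_measurable_maximal_function cu uU a'0.
have M0 x : 0 <= M x by rewrite -lee_fin -ME; exact: maximal_function_ge0.
rewrite !Lnorm1.
under [X in (X <= _)%E]eq_integral do rewrite gee0_abs ?sqrte_ge0//.
under [X in (_ <= _ * X)%E]eq_integral do rewrite ME /= ger0_norm//.
rewrite -(bounded_EFin_Rintegral _ bM) -EFinM; apply/lee_addgt0Pr => e e0.
(* Since gamma has mass 1, replacing M by M + d costs C d = e. *)
pose d := e / C.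
have d0 : 0 < d by rewrite divr_gt0.
pose p x := M x + d.
have bp : bounded_measurable p by apply: bounded_measurableD => //; exact: bounded_measurable_cst.
have p_ge x : d <= p x by rewrite lerDr.
have avg x z s : 0 < s -> s <= k -> s * enorm x <= 4 * k + k ^+ 2 + 2 * k ^+ 2 ->
    enorm (z - x) < s ->
    (\int[gaussian_measure]_(w in eball z s) (ou_semigroup (s ^+ 2) u w ^+ 2)%:E
     <= (p x ^+ 2)%:E * gaussian_measure (eball z s))%E.
  move=> s0 sk sx zx; have k20 : 0 < k ^+ 2 by rewrite exprn_gt0.
  have sa : s < a' by rewrite /a'; lra.
  have sxa : s * enorm x < a' by apply: le_lt_trans sx _; rewrite /a'; lra.
  apply: le_trans (maximal_function_average cu uU a'0 s0 zx sa sxa) _.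
  apply: lee_wpmul2r => //; rewrite lee_fin; apply: ler_sqr_ge0; first exact: M0.
  by rewrite lerDl ltW.
apply: le_trans (square_function_integral_le cu uU d0 p_ge bp a_gt0 avg) _.
rewrite bounded_RintegralD//; last exact: bounded_measurable_cst.
rewrite probability_Rintegral_cst -EFinD lee_fin -/C mulrDr.
by rewrite /d mulrCA divff ?mulr1// gt_eqF.
Qed.
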